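(* Let $L=\{(i,j)\in\mathbb{Z}^2 : j\le -1\}\cup\{(i,0): i\le -1\}$. Let $\{X_{(s,t)}\}_{(s,t)\in\mathbb{Z}^2}$ be a weak-stationary random field with no deterministic part with respect to the half-plane past $S=L$. Let $U_1,U_2$ be the commuting unitary operators on $H=\overline{\mathrm{span}}\{X_{(s,t)}:(s,t)\in\mathbb{Z}^2\}$ with $U_1X_{(s,t)}=X_{(s-1,t)}$, $U_2X_{(s,t)}=X_{(s,t-1)}$, let $H^{(0,0)}=\overline{\mathrm{span}}\{X_{(s,t)}:(s,t)\in L\}$ be the past of $X_{(0,0)}$, and let $V_1=U_1|_{H^{(0,0)}}$, $V_2=U_2|_{H^{(0,0)}}$ (isometries on $H^{(0,0)}$). Then there is a decomposition $H^{(0,0)}=H_t^{(0,0)}\oplus H_e^{(0,0)}$ such that: (1) $H_t^{(0,0)}$ and $H_e^{(0,0)}$ reduce $V_1$ and $V_2$; (2) $(V_1|_{H_t^{(0,0)}},V_2|_{H_t^{(0,0)}})$ is a totally non-unitary pair (with respect to the semigroup $-L$); (3) $V_1|_{H_e^{(0,0)}}$ is unitary and $V_2|_{H_e^{(0,0)}}$ is a unilateral shift. Moreover: (4) there is a vector $v\in\ker V_2^*\cap H_e^{(0,0)}$ which is cyclic for $V_1|_{\ker V_2^*\cap H_e^{(0,0)}}$, and $$H_e^{(0,0)}=\bigoplus_{n\ge 0}\overline{\mathrm{span}}\{V_2^nV_1^mv: m=0,\dots,K-1\},\qquad K=\dim\ker V_2^*\le\infty$$ (for $K=\infty$ the index $m$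 runs over all non-negative integers); (5) $(V_1|_{H_t^{(0,0)}},V_2|_{H_t^{(0,0)}})$ is a pair given by the diagram $-L\cup\{(0,0)\}$, and $$H_t^{(0,0)}=\bigoplus_{(k,l)\in -L\cup\{(0,0)\}}V^{(k,l)}\ker V_1^*,$$ where, for $(k,l)\in -L\cup\{(0,0)\}$, $V^{(k,l)}=V_1^kV_2^l$ if $k\ge 0$ and $V^{(k,l)}=(V_1^* )^{|k|}V_2^l$ if $k<0$.
   Context: A random field $\{X_{(s,t)}\}_{(s,t)\in\mathbb{Z}^2}$ (complex random variables on one probability space) is weak-stationary if $\mathbb{E}|X_{(s,t)}|^2<\infty$, $\mathbb{E}X_{(s,t)}$ does not depend on $(s,t)$, and $\mathbb{E}[X_{(s,t)}\overline{X_{(s,t)+(p,q)}}]=\gamma(p,q)$ depends only on $(p,q)$. It is considered in the Hilbert space $L^2$ with inner product $\langle X,Y\rangle=\mathbb{E}[X\overline Y]$. For a past $S\subset\mathbb{Z}^2$ put $H^{(i,j)}=\overline{\mathrm{span}}\{X_{(s,t)}:(s-i,t-j)\in S\}$. The field has no deterministic part if $\bigcap_{(i,j)\in\mathbb{Z}^2}H^{(i,j)}=\{0\}$ (equivalently, no non-zero subspace reduces $(V_1,V_2)$ to a pair of unitary operators). $-L=\{(k,l):(-k,-l)\in L\}$. Let $T\subset\mathbb{Z}^2$ be a semigroup with $T\cap(-T)=\emptyset$ containing all pairs of positive integers (here $T=-S$), and let $(V_1,V_2)$ be a commuting pair of isometries on a Hilbert space $G$ such that, for all $(m,n)\in T$,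 the operator $V^{(m,n)}$ is an isometry, where $V^{(m,n)}=V_1^mV_2^n$ if $m,n\ge0$, $V^{(m,n)}=(V_1^* )^{|m|}V_2^n$ if $m<0\le n$, and $V^{(m,n)}=(V_2^* )^{|n|}V_1^m$ if $n<0\le m$. The pair is quasi-unitary (with respect to $T$) if the closure of $\bigcup V^{(k,l)*}V^{(m,n)}G$, union over $(k,l),(m,n)\in T$ with $(m,n)-(k,l)\in T$, equals $G$. It is totally non-unitary if no non-trivial subspace reduces $(V_1,V_2)$ to a quasi-unitary pair. A diagram is a set $J\subset\mathbb{Z}^2$ with $J+(\mathbb{Z}_{\ge0})^2\subset J$. For a Hilbert space $\mathcal{H}$, let $H_J=\{f\in L^2_{\mathcal H}(\mathbb{T}^2):\hat f_{i,j}=0 \text{ for }(i,j)\notin J\}$ ($L^2_{\mathcal H}$: square integrable $\mathcal{H}$-valued functions on the 2-torus; $\hat f_{i,j}$: Fourier coefficients). A pair of isometries is given by the diagram $J$ (and the space $\mathcal{H}$) if it is unitarily equivalent to $(M_{z_1}|_{H_J},M_{z_2}|_{H_J})$, multiplications by the coordinate functions. A vector $v\in M$ is cyclic for an operator $A$ on $M$ if $\overline{\mathrm{span}}\{A^mv:m\ge0\}=M$. *)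

(* Defs.v *)
From HB Require Import structures.
From mathcomp Require Import all_boot all_order all_algebra.
From mathcomp Require Import complex generic_quotient ring_quotient.
From mathcomp Require Import ring lra.
From mathcomp Require Import all_classical all_reals all_analysis.
From mathcomp Require Import measurable_realfun.

Set Implicit Arguments.
Unset Strict Implicit.
Unset Printing Implicit Defensive.
Import Order.TTheory GRing.Theory Num.Theory.
Import numFieldNormedType.Exports.

Local Open Scope classical_set_scope.
Local Open Scope ring_scope.
Local Open Scope complex_scope.

(* Linear in the first argument, as in <X, Y> = E[X conj(Y)]. The norm of a
   normedModType over R[i] takes its values in R[i]. *)
HB.mixin Record NormedModule_isInnerProduct (R : realType) E
    & NormedModule R[i] E := {
  inner : E -> E -> R[i];
  innerDl : forall x y z, inner (x + y) z = inner x z + inner y z;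
  innerZl : forall a x y, inner (a *: x) y = a * inner x y;
  innerC : forall x y, inner x y = (inner y x)^*%C;
  innerxx : forall x, inner x x = `|x| ^+ 2
}.

#[short(type="innerProductType")]
HB.structure Definition InnerProduct (R : realType) :=
  {E of NormedModule R[i] E & NormedModule_isInnerProduct R E}.

#[short(type="hilbertType")]
HB.structure Definition Hilbert (R : realType) :=
  {E of InnerProduct R E & Complete E}.

HB.factory Record Lmodule_isInnerProduct (R : realType) E
    & GRing.Lmodule R[i] E := {
  inner : E -> E -> R[i];
  innerDl : forall x y z, inner (x + y) z = inner x z + inner y z;
  innerZl : forall a x y, inner (a *: x) y = a * inner x y;
  innerC : forall x y, inner x y = (inner y x)^*%C;
  inner_ge0 : forall x, 0 <= inner x x;
  inner_eq0 : forall x, inner x x = 0 -> x = 0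
}.

HB.builders Context R E & Lmodule_isInnerProduct R E.

Let norm x : R[i] := (Num.sqrt (complex.Re (inner x x)))%:C.

Let innerDr x y z : inner x (y + z) = inner x y + inner x z.
Proof. by rewrite innerC innerDl rmorphD/= -!innerC. Qed.

Let innerZr a x y : inner x (a *: y) = a^*%C * inner x y.
Proof. by rewrite innerC innerZl rmorphM/= -innerC. Qed.

Let innerRe x : inner x x = (complex.Re (inner x x))%:C.
Proof. by apply/esym/RRe_real/ger0_real/inner_ge0. Qed.

Let Re_ge0 x : 0 <= complex.Re (inner x x).
Proof. by rewrite -ler0c -innerRe inner_ge0. Qed.

Let norm_ge0 x : 0 <= norm x.
Proof. by rewrite ler0c sqrtr_ge0. Qed.

Let sqr_norm x : norm x ^+ 2 = inner x x.
Proof. by rewrite -rmorphXn/= sqr_sqrtr ?Re_ge0// -innerRe. Qed.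

Let normZ (l : R[i]) x : norm (l *: x) = `|l| * norm x.
Proof.
apply/eqP; rewrite -(@eqrXn2 _ 2)// ?norm_ge0// ?mulr_ge0// ?norm_ge0//.
by rewrite exprMn !sqr_norm innerZl innerZr mulrA normCK.
Qed.

Let norm0_eq0 x : norm x = 0 -> x = 0.
Proof.
by move=> x0; apply: inner_eq0; rewrite -sqr_norm x0 expr0n.
Qed.

Let CS x y : `|inner x y| <= norm x * norm y.
Proof.
have [->|y0] := eqVneq y 0.
  have -> : inner x 0 = 0 by rewrite -(scale0r 0) innerZr conjc0 mul0r.
  by rewrite normr0 mulr_ge0// norm_ge0.
have ny0 : inner y y != 0 by apply: contra_neq y0 => /inner_eq0.
have ny : 0 < inner y y by rewrite lt_neqAle eq_sym ny0 inner_ge0.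
rewrite -(@ler_pXn2r _ 2)// ?nnegrE ?mulr_ge0// ?norm_ge0//.
rewrite exprMn !sqr_norm normCK.
have yy : (inner y y)^*%C = inner y y by rewrite -innerC.
have yx : inner y x = (inner x y)^*%C by rewrite innerC.
set u := inner x y in yx *; set v := inner y y in ny ny0 yy *.
set w := inner x x.
have := inner_ge0 (x + (- (u / v)) *: y).
rewrite innerDl !innerDr !innerZl !innerZr yx -/u -/v -/w.
have -> : (- (u / v))^*%C = - (u^*%C / v).
  by rewrite rmorphN/= rmorphM/= fmorphV/= yy.
set c := u^*%C.
have -> : w + - (c / v) * u + (- (u / v) * c + - (u / v) * (- (c / v) * v)) =
    w - u * c / v by field.
by rewrite subr_ge0 ler_pdivrMr.
Qed.

Let normD x y : norm (x + y) <= norm x + norm y.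
Proof.
rewrite -(@ler_pXn2r _ 2)// ?nnegrE ?addr_ge0// ?norm_ge0//.
rewrite sqrrD !sqr_norm innerDl !innerDr addrA -!addrA lerD2l !addrA lerD2r.
have -> : inner y x = (inner x y)^*%C by rewrite innerC.
rewrite addcJ -mulr2n -[leRHS]mulr_natl; apply: ler_wpM2l; first by rewrite ler0n.
apply: le_trans (CS x y); rewrite normc_def lecR.
rewrite (le_trans (ler_norm _))// -sqrtr_sqr ler_sqrt ?addr_ge0 ?sqr_ge0//.
by rewrite lerDl sqr_ge0.
Qed.

HB.instance Definition _ := @Lmodule_isNormed.Build R[i] E norm normD normZ
  norm0_eq0.

HB.instance Definition _ := @NormedModule_isInnerProduct.Build R E inner
  innerDl innerZl innerC (fun x => esym (sqr_norm x)).

HB.end.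

Section scalars.
Variable R : realType.

Let conj_sym (x y : R[i]^o) : x * y^*%C = (y * x^*%C)^*%C.
Proof. by rewrite rmorphM/= conjcK mulrC. Qed.

Let conj_norm (x : R[i]^o) : x * x^*%C = `|x| ^+ 2.
Proof. by rewrite normCK. Qed.

HB.instance Definition _ := @NormedModule_isInnerProduct.Build R R[i]^o
  (fun x y => x * y^*%C) (fun x y z => mulrDl x y z^*%C)
  (fun a x y => esym (mulrA a x y^*%C)) conj_sym conj_norm.

End scalars.

Section inner_theory.
Variables (R : realType) (E : innerProductType R).
Implicit Types x y z : E.

(* the norm as a real number *)
Definition nrm x : R := complex.Re `|x|.

Lemma nrmE x : (nrm x)%:C = `|x|.
Proof. by apply/RRe_real/ger0_real. Qed.

Lemma nrm_ge0 x : 0 <= nrm x.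
Proof. by rewrite -ler0c nrmE. Qed.

Lemma innerDr x y z : inner x (y + z) = inner x y + inner x z.
Proof. by rewrite innerC innerDl rmorphD/= -!innerC. Qed.

Lemma innerZr a x y : inner x (a *: y) = a^*%C * inner x y.
Proof. by rewrite innerC innerZl rmorphM/= -innerC. Qed.

Lemma inner0l x : inner 0 x = 0.
Proof. by rewrite -(scale0r 0) innerZl mul0r. Qed.

Lemma inner0r x : inner x 0 = 0.
Proof. by rewrite innerC inner0l conjc0. Qed.

Lemma innerNl x y : inner (- x) y = - inner x y.
Proof. by rewrite -scaleN1r innerZl mulN1r. Qed.

Lemma innerNr x y : inner x (- y) = - inner x y.
Proof. by rewrite innerC innerNl rmorphN/= -innerC. Qed.

Lemma nrm2E x : nrm x ^+ 2 = complex.Re (inner x x).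
Proof. by apply: complexI; rewrite rmorphXn/= nrmE innerxx RRe_real// rpredX. Qed.

Lemma inner_eq0 x : inner x x = 0 -> x = 0.
Proof. by rewrite innerxx => /eqP; rewrite expf_eq0/= normr_eq0 => /eqP. Qed.

Lemma nrm0_eq0 x : nrm x = 0 -> x = 0.
Proof. by move=> x0; apply/eqP; rewrite -normr_eq0 -nrmE x0. Qed.

Lemma Re_inner_polar x y :
  complex.Re (inner x y) = (nrm (x + y) ^+ 2 - nrm (x - y) ^+ 2) / 4.
Proof.
rewrite !nrm2E !(innerDl, innerDr) !(innerNl, innerNr).
rewrite (innerC y x); case: (inner x y) => a b.
case: (inner x x) => c d; case: (inner y y) => e f /=; lra.
Qed.

Lemma Im_inner x y : complex.Im (inner x y) = complex.Re (inner x ('i *: y)).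
Proof. by rewrite innerZr; case: (inner x y) => a b /=; ring. Qed.

Lemma nrmZ a x : nrm (a *: x) ^+ 2 =
  (complex.Re a ^+ 2 + complex.Im a ^+ 2) * nrm x ^+ 2.
Proof.
apply: complexI; rewrite [RHS]rmorphM/= add_Re2_Im2.
by rewrite !rmorphXn/= !nrmE normrZ exprMn.
Qed.

Lemma nrmDsq x y : nrm (x + y) ^+ 2 <= 2 * nrm x ^+ 2 + 2 * nrm y ^+ 2.
Proof.
have : nrm (x + y) ^+ 2 + nrm (x - y) ^+ 2 = 2 * nrm x ^+ 2 + 2 * nrm y ^+ 2.
  rewrite !nrm2E !(innerDl, innerDr) !(innerNl, innerNr).
  rewrite (innerC y x); case: (inner x y) => a b.
  case: (inner x x) => c d; case: (inner y y) => e f /=; ring.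
by move=> <-; rewrite lerDl sqr_ge0.
Qed.

Lemma Re_inner_bound x y : `|complex.Re (inner x y)| <= nrm x ^+ 2 + nrm y ^+ 2.
Proof.
have := sqr_ge0 (nrm (x + y)); have := sqr_ge0 (nrm (x - y)).
rewrite !nrm2E !(innerDl, innerDr) !(innerNl, innerNr).
rewrite (innerC y x); case: (inner x y) => a b.
have := sqr_ge0 (nrm x); have := sqr_ge0 (nrm y); rewrite !nrm2E.
case: (inner x x) => c d; case: (inner y y) => e f /=.
by move=> *; rewrite ler_norml; apply/andP; split; lra.
Qed.

Lemma nrm2_le (D : set E) x (c : R) : closure D x ->
  (nrm x ^+ 2 <= c) <->
  (forall d, D d -> 2 * complex.Re (inner x d) - nrm d ^+ 2 <= c).
Proof.
have key d : nrm (x - d) ^+ 2 =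
    nrm x ^+ 2 - (2 * complex.Re (inner x d) - nrm d ^+ 2).
  rewrite !nrm2E !(innerDl, innerDr) !(innerNl, innerNr).
  rewrite (innerC d x); case: (inner x d) => a b.
  by case: (inner x x) => r t; case: (inner d d) => e f /=; ring.
move=> Dx; split=> [xc d _|H].
  by have := sqr_ge0 (nrm (x - d)); rewrite key; lra.
apply/ler_addgt0Pl => e e0.
have /Dx [d [Dd]] : nbhs x (ball x (Num.sqrt e)%:C).
  by apply: nbhsx_ballx; rewrite (ltcR 0) sqrtr_gt0.
rewrite -ball_normE/= -nrmE ltcR => de.
have := H _ Dd; have : nrm (x - d) ^+ 2 <= e.
  by rewrite -(sqr_sqrtr (ltW e0)) ler_pXn2r// ?nnegrE ?nrm_ge0// ltW.
by rewrite key; lra.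
Qed.

End inner_theory.

Section strong_measurability.
Context d (T : measurableType d) (R : realType) (E : innerProductType R).
Implicit Types f g : T -> E.

(* Weakly measurable with separable range, i.e. strongly measurable by Pettis. *)
Definition strongly_measurable f :=
  (forall h : E,
     measurable_fun setT (fun w => complex.Re (inner (f w) h)) /\
     measurable_fun setT (fun w => complex.Im (inner (f w) h))) /\
  (exists2 D : set E, countable D & forall w, closure D (f w)).

Lemma strongly_measurable0 : strongly_measurable (fun=> 0).
Proof.
split=> [h|]; first by rewrite inner0l; split; exact: measurable_cst.
by exists [set 0] => // w; exact: subset_closure.
Qed.

Lemma strongly_measurableZ a f :
  strongly_measurable f -> strongly_measurable (fun w => a *: f w).
Proof.
move=> [mf [D cD fD]]; split=> [h|].
  have [mr mi] := mf h; case: a => a b; split.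
    rewrite (_ : (fun w => _) = (fun w => a * complex.Re (inner (f w) h) -
        b * complex.Im (inner (f w) h))).
      by apply: measurable_funB; apply: measurable_funM.
    by apply/funext => w; rewrite innerZl; case: (inner _ _).
  rewrite (_ : (fun w => _) = (fun w => a * complex.Im (inner (f w) h) +
      b * complex.Re (inner (f w) h))).
    by apply: measurable_funD; apply: measurable_funM.
  by apply/funext => w; rewrite innerZl; case: (inner _ _).
exists ((fun x => a *: x) @` D); first exact: sub_countable (card_image_le _ _) _.
move=> w B /(@scaler_continuous _ _ a (f w)) /fD[x [Dx Bx]].
by exists (a *: x); split => //; exists x.
Qed.

Lemma strongly_measurableD f g : strongly_measurable f ->
  strongly_measurable g -> strongly_measurable (fun w => f w + g w).
Proof.
move=> [mf [D cD fD]] [mg [D' cD' gD']]; split=> [h|].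
  have [mr mi] := mf h; have [mr' mi'] := mg h; split.
    rewrite (_ : (fun w => _) = (fun w => complex.Re (inner (f w) h) +
        complex.Re (inner (g w) h))); first exact: measurable_funD.
    by apply/funext => w; rewrite innerDl; case: (inner _ _); case: (inner _ _).
  rewrite (_ : (fun w => _) = (fun w => complex.Im (inner (f w) h) +
      complex.Im (inner (g w) h))); first exact: measurable_funD.
  by apply/funext => w; rewrite innerDl; case: (inner _ _); case: (inner _ _).
exists ((fun x => x.1 + x.2) @` (D `*` D')).
  by apply: sub_countable (card_image_le _ _) _; exact: countableX.
move=> w B /(@add_continuous E (f w, g w)) [[U V]/= [fU gV] UV].
have [x [Dx Ux]] := fD w _ fU; have [y [Dy Vy]] := gD' w _ gV.
by exists (x + y); split; [exists (x, y) | exact: (UV (x, y))].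
Qed.

Lemma measurable_nrm2 f : strongly_measurable f ->
  measurable_fun setT (fun w => nrm (f w) ^+ 2).
Proof.
move=> [mf [D cD fD]] mT; apply: (measurability _ (RGenOInfty.measurableE R)) => //.
move=> /= _ [_ [c ->] <-]; rewrite setTI.
pose G (d : D) := [set w | c < 2 * complex.Re (inner (f w) (\val d)) - nrm (\val d) ^+ 2].
rewrite (_ : _ @^-1` _ = \bigcup_d G d); last first.
  apply/seteqP; split => w /=; rewrite in_itv/= andbT.
    rewrite ltNge => /negP H.
    apply: contrapT => K; apply: H; apply/(nrm2_le c (fD w)) => x Dx.
    rewrite leNgt; apply/negP => cx; apply: K.
    by exists (SigSub (mem_set Dx)).
  move=> [x _ /= H]; rewrite ltNge; apply/negP => /(nrm2_le c (fD w)).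
  by move=> /(_ _ (set_valP x)); rewrite leNgt H.
apply: countable_bigcupT_measurable => [|x].
  by rewrite (eq_countable (card_setT _)).
have mr : measurable_fun setT (fun w => 2 * complex.Re (inner (f w) (\val x)) - nrm (\val x) ^+ 2).
  by apply: measurable_funB => //; apply: measurable_funM => //; have [] := mf (\val x).
rewrite -[G x]setTI /G.
have := mr measurableT `]c, +oo[%classic (measurable_itv _).
by congr measurable; apply/seteqP; split => w /=; rewrite in_itv/= andbT.
Qed.

Lemma measurable_Re_inner f g : strongly_measurable f ->
  strongly_measurable g -> measurable_fun setT (fun w => complex.Re (inner (f w) (g w))).
Proof.
move=> mf mg; under eq_fun => w do rewrite Re_inner_polar.
apply: measurable_funM => //; apply: measurable_funB.
  exact/measurable_nrm2/strongly_measurableD.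
under eq_fun => w do rewrite -scaleN1r.
exact/measurable_nrm2/strongly_measurableD/strongly_measurableZ.
Qed.

Lemma measurable_Im_inner f g : strongly_measurable f ->
  strongly_measurable g -> measurable_fun setT (fun w => complex.Im (inner (f w) (g w))).
Proof.
move=> mf mg; under eq_fun => w do rewrite Im_inner.
exact/measurable_Re_inner/strongly_measurableZ.
Qed.

End strong_measurability.

Section L2fun.
Context d (T : measurableType d) (R : realType).
Context (mu : {measure set T -> \bar R}) (E : innerProductType R).
Implicit Types f g : T -> E.

Definition square_integrable f :=
  strongly_measurable f /\ (\int[mu]_w (nrm (f w) ^+ 2)%:E < +oo)%E.

Definition L2pred : {pred T -> E} := fun f => `[< square_integrable f >].

Lemma integrable_nrm2 f : square_integrable f ->
  mu.-integrable setT (fun w => (nrm (f w) ^+ 2)%:E).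
Proof.
move=> [mf foo]; apply/integrableP; split.
  exact/measurable_EFinP/measurable_nrm2.
by under eq_integral => w _ do rewrite gee0_abs ?lee_fin ?sqr_ge0//.
Qed.

Lemma square_integrableD f g : square_integrable f -> square_integrable g ->
  square_integrable (fun w => f w + g w).
Proof.
move=> sf sg; have mfg := strongly_measurableD sf.1 sg.1; split => //.
have h : mu.-integrable setT
    (fun w => (2 * nrm (f w) ^+ 2)%:E + (2 * nrm (g w) ^+ 2)%:E)%E.
  apply: integrableD => //.
    under eq_fun => w do rewrite EFinM.
    by apply: integrableZl => //; exact: integrable_nrm2.
  under eq_fun => w do rewrite EFinM.
  by apply: integrableZl => //; exact: integrable_nrm2.
have : mu.-integrable setT (fun w => (nrm (f w + g w) ^+ 2)%:E).
  apply: le_integrable h => //; first exact/measurable_EFinP/measurable_nrm2.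
  move=> w _; rewrite -EFinD !gee0_abs ?lee_fin ?sqr_ge0 ?nrmDsq//.
  by rewrite addr_ge0// mulr_ge0// sqr_ge0.
move/integrableP => -[_].
by under eq_integral => w _ do rewrite gee0_abs ?lee_fin ?sqr_ge0//.
Qed.

Lemma square_integrableZ a f : square_integrable f ->
  square_integrable (fun w => a *: f w).
Proof.
move=> sf; split; first exact: strongly_measurableZ sf.1.
under eq_integral => w _ do rewrite nrmZ EFinM.
rewrite ge0_integralZl//=; last first.
- by rewrite lee_fin addr_ge0// sqr_ge0.
- by move=> w _; rewrite lee_fin sqr_ge0.
- exact/measurable_EFinP/measurable_nrm2/sf.1.
apply: lte_mul_pinfty => //; last exact: sf.2.
by rewrite lee_fin addr_ge0// sqr_ge0.
Qed.

Lemma square_integrable0 : square_integrable (fun=> 0).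
Proof.
split; first exact: strongly_measurable0.
rewrite (eq_integral (cst 0%E)) ?integral0// => w _.
by rewrite /nrm normr0 expr0n.
Qed.

Lemma L2pred_submod : submod_closed L2pred.
Proof.
split; first exact/asboolP/square_integrable0.
move=> a f g /asboolP sf /asboolP sg; apply/asboolP.
by apply: square_integrableD => //; exact: square_integrableZ.
Qed.

HB.instance Definition _ :=
  GRing.isSubmodClosed.Build R[i] (T -> E) L2pred L2pred_submod.

Record L2fun := MkL2fun { L2val :> T -> E; _ : L2val \in L2pred }.

HB.instance Definition _ := [isSub for L2val].
HB.instance Definition _ := [Choice of L2fun by <:].
HB.instance Definition _ := [SubChoice_isSubLmodule of L2fun by <:].

Lemma L2funP (u : L2fun) : square_integrable u.
Proof. by case: u => f /= /asboolP. Qed.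

Definition ae_null : {pred L2fun} :=
  fun u => `[< {ae mu, forall w, u w = 0} >].

Lemma ae_null_zmod : zmod_closed ae_null.
Proof.
split; first by apply/asboolP; apply: aeW.
move=> f g /asboolP f0 /asboolP g0; apply/asboolP.
near=> w; change (L2val f w - L2val g w = 0).
by rewrite (near f0 w)// (near g0 w)// subr0.
Unshelve. all: by end_near. Qed.

HB.instance Definition _ := GRing.isZmodClosed.Build L2fun ae_null ae_null_zmod.

End L2fun.

Definition cintegral d (T : measurableType d) (R : realType)
    (mu : {measure set T -> \bar R}) (f : T -> R[i]) : R[i] :=
  (Rintegral mu setT (fun w => complex.Re (f w))) +i*
  (Rintegral mu setT (fun w => complex.Im (f w))).

Section L2space.
Context d (T : measurableType d) (R : realType).
Context (mu : {measure set T -> \bar R}) (E : innerProductType R).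
Local Open Scope quotient_scope.

(* L^2(mu; E): square integrable functions modulo almost everywhere equality *)
Definition L2 : Type := @Quotient.quot (L2fun mu E) (@ae_null d T R mu E).

HB.instance Definition _ := GRing.Zmodule.on L2.
HB.instance Definition _ := EqQuotient.on L2.

Implicit Types (f g : L2fun mu E) (F G : L2).

Lemma piL2P f g : (\pi_L2 f = \pi_L2 g) <-> {ae mu, forall w, f w = g w}.
Proof.
have -> : (\pi_L2 f = \pi_L2 g) <-> (f - g \in @ae_null d T R mu E).
  by rewrite Quotient.idealrBE; split=> [->|/eqP].
split=> [/asboolP H|H].
  near=> w; apply/eqP; rewrite -subr_eq0; apply/eqP.
  by change ((f - g) w = 0); near: w.
apply/asboolP; near=> w; change (L2val f w - L2val g w = 0).
by rewrite (near H w)// subrr.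
Unshelve. all: by end_near. Qed.

Lemma reprL2 f : {ae mu, forall w, repr (\pi_L2 f) w = f w}.
Proof. by apply/piL2P; rewrite reprK. Qed.

Lemma piL2D f g : \pi_L2 (f + g) = \pi_L2 f + \pi_L2 g.
Proof. exact: Quotient.pi_add. Qed.

Definition scaleL2 (a : R[i]) F : L2 := \pi_L2 (a *: repr F).

Lemma piL2Z a f : \pi_L2 (a *: f) = scaleL2 a (\pi_L2 f).
Proof.
apply/piL2P; have := reprL2 f; apply: filterS => w H.
by change (a *: L2val f w = a *: L2val (repr (\pi_L2 f)) w); rewrite H.
Qed.

Let scaleL2A a b F : scaleL2 a (scaleL2 b F) = scaleL2 (a * b) F.
Proof. by rewrite -[F]reprK -!piL2Z scalerA ?reprK. Qed.

Let scaleL21 : left_id 1 scaleL2.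
Proof. by move=> F; rewrite -[F]reprK -!piL2Z scale1r ?reprK. Qed.

Let scaleL2Dr : right_distributive scaleL2 +%R.
Proof.
by move=> a F G; rewrite -[F]reprK -[G]reprK -piL2D -!piL2Z scalerDr piL2D ?reprK.
Qed.

Let scaleL2Dl F : {morph scaleL2^~ F : a b / a + b}.
Proof. by move=> a b; rewrite -[F]reprK -!piL2Z scalerDl piL2D ?reprK. Qed.

HB.instance Definition _ := GRing.Zmodule_isLmodule.Build R[i] L2
  scaleL2A scaleL21 scaleL2Dr scaleL2Dl.

Definition innerL2 F G := cintegral mu (fun w => inner (repr F w) (repr G w)).

Let L2sm f : strongly_measurable f. Proof. by case: (L2funP f). Qed.

Lemma integrable_Re_inner f g :
  mu.-integrable setT (fun w => (complex.Re (inner (f w) (g w)))%:E).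
Proof.
have h := integrableD measurableT (integrable_nrm2 (L2funP f))
  (integrable_nrm2 (L2funP g)).
apply: le_integrable h => //.
  exact/measurable_EFinP/measurable_Re_inner.
move=> w _; rewrite /= lee_fin (le_trans (Re_inner_bound _ _))//.
exact: ler_norm.
Qed.

Lemma integrable_Im_inner f g :
  mu.-integrable setT (fun w => (complex.Im (inner (f w) (g w)))%:E).
Proof.
by under eq_fun => w do rewrite Im_inner; exact: (integrable_Re_inner f ('i *: g)).
Qed.

Lemma innerL2E f g :
  innerL2 (\pi_L2 f) (\pi_L2 g) = cintegral mu (fun w => inner (f w) (g w)).
Proof.
have fE := reprL2 f; have gE := reprL2 g.
congr Complex; congr fine; apply: ae_eq_integral => //.
- exact/measurable_EFinP/measurable_Re_inner.
- exact/measurable_EFinP/measurable_Re_inner.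
- by near=> w => _; rewrite /= (near fE w)// (near gE w).
- exact/measurable_EFinP/measurable_Im_inner.
- exact/measurable_EFinP/measurable_Im_inner.
- by near=> w => _; rewrite /= (near fE w)// (near gE w).
Unshelve. all: by end_near. Qed.

Let innerL2Dl F G H : innerL2 (F + G) H = innerL2 F H + innerL2 G H.
Proof.
rewrite -[F]reprK -[G]reprK -[H]reprK -piL2D !innerL2E.
move: (repr F) (repr G) (repr H) => f g h; rewrite /cintegral.
have dE w : inner ((f + g) w) (h w) = inner (f w) (h w) + inner (g w) (h w).
  exact: innerDl.
congr Complex.
  rewrite -RintegralD//; try exact: integrable_Re_inner.
  by apply: eq_Rintegral => w _; rewrite dE; case: (inner _ _); case: (inner _ _).
rewrite -RintegralD//; try exact: integrable_Im_inner.
by apply: eq_Rintegral => w _; rewrite dE; case: (inner _ _); case: (inner _ _).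
Qed.

Let innerL2Zl a F G : innerL2 (a *: F) G = a * innerL2 F G.
Proof.
rewrite -[F]reprK -[G]reprK -[_ *: _]piL2Z !innerL2E.
move: (repr F) (repr G) => f g; rewrite /cintegral.
have dE w : inner ((a *: f) w) (g w) = a * inner (f w) (g w).
  exact: innerZl.
have iR := integrable_Re_inner f g; have iI := integrable_Im_inner f g.
case: a dE => a b dE.
have iZ c u : mu.-integrable setT (EFin \o u) -> mu.-integrable setT (fun w => (c * u w)%:E).
  by move=> iu; under eq_fun => w do rewrite EFinM; exact: integrableZl.
congr Complex.
  rewrite -!RintegralZl// -RintegralB//; [|exact: iZ|exact: iZ].
  by apply: eq_Rintegral => w _; rewrite dE; case: (inner _ _).
rewrite -!RintegralZl// -RintegralD//; [|exact: iZ|exact: iZ].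
by apply: eq_Rintegral => w _; rewrite dE; case: (inner _ _).
Qed.

Let innerL2C F G : innerL2 F G = (innerL2 G F)^*%C.
Proof.
rewrite /innerL2 /cintegral; move: (repr F) (repr G) => f g /=.
congr Complex.
  by apply: eq_Rintegral => w _; rewrite innerC; case: (inner _ _).
rewrite -mulN1r -RintegralZl//; last exact: integrable_Im_inner.
by apply: eq_Rintegral => w _; rewrite innerC; case: (inner _ _) => ? ? /=; ring.
Qed.

Let innerL2E2 F : innerL2 F F = (Rintegral mu setT (fun w => nrm (repr F w) ^+ 2))%:C.
Proof.
rewrite /innerL2 /cintegral; congr Complex.
  by apply: eq_Rintegral => w _; rewrite nrm2E.
rewrite (@eq_Rintegral _ _ _ _ _ (cst 0)) ?Rintegral_cst ?mul0r// => w _.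
by rewrite innerxx -nrmE -rmorphXn.
Qed.

Let innerL2_ge0 F : 0 <= innerL2 F F.
Proof. by rewrite innerL2E2 ler0c Rintegral_ge0// => w _; exact: sqr_ge0. Qed.

Let innerL2_eq0 F : innerL2 F F = 0 -> F = 0.
Proof.
rewrite innerL2E2 => /complexI; set f := repr F; rewrite /Rintegral => f0.
rewrite -[F]reprK -/f -[0]reprK; apply/piL2P.
have i0 : (\int[mu]_w (nrm (f w) ^+ 2)%:E = 0)%E.
  rewrite -[LHS]fineK ?f0//; apply: integrable_fin_num => //.
  exact/integrable_nrm2/L2funP.
have : ae_eq mu setT (fun w => (nrm (f w) ^+ 2)%:E) (cst 0%E).
  apply/ae_eq_integral_abs => //; first exact/measurable_EFinP/measurable_nrm2.
  by under eq_integral => w _ do rewrite gee0_abs ?lee_fin ?sqr_ge0//.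
have z0 : {ae mu, forall w, repr (0 : L2) w = 0}.
  have -> : (0 : L2) = \pi_L2 0 by rewrite /GRing.zero/= /Quotient.zero; unlock.
  exact: reprL2.
move=> H; near=> w; rewrite (near z0 w)//; apply: nrm0_eq0; apply/eqP.
have /(_ Logic.I) [/eqP] : setT w -> (nrm (f w) ^+ 2)%:E = cst 0%E w by near: w.
by rewrite sqrf_eq0.
Unshelve. all: by end_near. Qed.

HB.instance Definition _ := Lmodule_isInnerProduct.Build R L2
  innerL2Dl innerL2Zl innerL2C innerL2_ge0 innerL2_eq0.

(* class of a square integrable function, 0 on other functions *)
Definition toL2 (u : T -> E) : L2 := \pi_L2 (insubd 0 u).

End L2space.

Section subspaces.
Variables (R : realType) (E : innerProductType R).
Implicit Types (A B M N : set E).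

Definition lspan A : set E :=
  [set x | exists n (c : 'I_n -> R[i]) (a : 'I_n -> E),
     (forall i, A (a i)) /\ x = \sum_i c i *: a i].

Definition clspan A : set E := closure (lspan A).

Definition closed_subspace M :=
  [/\ M 0, forall (a : R[i]) x y, M x -> M y -> M (a *: x + y) & closed M].

Definition orth_sets A B := forall x y, A x -> B y -> inner x y = 0.

Definition orth_sum2 M A B :=
  [/\ closed_subspace A, closed_subspace B, orth_sets A B &
      M = [set x + y | x in A & y in B]].

(* Hilbert sum [M = (+)_(i in D) F i] of pairwise orthogonal closed subspaces *)
Definition orth_sum (I : Type) (D : set I) (F : I -> set E) M :=
  [/\ forall i, D i -> closed_subspace (F i),
      forall i j, D i -> D j -> i <> j -> orth_sets (F i) (F j) &
      M = clspan (\bigcup_(i in D) F i)].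

(* Hilbert dimension, with all infinite cardinals identified with +oo *)
Definition hdim M : \bar R :=
  ereal_sup [set n%:R%:E | n in [set n : nat | exists e : 'I_n -> E,
    (forall i, M (e i)) /\ (forall i j, inner (e i) (e j) = (i == j)%:R)]].

End subspaces.

(* An operator on a closed subspace [M] of [E] is represented by a map
   [A : E -> E] whose values outside [M] are irrelevant; in particular the
   restriction of [A] to a smaller subspace is represented by [A] itself. *)
Section operators.
Variables (R : realType) (E : innerProductType R).
Implicit Types (M N W : set E) (A B : E -> E).

Definition linear_on (F : innerProductType R) M (N : set F) (A : E -> F) :=
  (forall x, M x -> N (A x)) /\
  (forall (a : R[i]) x y, M x -> M y -> A (a *: x + y) = a *: A x + A y).

Definition isometry_on M A :=
  linear_on M M A /\ (forall x, M x -> `|A x| = `|x|).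

Definition unitary_on M A := isometry_on M A /\ A @` M = M.

Definition commute_on M A B := forall x, M x -> A (B x) = B (A x).

Definition adjoint M A (y : E) : E :=
  xget 0 [set z | M z /\ forall x, M x -> inner (A x) y = inner x z].

Definition kernel_on M A : set E := [set x | M x /\ A x = 0].

Definition reduces M A N :=
  [/\ closed_subspace N, N `<=` M, forall x, N x -> N (A x) &
      forall x, N x -> N (adjoint M A x)].

(* shift of arbitrary multiplicity [dim W], 0 being allowed *)
Definition unilateral_shift M A := isometry_on M A /\
  exists W, orth_sum [set: nat] (fun n => iter n A @` W) M.

Definition cyclic_vector M A v :=
  [/\ linear_on M M A, M v & clspan [set iter m A v | m in [set: nat]] = M].

End operators.

Section pairs.
Variables (R : realType) (E : innerProductType R).
Implicit Types (M N : set E) (V : E -> E) (T J : set (int * int)).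

(* Two negative exponents give a dummy value: an admissible semigroup (below)
   contains no such pair. *)
Definition Vpow M V1 V2 (p : int * int) (x : E) : E :=
  match p.1, p.2 with
  | Posz m, Posz n => iter m V1 (iter n V2 x)
  | Negz m, Posz n => iter m.+1 (adjoint M V1) (iter n V2 x)
  | Posz m, Negz n => iter n.+1 (adjoint M V2) (iter m V1 x)
  | Negz _, Negz _ => 0
  end.

Definition neg_set T : set (int * int) := [set p | T (- p)].

Definition admissible_semigroup T :=
  [/\ forall p q, T p -> T q -> T (p + q), T `&` neg_set T = set0 &
      forall m n : int, 0 < m -> 0 < n -> T (m, n)].

Definition semigroup_pair T M V1 V2 :=
  [/\ admissible_semigroup T,
      isometry_on M V1, isometry_on M V2, commute_on M V1 V2 &
      forall p, T p -> isometry_on M (Vpow M V1 V2 p)].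

Definition quasi_unitary T M V1 V2 :=
  semigroup_pair T M V1 V2 /\
  closure [set y | exists p q x, [/\ T p, T q, T (q - p), M x &
    y = adjoint M (Vpow M V1 V2 p) (Vpow M V1 V2 q x)]] = M.

Definition totally_non_unitary T M V1 V2 :=
  semigroup_pair T M V1 V2 /\
  (forall N, reduces M V1 N -> reduces M V2 N ->
     quasi_unitary T N V1 V2 -> N = [set 0]).

Definition is_diagram J :=
  forall p (m n : nat), J p -> J (p + (m%:Z, n%:Z)).

End pairs.

Section torus.
Variables (R : realType).

(* The 2-torus is parametrised by angles: [(a, b)] in the unit square stands for
   [(exp(2 i pi a), exp(2 i pi b))], so that Haar measure is the product of two
   copies of the uniform probability on [0, 1]. *)
Definition torus_measure :=
  (uniform_prob (@ltr01 R) \x uniform_prob (@ltr01 R))%E.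

Definition expi (a : R) : R[i] := cos (2 * pi * a) +i* sin (2 * pi * a).

Variable E : innerProductType R.
Local Notation L2torus := (L2 torus_measure E).

(* [fourier f (i, j)] is the weak integral of [f z1^(-i) z2^(-j)] *)
Definition fourier (f : L2torus) (p : int * int) : E :=
  xget 0 [set c | forall h, inner c h =
    cintegral torus_measure (fun w =>
      inner (repr f w) h * (expi w.1 ^ (- p.1) * expi w.2 ^ (- p.2)))].

Definition diagram_space (J : set (int * int)) : set L2torus :=
  [set f | forall p, ~ J p -> fourier f p = 0].

Definition Mz1 (f : L2torus) : L2torus :=
  toL2 torus_measure (fun w => expi w.1 *: repr f w).

Definition Mz2 (f : L2torus) : L2torus :=
  toL2 torus_measure (fun w => expi w.2 *: repr f w).

End torus.

Definition unitarily_equivalent (R : realType) (E F : innerProductType R)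
    (M : set E) (A1 A2 : E -> E) (N : set F) (B1 B2 : F -> F) :=
  exists W : E -> F,
    [/\ linear_on M N W, W @` M = N, forall x, M x -> `|W x| = `|x|,
        forall x, M x -> W (A1 x) = B1 (W x) &
        forall x, M x -> W (A2 x) = B2 (W x)].

Definition given_by_diagram (R : realType) (E : innerProductType R)
    (J : set (int * int)) (M : set E) (V1 V2 : E -> E) :=
  is_diagram J /\
  exists H : hilbertType R,
    unitarily_equivalent M V1 V2 (@diagram_space R H J) (@Mz1 R H) (@Mz2 R H).

Section random_fields.
Context d (Omega : measurableType d) (R : realType) (P : probability Omega R).
Implicit Types (X : int * int -> Omega -> R[i]) (S : set (int * int)).

Definition weak_stationary X :=
  [/\ forall p, measurable_fun setT (fun w => complex.Re (X p w)) /\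
                measurable_fun setT (fun w => complex.Im (X p w)),
      forall p, (\int[P]_w (complex.Re (`|X p w| ^+ 2))%:E < +oo)%E,
      forall p q, cintegral P (X p) = cintegral P (X q) &
      exists gamma : int * int -> R[i], forall p q,
        cintegral P (fun w => X p w * (X (p + q) w)^*%C) = gamma q].

Definition rv_class X (p : int * int) : L2 P R[i]^o := toL2 P (X p : Omega -> R[i]^o).

Definition field_space X : set (L2 P R[i]^o) :=
  clspan [set rv_class X p | p in [set: int * int]].

Definition past_space X S (p : int * int) : set (L2 P R[i]^o) :=
  clspan [set rv_class X q | q in [set q | S (q - p)]].

Definition no_deterministic_part X S :=
  \bigcap_(p in [set: int * int]) past_space X S p = [set 0].

End random_fields.

Arguments field_space {d Omega R} P X _.
Arguments past_space {d Omega R} P X S p _.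

Definition half_plane : set (int * int) :=
  [set p | p.2 <= -1 \/ p.2 = 0 /\ p.1 <= -1].

(* Main.v *)
(* Put x0 = X_(-1,0) and J = -L U {(0,0)}. The shifts extend to a unitary
   representation U of Z^2 on L^2, and the past H of X_(0,0) is the closed span of
   the vectors U^p x0, p in J. Since J is the nonnegative cone of a total order, the
   innovation space W = H - U^(1,0) H (orthogonal difference) satisfies
   U^p W _|_ U^q W for p <> q. Let H_t be the Hilbert sum of the U^p W, p in J, and
   H_e = H - H_t. On H_e the operator V1 is onto, as H_e _|_ W, and V2 is a shift by
   the Wold argument, as the intersection of the U^(0,n) H is zero. The projection v
   of x0 on H_e - V2 H_e is cyclic because the projections of the other generators of
   H are zero or of the form V1^m v. If N reduces V1, V2 on H_t to a quasi-unitary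
   pair, then N = V1 N, whence N _|_ U^p W for all p in J, so N = 0.

   W is spanned by the innovation e, the projection of x0. If e <> 0 then, up to
   scaling, the U^p e have the same Gram matrix as the characters of the torus, which
   form an orthonormal basis; this yields the diagram model with coefficients in C.
   For the completeness of the characters, let phi be orthogonal to them. The bounded
   functions u such that phi u is orthogonal to all trigonometric polynomials are
   stable under bounded limits, hence they include the indicators of products of arcs
   and then, by Dynkin's lemma, all indicators. *)

From HB Require Import structures.
Require Import Defs.
From mathcomp Require Import all_boot all_order all_algebra.
From mathcomp Require Import complex generic_quotient ring_quotient ring lra zify.
From mathcomp Require Import all_classical all_reals all_analysis.
From mathcomp Require Import measurable_realfun.

Set Implicit Arguments.
Unset Strict Implicit.
Unset Printing Implicit Defensive.
Import Order.TTheory GRing.Theory Num.Theory.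
Import numFieldNormedType.Exports.
Local Open Scope classical_set_scope.
Local Open Scope ring_scope.
Local Open Scope complex_scope.

(** * Hilbert space geometry *)

(** The space L^2 enters as an [innerProductType], so the geometry is derived from [seq_complete],
    which Riesz-Fischer supplies. [U1] and [U2] are prescribed only on the closed span of the field;
    extending them by the identity on its orthogonal complement gives total maps U^p, which can be
    moved across an inner product without membership conditions. The operators of the theorem are
    compressions to the past: their adjoints are U^(-q) followed by a projection, and a recurring
    step is to see that this projection acts as the identity. One innovation space serves the whole
    two-parameter semigroup because (1,0) is the least positive element of the order, so that U^p H
    lies in U^(1,0) H for every positive p. Indicators of arcs come from the polynomials (1 -
    s^n)^(n 2^n), a device known from elementary proofs of the Stone-Weierstrass theorem: their
    limits are pointwise and bounded, as dominated convergence requires. The argument s must have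
    values in [0,1], so trigonometric polynomials are taken real, and real and imaginary parts are
    treated separately. *)

Section norm_theory.
Variables (R : realType) (E : innerProductType R).
Implicit Types (x y z : E) (A : set E).

Lemma innerBl x y z : inner (x - y) z = inner x z - inner y z.
Proof. by rewrite innerDl innerNl. Qed.

Lemma innerBr x y z : inner x (y - z) = inner x y - inner x z.
Proof. by rewrite innerDr innerNr. Qed.

Lemma inner_suml (I : finType) (x : I -> E) z :
  inner (\sum_i x i) z = \sum_i inner (x i) z.
Proof.
by elim/big_rec2 : _ => [|i a b _ <-]; rewrite ?inner0l ?innerDl.
Qed.

Lemma inner_sumr (I : finType) (x : I -> E) z :
  inner z (\sum_i x i) = \sum_i inner z (x i).
Proof.
by elim/big_rec2 : _ => [|i a b _ <-]; rewrite ?inner0r ?innerDr.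
Qed.

Lemma nrm0 : nrm (0 : E) = 0. Proof. by rewrite /nrm normr0. Qed.

Lemma nrmN x : nrm (- x) = nrm x. Proof. by rewrite /nrm normrN. Qed.

Lemma nrm_triangle x y : nrm (x + y) <= nrm x + nrm y.
Proof. by rewrite -lecR rmorphD/= !nrmE ler_normD. Qed.

Lemma nrmBC x y : nrm (x - y) = nrm (y - x).
Proof. by rewrite -nrmN opprB. Qed.

Lemma nrmB_triangle y x z : nrm (x - z) <= nrm (x - y) + nrm (y - z).
Proof. by rewrite -[x - z](subrKA y) nrm_triangle. Qed.

Lemma nrmB_sq x y :
  nrm (x - y) ^+ 2 = nrm x ^+ 2 - 2 * complex.Re (inner x y) + nrm y ^+ 2.
Proof.
rewrite !nrm2E !innerBl !innerBr (innerC y x); case: (inner x y) => a b.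
by case: (inner x x) => c d; case: (inner y y) => e f /=; ring.
Qed.

Lemma Re_innerC x y : complex.Re (inner y x) = complex.Re (inner x y).
Proof. by rewrite innerC; case: (inner x y). Qed.

Lemma Re_innerZr (t : R) x y :
  complex.Re (inner x (t%:C *: y)) = t * complex.Re (inner x y).
Proof. by rewrite innerZr; case: (inner x y) => a b /=; ring. Qed.

Lemma nrm_scaleR (t : R) x : nrm (t%:C *: x) ^+ 2 = t ^+ 2 * nrm x ^+ 2.
Proof. by rewrite nrmZ/= expr0n addr0. Qed.

Lemma parallelogram x y : nrm (x + y) ^+ 2 + nrm (x - y) ^+ 2 =
  2 * nrm x ^+ 2 + 2 * nrm y ^+ 2.
Proof.
rewrite -{1}[y]opprK !nrmB_sq nrmN innerNr.
by case: (inner x y) => a b /=; ring.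
Qed.

Lemma Re_inner_CS x y : `|complex.Re (inner x y)| <= nrm x * nrm y.
Proof.
wlog ge0 : x / 0 <= complex.Re (inner x y) => [H|].
  have [/H//|lt0] := leP 0 (complex.Re (inner x y)).
  have := H (- x); rewrite innerNl nrmN; case: (inner x y) lt0 => a b /= a0.
  by rewrite normrN oppr_ge0 => -> //; exact: ltW.
rewrite ger0_norm//.
have [x0|x0] := eqVneq (nrm x) 0; first by rewrite (nrm0_eq0 x0) inner0l nrm0 mul0r.
have [y0|y0] := eqVneq (nrm y) 0; first by rewrite (nrm0_eq0 y0) inner0r nrm0 mulr0.
have xp : 0 < nrm x by rewrite lt_neqAle eq_sym x0 nrm_ge0.
have yp : 0 < nrm y by rewrite lt_neqAle eq_sym y0 nrm_ge0.
have := sqr_ge0 (nrm ((nrm y)%:C *: x - (nrm x)%:C *: y)).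
rewrite nrmB_sq !nrm_scaleR Re_innerZr Re_innerC Re_innerZr Re_innerC.
move: (complex.Re _) => r H.
have : 0 <= (nrm x * nrm y) * (nrm x * nrm y - r) by nra.
by rewrite pmulr_rge0 ?mulr_gt0// subr_ge0.
Qed.

Lemma Im_inner_CS x y : `|complex.Im (inner x y)| <= nrm x * nrm y.
Proof.
rewrite Im_inner (le_trans (Re_inner_CS _ _))// ler_wpM2l ?nrm_ge0//.
rewrite -(@ler_pXn2r _ 2)// ?nnegrE ?nrm_ge0//.
by rewrite nrmZ/= expr0n add0r expr1n mul1r.
Qed.

(** Balls have radii in [R[i]]; a positive radius is real there, so real radii suffice. *)
Lemma closure_nrmP A x :
  closure A x <-> forall e : R, 0 < e -> exists2 a, A a & nrm (x - a) < e.
Proof.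
split=> [Ax e e0|H B /nbhs_ballP[e /= e0 eB]].
  have /Ax [a [Aa]] : nbhs x (ball x e%:C) by apply: nbhsx_ballx; rewrite (ltcR 0).
  by rewrite -ball_normE/= -nrmE ltcR => xa; exists a.
have eE : e = (complex.Re e)%:C by rewrite RRe_real// gtr0_real.
have [|a Aa xa] := H (complex.Re e); first by rewrite -ltcR -eE.
by exists a; split => //; apply: eB; rewrite -ball_normE/= -nrmE eE ltcR.
Qed.

End norm_theory.

Section subspace_theory.
Variables (R : realType) (E : innerProductType R).
Implicit Types (x y z : E) (A B M N : set E).

Lemma csub0 M : closed_subspace M -> M 0. Proof. by case. Qed.

Lemma csubL M (a : R[i]) x y : closed_subspace M -> M x -> M y -> M (a *: x + y).
Proof. by case=> _ + _; apply. Qed.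

Lemma csubD M x y : closed_subspace M -> M x -> M y -> M (x + y).
Proof. by move=> cM Mx My; rewrite -[x]scale1r; exact: csubL. Qed.

Lemma csubZ M (a : R[i]) x : closed_subspace M -> M x -> M (a *: x).
Proof. by move=> cM Mx; rewrite -[_ *: _]addr0; apply: csubL => //; exact: csub0. Qed.

Lemma csubN M x : closed_subspace M -> M x -> M (- x).
Proof. by move=> cM Mx; rewrite -scaleN1r; exact: csubZ. Qed.

Lemma csubB M x y : closed_subspace M -> M x -> M y -> M (x - y).
Proof. by move=> cM Mx My; apply: csubD => //; exact: csubN. Qed.

Lemma csub_closure M x : closed_subspace M -> closure M x -> M x.
Proof. by case=> _ _ /closure_id <-. Qed.

Lemma lspan_sub A : A `<=` lspan A.
Proof.
move=> x Ax; exists 1%N, (fun=> 1), (fun=> x); split => //.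
by rewrite big_ord_recl big_ord0 addr0 scale1r.
Qed.

Lemma lspan_lin A (a : R[i]) x y : lspan A x -> lspan A y -> lspan A (a *: x + y).
Proof.
move=> [n [c [u [Au ->]]]] [m [c' [u' [Au' ->]]]].
exists (n + m)%N, (fun i => match fintype.split i with inl j => a * c j | inr j => c' j end),
  (fun i => match fintype.split i with inl j => u j | inr j => u' j end); split.
  by move=> i; case: (fintype.split i).
rewrite big_split_ord/= scaler_sumr; congr (_ + _); apply: eq_bigr => i _.
  by rewrite (unsplitK (inl _ i)) scalerA.
by rewrite (unsplitK (inr _ i)).
Qed.

Lemma lspan0 A : lspan A 0.
Proof. by exists 0%N, (fun=> 0), (fun=> 0); split => [[]//|]; rewrite big_ord0. Qed.

Lemma clspan_sub A : A `<=` clspan A.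
Proof. by move=> x /lspan_sub; exact: subset_closure. Qed.

Lemma clspan_csub A : closed_subspace (clspan A).
Proof.
split; first exact/subset_closure/lspan0.
  move=> a x y /closure_nrmP Ax /closure_nrmP Ay; apply/closure_nrmP => e e0.
  have a1 : 0 < nrm (a : R[i]^o) + 1 by rewrite ltr_wpDl ?nrm_ge0.
  have e2 : 0 < e / 2 by rewrite divr_gt0.
  have [x' Ax' xx'] := Ax (e / 2 / (nrm (a : R[i]^o) + 1)) (divr_gt0 e2 a1).
  have [y' Ay' yy'] := Ay (e / 2) e2.
  exists (a *: x' + y'); first exact: lspan_lin.
  rewrite opprD addrACA -scalerBr (le_lt_trans (nrm_triangle _ _))//.
  have -> : nrm (a *: (x - x')) = nrm (a : R[i]^o) * nrm (x - x').
    by apply: complexI; rewrite rmorphM/= !nrmE normrZ.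
  have : nrm (a : R[i]^o) * nrm (x - x') <= (nrm (a : R[i]^o) + 1) * nrm (x - x').
    by rewrite ler_wpM2r ?nrm_ge0// lerDl.
  by move: xx'; rewrite ltr_pdivlMr// mulrC; lra.
exact: closed_closure.
Qed.

Lemma lspan_min A M : closed_subspace M -> A `<=` M -> lspan A `<=` M.
Proof.
move=> cM AM _ [n [c [a [Aa ->]]]].
by elim/big_rec : _ => [|i x _ Mx]; [exact: csub0|apply: csubL => //; exact: AM].
Qed.

Lemma clspan_min A M : closed_subspace M -> A `<=` M -> clspan A `<=` M.
Proof.
move=> cM AM; apply: subset_trans (closure_subset (lspan_min cM AM)) _.
by move=> x; exact: csub_closure.
Qed.

Lemma clspan_mono A B : A `<=` B -> clspan A `<=` clspan B.
Proof.
move=> AB; apply: clspan_min; first exact: clspan_csub.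
exact: subset_trans AB (@clspan_sub _).
Qed.

Lemma csubI M N : closed_subspace M -> closed_subspace N -> closed_subspace (M `&` N).
Proof.
move=> cM cN; split; first by split; exact: csub0.
  by move=> a x y [? ?] [? ?]; split; exact: csubL.
by apply: closedI; [case: cM|case: cN].
Qed.

Definition perp A : set E := [set x | forall a, A a -> inner x a = 0].

Lemma perp_csub A : closed_subspace (perp A).
Proof.
split; first by move=> a _; rewrite inner0l.
  by move=> a x y Ax Ay b Ab; rewrite innerDl innerZl Ax// Ay// mulr0 addr0.
move=> x /closure_nrmP Ax a Aa; have key (r : R) :
    (forall y, perp A y -> `|r| <= nrm (x - y) * nrm a) -> r = 0.
  move=> H; apply/eqP; rewrite -normr_le0; apply/ler_addgt0Pl => e e0.
  rewrite addr0; have na : 0 < nrm a + 1 by rewrite ltr_wpDl ?nrm_ge0.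
  have [y Ay xy] := Ax (e / (nrm a + 1)) (divr_gt0 e0 na).
  apply: le_trans (H _ Ay) _; move: xy; rewrite ltr_pdivlMr// => xy.
  by rewrite (le_trans _ (ltW xy))// ler_wpM2l ?nrm_ge0// lerDl.
apply/eqP; rewrite eq_complex; apply/andP; split; apply/eqP; apply: key => y Ay.
  have := Re_inner_CS (x - y) a; rewrite innerBl (Ay a Aa) subr0.
  by apply: le_trans.
have := Im_inner_CS (x - y) a; rewrite innerBl (Ay a Aa) subr0.
by apply: le_trans.
Qed.

Lemma perpC A x y : A x -> perp A y -> inner x y = 0.
Proof. by move=> Ax Ay; rewrite innerC Ay// conjc0. Qed.

Lemma inner_eq0C x y : inner x y = 0 -> inner y x = 0.
Proof. by move=> xy; rewrite innerC xy conjc0. Qed.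

Lemma perp_clspan A x : perp A x -> perp (clspan A) x.
Proof.
move=> Ax a Aa; apply: inner_eq0C.
suff : clspan A `<=` perp [set x] by move/(_ _ Aa) => /(_ x erefl).
apply: clspan_min; first exact: perp_csub.
by move=> b Ab _ ->; apply: inner_eq0C; exact: Ax.
Qed.

Lemma perp_self A x : A x -> perp A x -> x = 0.
Proof. by move=> Ax /(_ _ Ax) /inner_eq0. Qed.

(** Completeness as a property of sequences in the real norm: this is what the projection theorem
    consumes and what [L2_seq_complete] proves for L^2. *)
Definition seq_complete := forall u : nat -> E,
  (forall e : R, 0 < e ->
     exists k, forall m n, (k <= m)%N -> (k <= n)%N -> nrm (u m - u n) < e) ->
  exists l, forall e : R, 0 < e -> exists k, forall n, (k <= n)%N -> nrm (u n - l) < e.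

Hypothesis cE : seq_complete.

Lemma projection M x : closed_subspace M -> exists2 y, M y & perp M (x - y).
Proof.
move=> cM; pose D := [set nrm (x - z) | z in M].
have hD : has_inf D.
  split; first by exists (nrm (x - 0)); exists 0 => //; exact: csub0.
  by exists 0 => _ [z _ <-]; exact: nrm_ge0.
set d := inf D.
have lbD z : M z -> d <= nrm (x - z).
  by move=> Mz; apply: (ge_inf hD.2); exists z.
have d0 : 0 <= d by apply: lb_le_inf; [exact: hD.1|move=> _ [z _ <-]; exact: nrm_ge0].
have /choice[z Hz] n : exists z, M z /\ nrm (x - z) < d + n.+1%:R^-1.
  have [|_ [z Mz <-] zn] := @inf_adherent _ D n.+1%:R^-1 _ hD; first by rewrite invr_gt0.
  by exists z.
(* Parallelogram law: the midpoint of [z m] and [z n] lies in M, hence at distance at least d from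
   x. This leaves 4 d (a + b) + 2 a^2 + 2 b^2, where the errors a, b are at most 1. *)
have zz m n : nrm (z m - z n) ^+ 2 <= (4 * d + 2) * (m.+1%:R^-1 + n.+1%:R^-1).
  have := parallelogram (x - z m) (x - z n).
  have -> : x - z m - (x - z n) = - (z m - z n).
    by rewrite opprB addrC addrA subrK opprB.
  have -> : x - z m + (x - z n) = 2%:C *: (x - (2^-1)%:C *: (z m + z n)).
    rewrite scalerBr scalerA -rmorphM/= divff// scale1r addrACA -opprD.
    by congr (_ - _); rewrite -[2%:C]/(2%:R%:C) rmorph_nat scaler_nat.
  rewrite nrm_scaleR nrmN.
  have Mh : M ((2^-1)%:C *: (z m + z n)).
    by apply: csubZ => //; apply: csubD => //; have [] := Hz m; have [] := Hz n.
  have i1 k : k.+1%:R^-1 <= 1 :> R by rewrite invf_le1 ?ler1n.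
  have i0 k : 0 <= k.+1%:R^-1 :> R by rewrite invr_ge0.
  have {}lbD := lbD _ Mh; have [_] := Hz m; have [_] := Hz n.
  move: lbD (i1 m) (i1 n) (i0 m) (i0 n) (nrm_ge0 (x - z m)) (nrm_ge0 (x - z n)).
  move: (nrm _) (nrm _) (nrm _) (nrm _) (m.+1%:R^-1) (n.+1%:R^-1) => s r q p a b.
  move=> dp a1 b1 a0 b0 q0 r0 rd qd.
  have : d ^+ 2 <= p ^+ 2 by rewrite ler_pXn2r// nnegrE (le_trans d0).
  have : q ^+ 2 <= (d + a) ^+ 2 by rewrite ler_pXn2r// ?nnegrE ?addr_ge0// ltW.
  have : r ^+ 2 <= (d + b) ^+ 2 by rewrite ler_pXn2r// ?nnegrE ?addr_ge0// ltW.
  have : a ^+ 2 <= a by rewrite expr2 ler_piMl.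
  have : b ^+ 2 <= b by rewrite expr2 ler_piMl.
  by nra.
have [|y Hy] := cE (u := z).
  move=> e e0; have d2 : 0 < 4 * d + 2 by lra.
  have e2 : 0 < e ^+ 2 / 2 / (4 * d + 2) by rewrite !divr_gt0// exprn_gt0.
  have [k /= _ Hk] := @near_infty_natSinv_lt R (PosNum e2).
  exists k => m n km kn; rewrite -(@ltr_pXn2r _ 2)// ?nnegrE ?nrm_ge0 ?(ltW e0)//.
  apply: le_lt_trans (zz m n) _.
  have := Hk m km; have := Hk n kn; rewrite /= !ltr_pdivlMr//.
  by move: (m.+1%:R^-1) (n.+1%:R^-1) => a b; lra.
have My : M y.
  apply: csub_closure => //; apply/closure_nrmP => e /Hy[k /(_ _ (leqnn k)) ke].
  by exists (z k); [have [] := Hz k|rewrite nrmBC].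
have yD : nrm (x - y) <= d.
  apply/ler_addgt0Pr => e e0; have e2 : 0 < e / 2 by rewrite divr_gt0.
  have [k Hk] := Hy _ e2.
  have [k' /= _ Hk'] := @near_infty_natSinv_lt R (PosNum e2).
  pose n := maxn k k'; have kn := Hk n (leq_maxl _ _).
  have {Hk'} := Hk' n (leq_maxr _ _); rewrite /=; have [_] := Hz n.
  have := nrmB_triangle (z n) x y; move: kn; clearbody n; move: (n.+1%:R^-1) => a.
  lra.
exists y => //.
have Re0 a : M a -> complex.Re (inner (x - y) a) = 0.
  move=> Ma; set r := complex.Re _; set b := nrm a ^+ 2.
  have H t : 2 * t * r <= t ^+ 2 * b.
    have : nrm (x - y) ^+ 2 <= nrm (x - y - t%:C *: a) ^+ 2.
      rewrite ler_pXn2r// ?nnegrE ?nrm_ge0// (le_trans yD)//.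
      rewrite -addrA -opprD; apply: lbD; apply: csubD => //.
      exact: csubZ.
    by rewrite (nrmB_sq (x - y)) Re_innerZr nrm_scaleR -/r -/b; lra.
  have b0 : 0 <= b by exact: sqr_ge0.
  have b1 : 0 < b + 1 by lra.
  (* The optimal parameter is r / b; using b + 1 avoids a division by zero, and the inequality still
     becomes r^2 (b + 2) <= 0. *)
  have := H (r / (b + 1)); rewrite expr_div_n.
  have -> : 2 * (r / (b + 1)) * r = (2 * r ^+ 2 * (b + 1)) / (b + 1) ^+ 2.
    by field; rewrite gt_eqF.
  rewrite [leRHS]mulrAC ler_pM2r ?invr_gt0 ?exprn_gt0// => {}H.
  apply/eqP; rewrite -sqrf_eq0; apply/eqP/le_anti; rewrite sqr_ge0 andbT.
  by have := sqr_ge0 r; nra.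
move=> a Ma; apply/eqP; rewrite eq_complex/= Re0// Im_inner Re0 ?eqxx//.
exact: csubZ.
Qed.

(* [0] if [x] has no orthogonal projection on [M], which completeness excludes *)
Definition proj M x : E := xget 0 [set y | M y /\ perp M (x - y)].

Lemma projP M x : closed_subspace M -> M (proj M x) /\ perp M (x - proj M x).
Proof.
move=> cM; have [y My xy] := projection x cM.
by apply: (@xgetPex _ 0 [set y | M y /\ perp M (x - y)]); exists y.
Qed.

Lemma proj_in M x : closed_subspace M -> M (proj M x).
Proof. by case/(projP x). Qed.

Lemma proj_perp M x : closed_subspace M -> perp M (x - proj M x).
Proof. by case/(projP x). Qed.

Lemma proj_uniq M x y : closed_subspace M -> M y -> perp M (x - y) -> proj M x = y.
Proof.
move=> cM My xy; have [Mp xp] := projP x cM; apply/eqP; rewrite -subr_eq0; apply/eqP.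
apply: (@perp_self M); first exact: csubB.
rewrite (_ : _ - y = (x - y) - (x - proj M x)).
  by apply: (csubB (perp_csub M)).
by rewrite opprB [RHS]addrC subrKA.
Qed.

Lemma csub_eq M N : closed_subspace M -> M `<=` N -> closed_subspace N ->
  (forall x, N x -> perp M x -> x = 0) -> M = N.
Proof.
move=> cM MN cN H; apply/seteqP; split => // x Nx; have [Mp xp] := projP x cM.
suff /eqP : x - proj M x = 0 by rewrite subr_eq0 => /eqP ->.
by apply: H => //; apply: csubB => //; exact: MN.
Qed.

End subspace_theory.

(** * Unitary representations of the lattice *)

(** The positive and the nonnegative cone of the lexicographic order that compares second
    coordinates first. *)
Notation lexT := (neg_set half_plane).
Notation lexJ := (neg_set half_plane `|` [set (0, 0)]).
Notation dir1 := (1 : int, 0 : int).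
Notation dir2 := (0 : int, 1 : int).

Section half_plane_semigroup.
Implicit Types p q : int * int.

Lemma lexTE p : lexT p <-> 0 < p.2 \/ p.2 = 0 /\ 0 < p.1.
Proof. by case: p => k l; rewrite /neg_set /half_plane/=; lia. Qed.

Lemma lexJE p : lexJ p <-> 0 < p.2 \/ p.2 = 0 /\ 0 <= p.1.
Proof.
rewrite -[X in X <-> _]/(lexT p \/ p = (0, 0)) lexTE.
case: p => k l /=; split; first by case=> [|[-> ->]]; lia.
by move=> H; have [->|] := eqVneq (k, l) (0, 0); [right|rewrite xpair_eqE; left; lia].
Qed.

Lemma lexTJ p : lexT p -> lexJ p. Proof. by left. Qed.

Lemma lexJ0 : lexJ 0. Proof. by right. Qed.

Lemma lexJD p q : lexJ p -> lexJ q -> lexJ (p + q).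
Proof. by rewrite !lexJE; case: p q => k l [m n]/=; lia. Qed.

Lemma lexTD p q : lexT p -> lexJ q -> lexT (p + q).
Proof. by rewrite lexJE !lexTE; case: p q => k l [m n]/=; lia. Qed.

(** [dir1] is the least positive element; the innovation space and the quasi-unitarity argument both
    rest on this. *)
Lemma lexT_e1 p : lexT p -> lexJ (p - dir1).
Proof. by rewrite lexJE lexTE; case: p => k l /=; lia. Qed.

Lemma lexT_e2 : lexT dir2. Proof. by rewrite lexTE; left. Qed.

Lemma lexT1 : lexT dir1. Proof. by rewrite lexTE; right. Qed.

Lemma lexNJ p : ~ lexJ p -> lexT (- p).
Proof. by rewrite lexJE lexTE; case: p => k l /=; lia. Qed.

Lemma lex_total p : p <> 0 -> lexT p \/ lexT (- p).
Proof.
rewrite !lexTE; case: p => k l /= kl.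
have : ~ (k = 0 /\ l = 0) by move=> [k0 l0]; apply: kl; rewrite k0 l0.
lia.
Qed.

Lemma lexT_admissible : admissible_semigroup lexT.
Proof.
split=> [p q Tp Tq||m n m0 n0]; first exact/lexTD/lexTJ.
  apply/seteqP; split => // p [/lexTE Tp].
  by rewrite -[neg_set _ _]/(lexT (- p)) lexTE; case: p Tp => k l /=; lia.
by rewrite lexTE; left.
Qed.

Lemma lexJ_diagram : is_diagram lexJ.
Proof. by move=> [k l] m n /lexJE H; rewrite lexJE; move: H => /=; lia. Qed.

End half_plane_semigroup.

Section unitary_group.
Variables (R : realType) (E : innerProductType R).
Implicit Types (x y z : E) (A M N : set E) (p q : int * int).

Definition unitary_group (U : int * int -> E -> E) :=
  [/\ forall p (a : R[i]) x y, U p (a *: x + y) = a *: U p x + U p y,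
      forall x, U 0 x = x,
      forall p q x, U (p + q) x = U p (U q x) &
      forall p x y, inner (U p x) (U p y) = inner x y].

Variable U : int * int -> E -> E.
Hypothesis hU : unitary_group U.

Lemma UL p (a : R[i]) x y : U p (a *: x + y) = a *: U p x + U p y.
Proof. by case: hU. Qed.

Lemma U0 x : U 0 x = x. Proof. by case: hU. Qed.

Lemma UD p q x : U (p + q) x = U p (U q x). Proof. by case: hU. Qed.

Lemma UI p x y : inner (U p x) (U p y) = inner x y. Proof. by case: hU. Qed.

Lemma UK p : cancel (U p) (U (- p)).
Proof. by move=> x; rewrite -UD addNr U0. Qed.

Lemma UNK p : cancel (U (- p)) (U p).
Proof. by move=> x; rewrite -UD subrr U0. Qed.

Lemma UadjL p x y : inner (U p x) y = inner x (U (- p) y).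
Proof. by rewrite -{1}[y](UNK p) UI. Qed.

Lemma UadjR p x y : inner x (U p y) = inner (U (- p) x) y.
Proof. by rewrite -{1}[x](UNK p) UI. Qed.

Lemma U_0 p : U p 0 = 0.
Proof. by apply: inner_eq0; rewrite UI inner0l. Qed.

Lemma U_D p x y : U p (x + y) = U p x + U p y.
Proof. by rewrite -{1}[x]scale1r UL scale1r. Qed.

Lemma U_Z p (a : R[i]) x : U p (a *: x) = a *: U p x.
Proof. by rewrite -[a *: x]addr0 UL U_0 addr0. Qed.

Lemma U_B p x y : U p (x - y) = U p x - U p y.
Proof. by rewrite addrC -scaleN1r UL scaleN1r addrC. Qed.

Lemma U_norm p x : `|U p x| = `|x|.
Proof. by apply/eqP; rewrite -(@eqrXn2 _ 2)// -!innerxx UI. Qed.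

Lemma U_nrm p x : nrm (U p x) = nrm x.
Proof. by rewrite /nrm U_norm. Qed.

Lemma U_image p A : U p @` A = [set x | A (U (- p) x)].
Proof.
by apply/seteqP; split=> [_ [x Ax <-]|x Ax] /=; [rewrite UK|exists (U (- p) x) => //; rewrite UNK].
Qed.

Lemma U_preim_csub p M : closed_subspace M -> closed_subspace [set x | M (U p x)].
Proof.
move=> cM; split=> [|a x y Mx My|x /closure_nrmP Mx] /=; first by rewrite U_0; exact: csub0.
  by rewrite UL; exact: csubL.
apply: csub_closure => //; apply/closure_nrmP => e /Mx[a Ma xa].
by exists (U p a) => //; rewrite -U_B U_nrm.
Qed.

Lemma U_csub p M : closed_subspace M -> closed_subspace (U p @` M).
Proof. by rewrite U_image; exact: U_preim_csub. Qed.

Lemma U_clspan p A M : closed_subspace M -> (forall a, A a -> M (U p a)) ->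
  forall x, clspan A x -> M (U p x).
Proof. by move=> cM AM; exact: (clspan_min (U_preim_csub p cM)). Qed.

Lemma U_clspan_image p A : U p @` clspan A = clspan (U p @` A).
Proof.
apply/seteqP; split.
  move=> _ [x Ax <-]; apply: (U_clspan (A := A)) => //; first exact: clspan_csub.
  by move=> a Aa; apply: clspan_sub; exists a.
apply: clspan_min; first exact/U_csub/clspan_csub.
by move=> _ [x Ax <-]; exists x => //; exact: clspan_sub.
Qed.

Hypothesis cE : seq_complete E.

Section reducing.
Variables (H : set E) (q : int * int) (A : E -> E).
Hypotheses (cH : closed_subspace H) (AU : forall x, H x -> A x = U q x).

(** [A] restricts U^q, so its adjoint is the compression of U^(-q); the projection is there because
    U^(-q) may lead out of [H]. *)
Lemma adjointE y : adjoint H A y = proj H (U (- q) y).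
Proof.
apply: xget_unique => [|z [Hz Az]].
  split=> [|x Hx]; first exact: proj_in.
  rewrite AU// UadjL; apply/eqP; rewrite -subr_eq0 -innerBr; apply/eqP.
  by apply: inner_eq0C; apply: (proj_perp cE).
apply/esym/proj_uniq => // x Hx; apply: inner_eq0C.
by rewrite innerBr -Az// AU// -UadjL subrr.
Qed.

Lemma adjoint_in y : H (U (- q) y) -> adjoint H A y = U (- q) y.
Proof.
move=> Hy; rewrite adjointE; apply: proj_uniq => //.
by move=> x _; rewrite subrr inner0l.
Qed.

Lemma adjoint_eq0 y : adjoint H A y = 0 <-> perp (U q @` H) y.
Proof.
rewrite adjointE; split=> [y0 _ [x Hx <-]|yp].
  by have := proj_perp cE (U (- q) y) cH; rewrite y0 subr0 UadjR => /(_ _ Hx).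
apply: proj_uniq => //; first exact: csub0.
by move=> x Hx; rewrite subr0 -UadjR; apply: yp; exists x.
Qed.

Lemma kernel_adjointE : kernel_on H (adjoint H A) = H `&` perp (U q @` H).
Proof. by apply/seteqP; split=> x [Hx /adjoint_eq0 ?]. Qed.

(** Invariance of the relative complement of N under U^q replaces invariance of N under the adjoint:
    the part [d] of the adjoint image orthogonal to N satisfies <d, d> = <U^(-q) x, d> = <x, U^q d>
    = 0. *)
Lemma reducesI N : closed_subspace N -> N `<=` H ->
  (forall x, N x -> N (U q x)) ->
  (forall x, H x -> perp N x -> perp N (U q x)) -> reduces H A N.
Proof.
move=> cN NH Nq Nq'; split => // x Nx; first by rewrite AU; [exact: Nq|exact: NH].
rewrite adjointE; set z := proj H _; have Hz : H z by exact: proj_in.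
have [Np dp] := projP cE z cN; set d := z - proj N z in dp.
have Hd : H d by apply: csubB => //; exact: NH.
suff : d = 0 by move/eqP; rewrite subr_eq0 => /eqP ->.
apply: inner_eq0; rewrite {1}/d innerBl (perpC Np dp) subr0.
have := proj_perp cE (U (- q) x) cH Hd; rewrite -/z innerBl.
by rewrite -UadjR (perpC Nx (Nq' _ Hd dp)) sub0r => /eqP; rewrite oppr_eq0 => /eqP.
Qed.

Lemma reducesU N x : reduces H A N -> N x -> N (U q x).
Proof. by move=> [_ NH Nq _] Nx; rewrite -AU; [exact: Nq|exact: NH]. Qed.

Lemma reducesUN N x : reduces H A N -> N x -> H (U (- q) x) -> N (U (- q) x).
Proof. by move=> [_ NH _ Nq] Nx Hx; rewrite -adjoint_in//; exact: Nq. Qed.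

End reducing.
End unitary_group.

(** * The decomposition of the past *)

Section cyclic_dimension.
Variables (R : realType) (E : innerProductType R).
Implicit Types (x y z : E) (M N : set E).
Hypothesis cE : seq_complete E.
Variables (A : E -> E) (f : nat -> E).
Hypothesis fS : forall n, A (f n) = f n.+1.
Hypothesis A_clspan : forall (D : set E) M, closed_subspace M ->
  (forall a, D a -> M (A a)) -> forall x, clspan D x -> M (A x).

Let S (j : nat) : set E := clspan [set f m | m in [set m | (m < j)%N]].

Let cS j : closed_subspace (S j). Proof. exact: clspan_csub. Qed.

Let S_mono i j : (i <= j)%N -> S i `<=` S j.
Proof. by move=> ij; apply: clspan_mono => _ [m /= mi <-]; exists m => //=; exact: leq_trans ij. Qed.

Let S_stable j : S j (f j) -> clspan [set f m | m in [set: nat]] = S j.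
Proof.
move=> Sj; apply/seteqP; split; last by apply: clspan_mono => _ [m _ <-]; exists m.
apply: clspan_min => // _ [m _ <-].
have [mj|] := ltnP m j; first by apply: clspan_sub; exists m.
move=> /subnKC <-; elim: (m - j)%N => [|n IH]; first by rewrite addn0.
rewrite addnS -fS; apply: (A_clspan (cS j)) IH => _ [k /= kj <-]; rewrite fS.
move: kj; rewrite leq_eqVlt => /predU1P[->//|kj].
by apply: clspan_sub; exists k.+1.
Qed.

Let gram_schmidt M n : closed_subspace M -> (forall m, M (f m)) ->
  (forall j, (j < n)%N -> ~ S j (f j)) ->
  exists e : 'I_n -> E,
    (forall i, M (e i)) /\ (forall i j, inner (e i) (e j) = (i == j)%:R).
Proof.
move=> cM Mf nS; pose g (i : 'I_n) := f i - proj (S i) (f i).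
have SM j : S j `<=` M by apply: clspan_min => // _ [m _ <-].
have g0 i : nrm (g i) != 0.
  apply/eqP => /nrm0_eq0/eqP; rewrite subr_eq0 => /eqP fi.
  by apply: (nS i (ltn_ord i)); rewrite fi; exact: (proj_in cE).
have Mg i : M (g i) by apply: (csubB cM) => //; apply: (SM i); exact: (proj_in cE).
have o (i j : 'I_n) : (i < j)%N -> inner (g i) (g j) = 0.
  move=> ij; apply: (@perpC _ _ (S j)); last exact: (proj_perp cE).
  apply: (csubB (cS j)); first by apply: clspan_sub; exists i.
  by apply: (S_mono (ltnW ij)); exact: (proj_in cE).
exists (fun i => (nrm (g i))^-1%:C *: g i); split=> [i|i j]; first exact: csubZ.
rewrite innerZl innerZr; have [->|ij] := eqVneq i j; last first.
  suff -> : inner (g i) (g j) = 0 by rewrite !mulr0.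
  have [|] := ltnP i j; first exact: o.
  by rewrite leq_eqVlt eq_sym (negPf (_ : val i != val j))//= => /o/inner_eq0C.
rewrite innerxx -nrmE conjc_real -[_ ^+ 2]rmorphXn -!rmorphM/=.
by rewrite -[RHS]/(1%:C); congr (_%:C); field; exact: g0.
Qed.

(* If [f j] is in the span [S j] of the previous vectors, then [S j] is stable
   under [A] and contains everything; before the first such [j], Gram-Schmidt
   provides [j] orthonormal vectors of [M]. *)
Lemma clspan_hdim M : closed_subspace M -> (forall m, M (f m)) ->
  clspan [set f m | m in [set m : nat | (m%:R%:E < hdim M)%E]] =
  clspan [set f m | m in [set: nat]].
Proof.
move=> cM Mf; set D := [set m : nat | _].
have hD n : (forall j, (j < n)%N -> ~ S j (f j)) -> (n%:R%:E <= hdim M)%E.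
  by move=> /(gram_schmidt cM Mf) He; apply: ereal_sup_ubound; exists n.
have [[j Sj]|nS] := pselect (exists j, S j (f j)); last first.
  congr clspan; congr image; apply/seteqP; split => // m _.
  apply: (@lt_le_trans _ _ m.+1%:R%:E); first by rewrite lte_fin ltr_nat.
  by apply: hD => j _ Sj; apply: nS; exists j.
have : exists j, `[< S j (f j) >] by exists j; apply/asboolP.
case/ex_minnP => {Sj}j /asboolP Sj jmin.
apply/seteqP; split; first by apply: clspan_mono => _ [m _ <-]; exists m.
rewrite (S_stable Sj); apply: clspan_mono => _ [m /= mj <-]; exists m => //=.
apply: (@lt_le_trans _ _ j%:R%:E); first by rewrite lte_fin ltr_nat.
by apply: hD => k kj /asboolP/jmin; rewrite leqNgt kj.
Qed.

End cyclic_dimension.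

Section decomposition.
Variables (R : realType) (E : innerProductType R).
Implicit Types (x y z : E) (A M N : set E) (p q : int * int).
Variables (U : int * int -> E -> E) (x0 : E) (V1 V2 : E -> E).
Hypotheses (hU : unitary_group U) (cE : seq_complete E).

Let H : set E := clspan [set U p x0 | p in lexJ].

Hypothesis H_inf : forall x, (forall n : nat, H (U (0, - n%:Z) x)) -> x = 0.
Hypothesis V1E : forall x, H x -> V1 x = U dir1 x.
Hypothesis V2E : forall x, H x -> V2 x = U dir2 x.

Let cH : closed_subspace H. Proof. exact: clspan_csub. Qed.

Let HU p x : lexJ p -> H x -> H (U p x).
Proof.
move=> Jp; apply: (U_clspan hU) => // _ [q Jq <-].
by apply: clspan_sub; exists (p + q); [exact: lexJD|rewrite (UD hU)].
Qed.

Let H1 x : H x -> H (U dir1 x). Proof. exact/HU/lexTJ/lexT1. Qed.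

Definition wandering1 : set E := H `&` perp (U dir1 @` H).
Local Notation W1 := wandering1.

Let cW1 : closed_subspace W1.
Proof. by apply: csubI => //; exact: perp_csub. Qed.

Let W1_perp w p x : W1 w -> lexT p -> H x -> inner w (U p x) = 0.
Proof.
move=> [_ Ww] Tp Hx; apply: Ww; exists (U (p - dir1) x).
  by apply: HU => //; exact: lexT_e1.
by rewrite -(UD hU) addrC subrK.
Qed.

Let W1_orth p q w w' : p <> q -> W1 w -> W1 w' -> inner (U p w) (U q w') = 0.
Proof.
move=> pq Ww Ww'; have [|Tqp|] := @lex_total (q - p).
- by move=> /eqP; rewrite subr_eq0 => /eqP/esym.
- by rewrite (UadjL hU) -(UD hU) addrC W1_perp//; case: Ww'.
rewrite opprB => Tpq; apply: inner_eq0C.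
by rewrite (UadjL hU) -(UD hU) addrC W1_perp//; case: Ww.
Qed.

Definition diagram_part : set E := clspan (\bigcup_(p in lexJ) (U p @` W1)).
Local Notation Ht := diagram_part.

Definition evanescent_part : set E := H `&` perp Ht.
Local Notation He := evanescent_part.

Let cHt : closed_subspace Ht. Proof. exact: clspan_csub. Qed.

Let cHe : closed_subspace He.
Proof. by apply: csubI => //; exact: perp_csub. Qed.

Let HtH : Ht `<=` H.
Proof.
apply: clspan_min => // _ [p Jp [w [Hw _] <-]]; exact: HU.
Qed.

Let HeH : He `<=` H. Proof. by move=> x []. Qed.

Let W1Ht p w : lexJ p -> W1 w -> Ht (U p w).
Proof. by move=> Jp Ww; apply: clspan_sub; exists p => //; exists w. Qed.

Let perp_Ht x : (forall p w, lexJ p -> W1 w -> inner x (U p w) = 0) -> perp Ht x.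
Proof. by move=> K; apply: perp_clspan => _ [p Jp [w Ww <-]]; exact: K. Qed.

Lemma diagram_evanescent_sum : orth_sum2 H Ht He.
Proof.
split => //; first by move=> x y Hx [_ Hy]; apply: perpC Hx Hy.
apply/seteqP; split=> [x Hx|_ [x Hx [y [Hy _] <-]]]; last first.
  by apply: (csubD cH) => //; exact: HtH.
have [Px Qx] := projP cE x cHt; exists (proj Ht x) => //.
exists (x - proj Ht x); last by rewrite addrC subrK.
by split => //; apply: (csubB cH) => //; exact: HtH.
Qed.

Let HtU q x : lexJ q -> Ht x -> Ht (U q x).
Proof.
move=> Jq; apply: (U_clspan hU) => // _ [p Jp [w Ww <-]].
by rewrite -(UD hU); apply: W1Ht => //; exact: lexJD.
Qed.

(** To pair U^q x with U^p w, compare p and q. If q <= p, then U^(p-q) w is still in Ht; if p < q,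
    then U^(q-p) x lies in U^dir1 H, to which w is orthogonal. *)
Let HeU q x : lexJ q -> He x -> He (U q x).
Proof.
move=> Jq [Hx xp]; split; first exact: HU.
apply: perp_Ht => p w Jp Ww; rewrite (UadjL hU) -(UD hU).
have [Jpq|/lexNJ Tpq] := pselect (lexJ (- q + p)); first by apply: xp; exact: W1Ht.
rewrite -[- q + p]opprK -(UadjL hU); apply: inner_eq0C.
exact: W1_perp.
Qed.

Let Ht_reduces q (A : E -> E) : lexJ q -> (forall x, H x -> A x = U q x) -> reduces H A Ht.
Proof.
move=> Jq Aq; apply: (reducesI hU cE cH Aq) => // [x|x Hx xp]; first exact: HtU.
by have [] : He (U q x) by apply: HeU.
Qed.

Let He_reduces q (A : E -> E) : lexJ q -> (forall x, H x -> A x = U q x) -> reduces H A He.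
Proof.
move=> Jq Aq; apply: (reducesI hU cE cH Aq) => // [x|x Hx xp]; first exact: HeU.
(* [reducesI] asks that U^q preserve the complement of He in H; this complement is Ht, already known
   to be invariant. *)
suff /HtU-/(_ _ Jq) Htx : Ht x by move=> y [_ yp]; apply: perpC Htx yp.
have [Px Qx] := projP cE x cHt; suff /eqP : x - proj Ht x = 0.
  by rewrite subr_eq0 => /eqP ->.
have Hex : He (x - proj Ht x) by split => //; apply: (csubB cH) => //; exact: HtH.
by apply: inner_eq0; rewrite {1}innerBl xp// (perpC Px Qx) subr0.
Qed.

Lemma diagram_part_reduces1 : reduces H V1 Ht.
Proof. exact: Ht_reduces (lexTJ lexT1) V1E. Qed.

Lemma diagram_part_reduces2 : reduces H V2 Ht.
Proof. exact: Ht_reduces (lexTJ lexT_e2) V2E. Qed.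

Lemma evanescent_part_reduces1 : reduces H V1 He.
Proof. exact: He_reduces (lexTJ lexT1) V1E. Qed.

Lemma evanescent_part_reduces2 : reduces H V2 He.
Proof. exact: He_reduces (lexTJ lexT_e2) V2E. Qed.

Section Vpow_reducing.
Variable N : set E.
Hypotheses (N1 : reduces H V1 N) (N2 : reduces H V2 N).

Let cN : closed_subspace N. Proof. by case: N1. Qed.

Let NH : N `<=` H. Proof. by case: N1. Qed.

Let NV1 x : N x -> V1 x = U dir1 x. Proof. by move/NH/V1E. Qed.
Let NV2 x : N x -> V2 x = U dir2 x. Proof. by move/NH/V2E. Qed.

Let NUk (k : nat) x : N x -> N (U (k%:Z, 0) x).
Proof.
elim: k x => [|k IH] x Nx; first by rewrite (U0 hU).
have -> : (k.+1%:Z, 0%Z) = (k%:Z, 0%Z) + dir1 by rewrite -addn1.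
by rewrite (UD hU); apply: IH; apply: (reducesU V1E).
Qed.

Let NUl (l : nat) x : N x -> N (U (0, l%:Z) x).
Proof.
elim: l x => [|l IH] x Nx; first by rewrite (U0 hU).
have -> : (0%Z, l.+1%:Z) = (0%Z, l%:Z) + dir2 by rewrite -addn1.
by rewrite (UD hU); apply: IH; apply: (reducesU V2E).
Qed.

(** Every (-k, l+1) lies in [lexJ], so each intermediate vector stays in H and the adjoint of V1
    acts as U^(-dir1) without truncation. On the row 0 the points (-k, 0) with k > 0 leave the
    cone. *)
Let NUkl (k l : nat) x : N x -> N (U (- k%:Z, l.+1%:Z) x).
Proof.
move=> Nx; elim: k => [|k IH]; first exact: NUl.
have e : (- k.+1%:Z, l.+1%:Z) = - dir1 + (- k%:Z, l.+1%:Z).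
  by congr pair; rewrite /=; lia.
rewrite e (UD hU); apply: (reducesUN hU cE cH V1E N1) => //.
rewrite -(UD hU) -e; apply: HU; last exact: NH.
by rewrite lexJE; left.
Qed.

Lemma reducing_invariant p x : lexJ p -> N x -> N (U p x).
Proof.
case: p => k l /lexJE/= K Nx; case: l K => l K; last lia.
case: k K => k K.
  have -> : (Posz k, Posz l) = (k%:Z, 0%Z) + (0%Z, l%:Z).
    by congr pair; rewrite /=; lia.
  by rewrite (UD hU); apply/NUk/NUl.
by case: l K => [|l] K; [lia|rewrite NegzE; exact: NUkl].
Qed.

Lemma reducing_iter1 m x : N x -> iter m V1 x = U (m%:Z, 0) x.
Proof.
move=> Nx; elim: m => [|m IH] /=; first by rewrite (U0 hU).
rewrite IH NV1; last exact: NUk.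
by rewrite -(UD hU); congr (U _ x); congr pair; rewrite /=; lia.
Qed.

Lemma reducing_iter2 m x : N x -> iter m V2 x = U (0, m%:Z) x.
Proof.
move=> Nx; elim: m => [|m IH] /=; first by rewrite (U0 hU).
rewrite IH NV2; last exact: NUl.
by rewrite -(UD hU); congr (U _ x); congr pair; rewrite /=; lia.
Qed.

Lemma reducing_VpowE p x : lexJ p -> N x -> Vpow N V1 V2 p x = U p x.
Proof.
case: p => k l Jkl Nx; have := Jkl; rewrite lexJE/= => kl.
case: l Jkl kl => l Jkl kl; last lia.
case: k Jkl kl => k Jkl kl; rewrite /Vpow/=.
  rewrite reducing_iter2// reducing_iter1//; last exact: NUl.
  by rewrite -(UD hU); congr (U _ x); congr pair; rewrite /=; lia.
case: l Jkl kl => [|l] Jkl kl; first lia.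
rewrite reducing_iter2// -/(iter k.+1 _ _) NegzE.
elim: k.+1 => [//|m IH] /=; rewrite IH.
have e : (- m.+1%:Z, l.+1%:Z) = - dir1 + (- m%:Z, l.+1%:Z).
  by congr pair; rewrite /=; lia.
by rewrite (adjoint_in hU cE cN NV1) -(UD hU) -e//; exact: NUkl.
Qed.

Lemma reducing_semigroup_pair : semigroup_pair lexT N V1 V2.
Proof.
have iso p (A : E -> E) : lexJ p -> (forall x, N x -> A x = U p x) -> isometry_on N A.
  move=> Jp AU; split; last by move=> x Nx; rewrite AU// (U_norm hU).
  split=> [x Nx|a x y Nx Ny]; first by rewrite AU//; exact: reducing_invariant.
  by rewrite !AU// ?(UL hU)//; exact: csubL.
split.
- exact: lexT_admissible.
- exact: iso (lexTJ lexT1) NV1.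
- exact: iso (lexTJ lexT_e2) NV2.
- move=> x Nx; have N1x := reducing_invariant (lexTJ lexT1) Nx.
  have N2x := reducing_invariant (lexTJ lexT_e2) Nx.
  by rewrite NV1 !NV2 ?NV1// -!(UD hU) addrC.
- by move=> p /lexTJ Jp; apply: (iso p) => // x; exact: reducing_VpowE.
Qed.

(* [V^(p)* V^(q)] acts on [N] as [U (q - p)], and [q - p] is [dir1] plus an
   element of [lexJ] because it is in [lexT]. *)
Lemma quasi_unitary_sub : quasi_unitary lexT N V1 V2 -> N `<=` U dir1 @` N.
Proof.
move=> [_ {1}<-]; have cUN := U_csub hU dir1 cN.
suff K : [set y | exists p q x, [/\ lexT p, lexT q, lexT (q - p), N x &
    y = adjoint N (Vpow N V1 V2 p) (Vpow N V1 V2 q x)]] `<=` U dir1 @` N.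
  by move=> y /(closure_subset K); exact: csub_closure.
move=> _ [p [q [x [Tp Tq Tqp Nx ->]]]].
have Jp := lexTJ Tp; have Jq := lexTJ Tq.
rewrite (reducing_VpowE Jq Nx).
have Nqp : N (U (q - p) x) by apply: reducing_invariant => //; exact: lexTJ.
rewrite (adjoint_in hU cE cN (q := p)); last 2 first.
- by move=> y; exact: reducing_VpowE.
- by rewrite -(UD hU) addrC.
exists (U (q - p - dir1) x); first by apply: reducing_invariant => //; exact: lexT_e1.
by rewrite -!(UD hU); congr (U _ x); rewrite addrC subrK addrC.
Qed.

End Vpow_reducing.

(** Since Ht reduces A, the adjoints formed in Ht and in H agree on Ht. *)
Let reduces_trans q (A : E -> E) N : (forall x, H x -> A x = U q x) ->
  reduces H A Ht -> reduces Ht A N -> reduces H A N.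
Proof.
move=> AU [_ _ _ HtA] [cN NHt NA NA']; split => // [|x Nx]; first exact: subset_trans HtH.
rewrite (_ : adjoint H A x = adjoint Ht A x); first exact: NA'.
rewrite (adjointE hU cE cHt (q := q)) => [|y /HtH]; last exact: AU.
apply/esym/(proj_uniq cE cHt); first exact/HtA/NHt.
rewrite (adjointE hU cE cH (q := q))// => y /HtH Hy.
exact: (proj_perp cE).
Qed.

Lemma diagram_part_tnu : totally_non_unitary lexT Ht V1 V2.
Proof.
have Ht1 := diagram_part_reduces1; have Ht2 := diagram_part_reduces2.
split=> [|N rN1 rN2 qN]; first exact: reducing_semigroup_pair.
have NHt : N `<=` Ht by case: rN1.
have {}rN1 := reduces_trans V1E Ht1 rN1.
have {}rN2 := reduces_trans V2E Ht2 rN2.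
have cN : closed_subspace N by case: rN1.
have NUN := quasi_unitary_sub rN1 rN2 qN.
(* The inclusion of N in U^dir1 N lets horizontal translations act on N in both directions. *)
have Nk (k : int) x : N x -> N (U (k, 0) x).
  case: k => k Nx; first by apply: reducing_invariant => //; rewrite lexJE; right.
  rewrite NegzE; elim: k.+1 => [|m IH]; first by rewrite (U0 hU).
  have /NUN[y Ny e] := IH; rewrite (_ : U _ x = y)//.
  rewrite (_ : (_, _) = - dir1 + (- m%:Z, 0)); last by congr pair; rewrite /=; lia.
  by rewrite (UD hU) -e (UK hU).
(* Induction on the row. For l = 0 the vector x lies in U^dir1 H, which is orthogonal to W1. For the
   next row, one factor U^dir2 is moved to the other side as the adjoint of V2, under which N is
   stable. *)
have Nl (l : nat) x w : N x -> W1 w -> inner x (U (0, l%:Z) w) = 0.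
  elim: l x => [|l IH] x Nx Ww.
    have /NUN[y Ny <-] := Nx; rewrite (U0 hU); apply: inner_eq0C.
    by apply: W1_perp Ww lexT1 _; apply/HtH/NHt.
  have Hl : H (U (0, l%:Z) w) by apply: HU; [rewrite lexJE/=; lia|case: Ww].
  rewrite (_ : (0, _) = dir2 + (0, l%:Z)); last by congr pair; rewrite /=; lia.
  rewrite (UD hU) (UadjR hU); set z := U (0, _) w in Hl *.
  have := IH (adjoint H V2 x); rewrite (adjointE hU cE cH V2E) -/z => <- //.
    apply/eqP; rewrite -subr_eq0 -innerBl; apply/eqP; exact: (proj_perp cE).
  by rewrite -(adjointE hU cE cH V2E); case: rN2 => _ _ _; apply.
apply/seteqP; split=> [x Nx|x ->]; last exact: csub0.
apply: (@perp_self _ _ Ht); first exact: NHt.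
apply: perp_Ht => -[k l] w Jp Ww.
(* The horizontal part of the exponent is moved onto x, which thereby stays in N. *)
have -> : (k, l) = (k, 0) + (0, l) by congr pair; rewrite /=; lia.
rewrite (UD hU) (UadjR hU) (_ : - (k, 0) = (- k, 0)); last by congr pair; rewrite /=; lia.
case: l Jp => l Jp; first by apply: Nl => //; exact: Nk.
by move: Jp; rewrite lexJE/=; lia.
Qed.

Lemma kernel_wandering1 : kernel_on H (adjoint H V1) = W1.
Proof. exact: (kernel_adjointE hU cE cH V1E). Qed.

Lemma diagram_part_orth_sum : orth_sum lexJ (fun p => U p @` W1) Ht.
Proof.
split=> // [p _|p q _ _ pq _ _ [w Ww <-] [w' Ww' <-]]; last exact: W1_orth.
exact: U_csub.
Qed.

Lemma diagram_part_Vpow_sum :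
  orth_sum lexJ (fun p => Vpow H V1 V2 p @` kernel_on H (adjoint H V1)) Ht.
Proof.
(* [Vpow] is formed in H here, so H itself serves as the reducing subspace in [reducing_VpowE]. *)
have HH (A : E -> E) q : lexJ q -> (forall x, H x -> A x = U q x) -> reduces H A H.
  move=> Jq AU; split => // x Hx; first by rewrite AU//; exact: HU.
  by rewrite (adjointE hU cE cH AU); exact: proj_in.
have VE p : lexJ p -> Vpow H V1 V2 p @` kernel_on H (adjoint H V1) = U p @` W1.
  move=> Jp; rewrite kernel_wandering1; apply: eq_imagel => w [Hw _].
  by apply: reducing_VpowE => //; [exact: HH (lexTJ lexT1) V1E|exact: HH (lexTJ lexT_e2) V2E].
have [c o ->] := diagram_part_orth_sum; split=> [p Jp|p q Jp Jq pq|].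
- by rewrite VE//; exact: c.
- by rewrite !VE//; exact: o.
- by congr clspan; apply: eq_bigcupr => p Jp; rewrite VE.
Qed.

Let He1 x : He x -> He (U (- dir1) x).
Proof.
move=> Hx; apply: (reducesUN hU cE cH V1E evanescent_part_reduces1) => //.
have cUH := U_csub hU dir1 cH.
have [Px xz] := projP cE x cUH; have [z Hz zE] := Px.
suff : x - proj (U dir1 @` H) x = 0.
  by move=> /eqP; rewrite subr_eq0 => /eqP ->; rewrite -zE (UK hU).
have [Hx' xp] := Hx; have Hp : H (proj (U dir1 @` H) x) by rewrite -zE; exact: H1.
have Wd : W1 (x - proj (U dir1 @` H) x) by split => //; exact: (csubB cH).
apply: inner_eq0; rewrite {1}innerBl (perpC Px xz) subr0.
by apply: xp; rewrite -[X in Ht X](U0 hU); apply: W1Ht => //; exact: lexJ0.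
Qed.

Let HeV1 x : He x -> V1 x = U dir1 x. Proof. by move/HeH/V1E. Qed.

Let He_pair : semigroup_pair lexT He V1 V2.
Proof.
exact: (reducing_semigroup_pair evanescent_part_reduces1 evanescent_part_reduces2).
Qed.

Lemma evanescent_part_unitary : unitary_on He V1.
Proof.
split; first by case: He_pair.
apply/seteqP; split=> [_ [x Hx <-]|x Hx]; first by rewrite HeV1//; exact/HeU/Hx/lexTJ/lexT1.
by exists (U (- dir1) x); [exact: He1|rewrite HeV1; [rewrite (UNK hU)|exact: He1]].
Qed.

(** The wandering space of V2 inside He only; the kernel of the adjoint of V2 on H may also meet
    Ht. *)
Definition wandering2 : set E := He `&` perp (U dir2 @` He).
Local Notation N := wandering2.

Let cN : closed_subspace N.
Proof. by apply: csubI => //; exact: perp_csub. Qed.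

Let He2 (n : nat) x : He x -> He (U (0, n%:Z) x).
Proof. by apply: HeU; rewrite lexJE/=; lia. Qed.

Lemma evanescent_part_orth_sum :
  orth_sum [set: nat] (fun n => U (0, n%:Z) @` N) He.
Proof.
have o (m n : nat) x y : (m < n)%N -> N x -> N y ->
    inner (U (0, m%:Z) x) (U (0, n%:Z) y) = 0.
  move=> mn [_ Nx] [Ny _]; rewrite (UadjL hU) -(UD hU).
  apply: Nx; exists (U (0, (n - m.+1)%N%:Z) y); first exact: He2.
  by rewrite -(UD hU); congr (U _ y); congr pair; rewrite /=; lia.
split=> [n _|m n _ _ mn _ _ [x Nx <-] [y Ny <-]|]; first exact: U_csub.
  have [mn'|nm|//] := ltngtP m n; first exact: o.
  by apply: inner_eq0C; exact: o.
apply/esym/(csub_eq cE) => //; first exact: clspan_csub.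
  by apply: clspan_min => // _ [n _ [x [Hx _] <-]]; exact: He2.
(* A vector orthogonal to all summands can be pulled back along [dir2] forever within He: the part
   of U^(0,-n) x orthogonal to U^dir2 He lies in N, and x is orthogonal to U^(0,n) N. *)
move=> x Hx xp; apply: H_inf => n; apply: HeH.
elim: n => [|n IH]; first by rewrite (U0 hU).
have cUH := U_csub hU dir2 cHe; set y := U (0, - n%:Z) x in IH.
have [Py yz] := projP cE y cUH; have [z Hz zE] := Py.
suff : y - proj (U dir2 @` He) y = 0.
  move=> /eqP; rewrite subr_eq0 -zE => /eqP yE.
  rewrite (_ : (_, _) = - dir2 + (0, - n%:Z)); last by congr pair; rewrite /=; lia.
  by rewrite (UD hU) -/y yE (UK hU).
have Ny : N (y - proj (U dir2 @` He) y).
  by split=> //; apply: (csubB cHe) => //; rewrite -zE; exact: (He2 1).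
apply: inner_eq0; rewrite {1}innerBl (perpC Py yz) subr0.
rewrite /y (UadjL hU) (_ : - (0, _) = (0, n%:Z)); last by congr pair; rewrite /=; lia.
by apply: xp; apply: clspan_sub; exists n => //; exists (y - proj (U dir2 @` He) y).
Qed.

Lemma evanescent_part_iter2 n x : He x -> iter n V2 x = U (0, n%:Z) x.
Proof. exact: (reducing_iter2 evanescent_part_reduces1 evanescent_part_reduces2). Qed.

Lemma evanescent_part_iter1 n x : He x -> iter n V1 x = U (n%:Z, 0) x.
Proof. exact: (reducing_iter1 evanescent_part_reduces1). Qed.

Lemma evanescent_part_shift : unilateral_shift He V2.
Proof.
split; first by case: He_pair.
exists N; rewrite (_ : (fun _ => _) = (fun n : nat => U (0, n%:Z) @` N)).
  exact: evanescent_part_orth_sum.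
apply/funext => n; apply: eq_imagel => x [Hx _]; exact: evanescent_part_iter2.
Qed.

(** On He, orthogonality to U^dir2 He already gives orthogonality to U^dir2 H, because U^dir2 Ht
    lies in Ht. *)
Lemma kernel_wandering2 : kernel_on H (adjoint H V2) `&` He = N.
Proof.
rewrite (kernel_adjointE hU cE cH V2E); apply/seteqP; split=> x.
  by move=> [[_ xp] Hx]; split => // _ [y Hy <-]; apply: xp; exists y => //; exact: HeH.
move=> [Hx xp]; split=> //; split; first exact: HeH.
move=> _ [y Hy <-]; have [_ _ _ HE] := diagram_evanescent_sum.
move: Hy; rewrite HE => -[a Ha [b Hb <-]]; rewrite (U_D hU) innerDr.
rewrite (xp _ (imageP _ Hb)) addr0; case: Hx => _; apply.
exact/HtU/Ha/lexTJ/lexT_e2.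
Qed.

Definition wandering2_vector : E := proj N x0.
Local Notation v := wandering2_vector.

Let NU1 (k : int) x : N x -> N (U (k, 0) x).
Proof.
have Hek (j : int) y : He y -> He (U (j, 0) y).
  case: j => j Hy; first by apply: HeU => //; rewrite lexJE; right.
  rewrite NegzE; elim: j.+1 => [|m IH]; first by rewrite (U0 hU).
  rewrite (_ : (_, _) = - dir1 + (- m%:Z, 0)); last by congr pair; rewrite /=; lia.
  by rewrite (UD hU); exact: He1.
move=> [Hx xp]; split; first exact: Hek.
move=> _ [y Hy <-]; rewrite (UadjL hU) -(UD hU) addrC (UD hU); apply: xp.
exists (U (- (k, 0)) y) => //.
by rewrite (_ : - (k, 0) = (- k, 0)); [exact: Hek|congr pair; rewrite /=; lia].
Qed.

Let Nv : N v. Proof. exact: (proj_in cE). Qed.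

(** Let x in N be orthogonal to the forward orbit of v and test it on the generators U^(k,l) x0. On
    the row l = 0 only k >= 0 occurs, and x sees only the component U^(k,0) v; on the rows l > 0 it
    sees nothing. Hence nonnegative powers span N, although U^(k,0) preserves N for all integers
    k. *)
Lemma wandering2_clspan :
  clspan [set U (m%:Z, 0) v | m in [set: nat]] = N.
Proof.
apply: (csub_eq cE) => //; first exact: clspan_csub.
  by apply: clspan_min => // _ [m _ <-]; exact: NU1.
move=> x Nx xp; have Hx : H x by case: Nx => /HeH.
have NU2 y z : N y -> H z -> inner y (U dir2 z) = 0.
  rewrite -kernel_wandering2 (kernel_adjointE hU cE cH V2E) => -[[_ K] _] Hz.
  by apply: K; exists z.
apply: (perp_self Hx); apply: perp_clspan => _ [[k l] Jp <-].
have [l0|l0] := eqVneq l 0.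
  move: Jp; rewrite l0 lexJE/= => kl; case: k kl => k kl; last lia.
  have -> : U (k%:Z, 0) x0 = U (k%:Z, 0) v + U (k%:Z, 0) (x0 - v).
    by rewrite -(U_D hU) addrC subrK.
  rewrite innerDr xp ?add0r; last by apply: clspan_sub; exists k.
  rewrite (UadjR hU); apply: perpC (proj_perp cE _ cN).
  by rewrite (_ : - (_, _) = (- k%:Z, 0)); [exact: NU1|congr pair; rewrite /=; lia].
(* Here k may be negative: U^(k,0) is moved onto x, and what remains lies in U^dir2 H, which is
   orthogonal to N. *)
have -> : (k, l) = (k, 0) + (dir2 + (0, l - 1)) by congr pair; rewrite /=; lia.
rewrite (UD hU) (UadjR hU) (UD hU); apply: NU2.
  by rewrite (_ : - (_, _) = (- k, 0)); [exact: NU1|congr pair; rewrite /=; lia].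
apply: clspan_sub; exists (0, l - 1) => //.
by move: Jp; rewrite !lexJE/=; lia.
Qed.

Lemma wandering2_cyclic :
  cyclic_vector (kernel_on H (adjoint H V2) `&` He) V1 v.
Proof.
rewrite kernel_wandering2; split=> //.
  split=> [x Nx|a x y [Hx _] [Hy _]].
    by rewrite HeV1; [exact: (NU1 1)|case: Nx].
  by rewrite !HeV1// ?(UL hU)//; exact: csubL.
rewrite -wandering2_clspan; congr clspan; apply: eq_imagel => m _.
by rewrite evanescent_part_iter1//; case: Nv.
Qed.

(** The cut-off is the dimension of the whole kernel of the adjoint of V2, which may exceed that of
    N; [clspan_hdim] accepts any closed subspace containing the orbit of v. *)
Lemma evanescent_part_cyclic_sum :
  orth_sum [set: nat] (fun n => clspan [set iter n V2 (iter m V1 v) |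
    m in [set m : nat | (m%:R%:E < hdim (kernel_on H (adjoint H V2)))%E]]) He.
Proof.
rewrite (_ : (fun _ => _) = (fun n : nat => U (0, n%:Z) @` N)).
  exact: evanescent_part_orth_sum.
apply/funext => n; rewrite -[in RHS]wandering2_clspan.
have Nk m : N (U (m%:Z, 0) v) by exact: NU1.
have cK : closed_subspace (kernel_on H (adjoint H V2)).
  by rewrite (kernel_adjointE hU cE cH V2E); apply: csubI => //; exact: perp_csub.
rewrite -(clspan_hdim cE _ _ cK (A := U dir1)).
- rewrite (U_clspan_image hU) image_comp; congr clspan; apply: eq_imagel => m _ /=.
  rewrite evanescent_part_iter1; last by case: Nv.
  by rewrite evanescent_part_iter2//; case: (Nk m).
- by move=> m; rewrite -(UD hU); congr (U _ v); congr pair; rewrite /=; lia.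
- by move=> D M cM DM; exact: (U_clspan hU).
- by move=> m; have := Nk m; rewrite -kernel_wandering2 => -[].
Qed.

Definition innovation : E := proj W1 x0.
Local Notation e0 := innovation.

Let W1e : W1 e0. Proof. exact: (proj_in cE). Qed.

(** Removing from w its component along e0 leaves a vector of W1. It is orthogonal to x0, as x0 - e0
    is orthogonal to W1, and to U^p x0 for all positive p, hence to H. If e0 = 0, the formula says
    that W1 is zero. *)
Let W1_innovation w : W1 w -> w = (inner w e0 / inner e0 e0) *: e0.
Proof.
move=> Ww; set c := _ / _; apply/eqP; rewrite -subr_eq0; apply/eqP.
have Wd : W1 (w - c *: e0) by apply: (csubB cW1) => //; exact: csubZ.
have de : inner (w - c *: e0) e0 = 0.
  have [->|e00] := eqVneq e0 0; first by rewrite inner0r.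
  rewrite innerBl innerZl /c divfK ?subrr//.
  by apply: contra_neq e00 => /inner_eq0.
move: (w - _) Wd de => d Wd de; have [Hd _] := Wd.
apply: (perp_self Hd); apply: perp_clspan => _ [p [Tp|->] <-].
  by apply: W1_perp => //; apply: clspan_sub; exists 0; [exact: lexJ0|rewrite (U0 hU)].
rewrite -[U _ _]/(U 0 x0) (U0 hU) -[x0](subrK e0) innerDr de addr0.
exact: perpC Wd (proj_perp cE _ cW1).
Qed.

Lemma diagram_part_innovation : Ht = clspan [set U p e0 | p in lexJ].
Proof.
apply/seteqP; split; last first.
  by apply: clspan_min => // _ [p Jp <-]; exact: W1Ht.
apply: clspan_min => [|_ [p Jp [w Ww <-]]]; first exact: clspan_csub.
rewrite (W1_innovation Ww) (U_Z hU); apply: (csubZ _ (clspan_csub _)).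
by apply: clspan_sub; exists p.
Qed.

Lemma innovation_orth p q : p <> q -> inner (U p e0) (U q e0) = 0.
Proof. by move=> pq; exact: W1_orth. Qed.

End decomposition.

(** * Square integrable complex functions *)

Section complex_plane.
Variable R : realType.
Implicit Types z : R[i]^o.

Lemma nrm_complex z : nrm z ^+ 2 = complex.Re z ^+ 2 + complex.Im z ^+ 2.
Proof.
rewrite nrm2E -[inner z z]/(z * (z : R[i])^*%C).
by case: z => a b /=; ring.
Qed.

Lemma Re_le_nrm z : `|complex.Re z| <= nrm z.
Proof.
rewrite -[leRHS]ger0_norm ?nrm_ge0// -ler_sqr// ?nnegrE// !real_normK ?num_real//.
by rewrite nrm_complex lerDl sqr_ge0.
Qed.

Lemma Im_le_nrm z : `|complex.Im z| <= nrm z.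
Proof.
rewrite -[leRHS]ger0_norm ?nrm_ge0// -ler_sqr// ?nnegrE// !real_normK ?num_real//.
by rewrite nrm_complex lerDr sqr_ge0.
Qed.

Lemma nrm_le_ReIm z : nrm z <= `|complex.Re z| + `|complex.Im z|.
Proof.
rewrite -ler_sqr ?nnegrE ?nrm_ge0 ?addr_ge0// nrm_complex.
rewrite -(real_normK (num_real (complex.Re z))) -(real_normK (num_real (complex.Im z))).
have := normr_ge0 (complex.Re z); have := normr_ge0 (complex.Im z).
by move: `|_| `|_| => a b; nra.
Qed.

(** Takes care of the separable range in [strongly_measurable], so that for scalar functions only
    measurability of the real and imaginary parts remains. *)
Lemma complex_separable : exists2 D : set R[i]^o, countable D & forall z, closure D z.
Proof.
exists [set (ratr x.1 +i* ratr x.2 : R[i]^o) | x in [set: rat * rat]].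
  exact: sub_countable (card_image_le _ _) _.
move=> z; apply/closure_nrmP => e e0.
have dr (a : R) : exists q : rat, `|a - ratr q| < e / 2.
  have [|q] := @rat_in_itvoo R (a - e / 2) (a + e / 2).
    by lra.
  by rewrite in_itv/= => ?; exists q; rewrite ltr_norml; lra.
have [q hq] := dr (complex.Re z); have [r hr] := dr (complex.Im z).
exists (ratr q +i* ratr r); first by exists (q, r).
apply: le_lt_trans (nrm_le_ReIm _) _; move: hq hr; case: z => a b /=; lra.
Qed.

End complex_plane.

Lemma strongly_measurableB d (T : measurableType d) (R : realType)
    (E : innerProductType R) (f g : T -> E) :
  strongly_measurable f -> strongly_measurable g -> strongly_measurable (fun w => f w - g w).
Proof.
move=> mf mg; under eq_fun => w do rewrite -scaleN1r.
exact: strongly_measurableD mf (strongly_measurableZ (-1) mg).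
Qed.

Section complex_measurability.
Context d (T : measurableType d) (R : realType).
Implicit Types f g : T -> R[i]^o.

Lemma strongly_measurable_complex f :
  measurable_fun setT (fun w => complex.Re (f w)) ->
  measurable_fun setT (fun w => complex.Im (f w)) -> strongly_measurable f.
Proof.
move=> mr mi; split; last first.
  by have [D cD dD] := complex_separable R; exists D.
move=> h; split.
  rewrite (_ : (fun w => _) = (fun w => complex.Re h * complex.Re (f w) +
      complex.Im h * complex.Im (f w))).
    by apply: measurable_funD; apply: measurable_funM.
  apply/funext => w; rewrite -[inner _ _]/((f w : R[i]) * (h : R[i])^*%C).
  by case: (f w) h => a b [c e] /=; ring.
rewrite (_ : (fun w => _) = (fun w => complex.Re h * complex.Im (f w) -
    complex.Im h * complex.Re (f w))).
  by apply: measurable_funB; apply: measurable_funM.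
apply/funext => w; rewrite -[inner _ _]/((f w : R[i]) * (h : R[i])^*%C).
by case: (f w) h => a b [c e] /=; ring.
Qed.

Lemma strongly_measurable_Re f : strongly_measurable f ->
  measurable_fun setT (fun w => complex.Re (f w)).
Proof.
move=> [/(_ 1)[+ _] _]; congr measurable_fun; apply/funext => w.
rewrite -[inner _ _]/((f w : R[i]) * 1^*%C).
by case: (f w) => a b /=; ring.
Qed.

Lemma strongly_measurable_Im f : strongly_measurable f ->
  measurable_fun setT (fun w => complex.Im (f w)).
Proof.
move=> [/(_ 1)[_ +] _]; congr measurable_fun; apply/funext => w.
rewrite -[inner _ _]/((f w : R[i]) * 1^*%C).
by case: (f w) => a b /=; ring.
Qed.

End complex_measurability.

Section L2_norm.
Context d (T : measurableType d) (R : realType).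
Context (mu : {measure set T -> \bar R}) (E : innerProductType R).
Local Open Scope quotient_scope.
Implicit Types f g : L2fun mu E.

Lemma piL2B f g : \pi_(L2 mu E) (f - g) = \pi_(L2 mu E) f - \pi_(L2 mu E) g.
Proof.
rewrite piL2D; congr (_ + _); rewrite -scaleN1r piL2Z.
exact: (@scaleN1r _ (L2 mu E)).
Qed.

Lemma nrm_piL2 f :
  ((nrm (\pi_(L2 mu E) f) ^+ 2)%:E = \int[mu]_w (nrm (f w) ^+ 2)%:E)%E.
Proof.
rewrite nrm2E -[inner _ _]/(innerL2 _ _) innerL2E /=.
rewrite /Rintegral fineK; last first.
  apply: integrable_fin_num => //; exact: integrable_Re_inner.
by apply: eq_integral => w _; rewrite nrm2E.
Qed.

Lemma nrm_piL2B f g : ((nrm (\pi_(L2 mu E) f - \pi_(L2 mu E) g) ^+ 2)%:E =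
  \int[mu]_w (nrm (f w - g w) ^+ 2)%:E)%E.
Proof. by rewrite -piL2B nrm_piL2. Qed.

End L2_norm.

Lemma cvgn_geometric_increments (R : realType) (a : R ^nat) (C : R) : 0 <= C ->
  (forall n, `|a n.+1 - a n| <= C * 2^-1 ^+ n) -> cvgn a.
Proof.
move=> C0 aC; rewrite (_ : a = (fun n => a 0%N + series (telescope a) n)); last first.
  by apply/funext => n; exact: eq_sum_telescope.
apply: is_cvgD; first exact: is_cvg_cst.
apply: normed_cvg; apply: (@series_le_cvg _ _ (geometric C 2^-1)).
- by move=> n; exact: normr_ge0.
- by move=> n; rewrite /geometric/= mulr_ge0// exprn_ge0.
- exact: aC.
- apply: is_cvg_geometric_series; rewrite ger0_norm// invf_lt1// ltr1n//.
Qed.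

Lemma piL2_eq0 d (T : measurableType d) (R : realType) (mu : {measure set T -> \bar R})
    (f : L2fun mu R[i]^o) :
  {ae mu, forall w, complex.Re (f w) = 0} -> {ae mu, forall w, complex.Im (f w) = 0} ->
  (\pi_(L2 mu R[i]^o) f)%qT = 0.
Proof.
move=> aer aei.
have -> : 0 = (\pi_(L2 mu R[i]^o) 0)%qT by rewrite /GRing.zero/= /Quotient.zero; unlock.
apply/piL2P; near=> w; apply/eqP.
by rewrite eq_complex (near aer w)// (near aei w)// !eqxx.
Unshelve. all: by end_near. Qed.

(** * Completeness of L^2 *)

Section Riesz_Fischer.
Context d (T : measurableType d) (R : realType) (mu : {measure set T -> \bar R}).
Local Notation L2C := (L2 mu R[i]^o).
Local Open Scope quotient_scope.

(** The case of representatives converging at every point, to which [L2_seq_complete] reduces by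
    passing to a subsequence and cutting off a null set. *)
Let L2fun_cvg (f : nat -> L2fun mu R[i]^o) :
  (forall w, cvgn (fun k => complex.Re (f k w))) ->
  (forall w, cvgn (fun k => complex.Im (f k w))) ->
  (forall e : R, 0 < e -> exists k, forall m n, (k <= m)%N -> (k <= n)%N ->
     nrm (\pi_L2C (f m) - \pi_L2C (f n)) < e) ->
  exists l : L2C, forall e : R, 0 < e -> exists k, forall n, (k <= n)%N ->
     nrm (\pi_L2C (f n) - l) < e.
Proof.
move=> cr ci cau.
pose g w : R[i]^o := limn (fun k => complex.Re (f k w)) +i* limn (fun k => complex.Im (f k w)).
have sf k : strongly_measurable (f k) by case: (L2funP (f k)).
have sg : strongly_measurable g.
  apply: strongly_measurable_complex.
    apply: (@measurable_fun_cvg _ _ _ _ (fun k w => complex.Re (f k w))) => [k|w _].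
      exact: strongly_measurable_Re.
    exact: cr.
  apply: (@measurable_fun_cvg _ _ _ _ (fun k w => complex.Im (f k w))) => [k|w _].
    exact: strongly_measurable_Im.
  exact: ci.
(* Fatou's lemma carries a bound on the distances from [f m] to [h] over to [g]. With h = f k it
   gives both the square integrability of [g] and the convergence. *)
have fat (h : L2fun mu R[i]^o) (c : \bar R) N :
    (forall m, (N <= m)%N -> (\int[mu]_w (nrm (f m w - h w) ^+ 2)%:E <= c)%E) ->
    (\int[mu]_w (nrm (g w - h w) ^+ 2)%:E <= c)%E.
  move=> Hc; pose F m w := (nrm (f (m + N)%N w - h w) ^+ 2)%:E.
  have mF m : measurable_fun setT (F m).
    apply/measurable_EFinP/measurable_nrm2.
    by apply: strongly_measurableB; [exact: sf|case: (L2funP h)].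
  have F0 m w : setT w -> (0 <= F m w)%E by rewrite lee_fin sqr_ge0.
  have := fatou mu measurableT mF F0.
  have -> : (\int[mu]_w limn_einf (F ^~ w) = \int[mu]_w (nrm (g w - h w) ^+ 2)%:E)%E.
    apply: eq_integral => w _; apply: (cvg_limn_einf_sup _).1.
    apply: cvg_EFin; first exact: nearW.
    pose q m := (complex.Re (f m w) - complex.Re (h w)) ^+ 2 +
      (complex.Im (f m w) - complex.Im (h w)) ^+ 2.
    rewrite (_ : fine \o _ = [sequence q (m + N)%N]_m); last first.
      by apply/funext => m /=; rewrite nrm_complex !raddfB.
    rewrite cvg_shiftn nrm_complex !raddfB/=.
    have sq (v : R ^nat) (a b : R) : v @ \oo --> a ->
        (fun m => (v m - b) ^+ 2) @ \oo --> (a - b) ^+ 2.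
      move=> va; under eq_fun => m do rewrite expr2.
      by rewrite expr2; apply: cvgM; (apply: cvgB; [exact: va|exact: cvg_cst]).
    by apply: cvgD; apply: sq; [exact: cr|exact: ci].
  move=> /le_trans; apply; rewrite limn_einf_lim.
  apply: lime_le; first exact: is_cvg_einfs.
  apply: nearW => m; apply: le_trans (Hc (m + N)%N (leq_addl _ _)).
  by apply: ereal_inf_lbound; exists m => /=.
have ig : (\int[mu]_w (nrm (g w) ^+ 2)%:E < +oo)%E.
  have [k Hk] := cau 1 ltr01.
  have fk0 w : setT w -> (0 <= (nrm (f k w) ^+ 2)%:E)%E by rewrite lee_fin sqr_ge0.
  have H1 : (\int[mu]_w (nrm (g w - f k w) ^+ 2)%:E <= 1%:E)%E.
    apply: (fat _ _ k) => m km; rewrite -nrm_piL2B lee_fin.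
    by rewrite expr_le1 ?nrm_ge0// ltW// Hk.
  have sgk : strongly_measurable (fun w => g w - f k w) := strongly_measurableB sg (sf k).
  have sgf : square_integrable mu (fun w => g w - f k w).
    by split => //; apply: le_lt_trans H1 _; rewrite ltry.
  have := square_integrableD sgf (L2funP (f k)).
  by under eq_fun => w do rewrite subrK; case.
have gL : g \in @L2pred d T R mu R[i]^o by apply/asboolP; split.
pose G := MkL2fun gL; exists (\pi_L2C G) => e e0.
have e20 : 0 < e / 2 by rewrite divr_gt0.
have [k Hk] := cau _ e20.
exists k => n kn; rewrite nrmBC.
have e2 : e / 2 < e by rewrite ltr_pdivrMr// ltr_pMr// ltr1n.
apply: le_lt_trans e2; rewrite -ler_sqr ?nnegrE ?nrm_ge0 ?divr_ge0 ?(ltW e0)//.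
rewrite -lee_fin nrm_piL2B; apply: (fat _ _ k) => m km.
rewrite -nrm_piL2B lee_fin ler_sqr ?nnegrE ?nrm_ge0 ?divr_ge0 ?(ltW e0)//.
by apply/ltW/Hk.
Qed.

Lemma L2_seq_complete : seq_complete L2C.
Proof.
move=> u cu.
(* The rate 4^-k makes the squared increments smaller than 16^-k; after multiplication by 4^k a
   convergent geometric series remains. *)
have /choice[N HN] : forall k : nat, exists j, forall m n, (j <= m)%N -> (j <= n)%N ->
    nrm (u m - u n) < 4^-1 ^+ k.
  by move=> k; apply: cu; rewrite exprn_gt0.
pose phi k := (\sum_(i < k.+1) (N i).+1)%N.
have phiS k : phi k.+1 = (phi k + (N k.+1).+1)%N by rewrite [LHS]/phi big_ord_recr.
have Nphi k : (N k <= phi k)%N.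
  by rewrite /phi big_ord_recr/= (leq_trans (leqnSn _))// leq_addl.
have phi_ge k : (k <= phi k)%N.
  by elim: k => // k IH; rewrite phiS addnS ltnS (leq_trans IH)// leq_addr.
pose f k : L2fun mu R[i]^o := repr (u (phi k)).
have fE k : \pi_L2C (f k) = u (phi k) by rewrite reprK.
have sf k : strongly_measurable (f k) by case: (L2funP (f k)).
pose dl k w : R := nrm (f k.+1 w - f k w) ^+ 2.
have sdl k : strongly_measurable (fun w => f k.+1 w - f k w).
  exact: strongly_measurableB (sf _) (sf _).
have mdl k : measurable_fun setT (fun w => (4 ^+ k * dl k w)%:E).
  by apply/measurable_EFinP/measurable_funM => //; exact: measurable_nrm2.
have dl0 k w : (0 <= (4 ^+ k * dl k w)%:E)%E.
  by rewrite lee_fin; apply: mulr_ge0; [exact: exprn_ge0|exact: sqr_ge0].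
(* The weights [4 ^ k] keep [S] integrable, and where [S] is finite they force the
   increments of [f] to decay like [2 ^- k]. *)
pose S w := (\sum_(k <oo) (4 ^+ k * dl k w)%:E)%E.
have mS : measurable_fun setT S.
  by apply: (ge0_emeasurable_sum (P := xpredT)) => [k w _ _|k _]; [exact: dl0|exact: mdl].
have S0 w : (0 <= S w)%E by apply: nneseries_ge0 => k _ _; exact: dl0.
have iS : (\int[mu]_w S w < +oo)%E.
  rewrite integral_nneseries//.
  apply: (@le_lt_trans _ _ (\sum_(k <oo) (2 / (2 ^ (k + 1))%:R)%:E)%E); last first.
    have /cvg_lim -> // := @cvg_geometric_eseries_half R 2 0.
    by rewrite ltry.
  apply: lee_nneseries => [k _ _|k _]; first exact: integral_ge0.
  under eq_integral => w _ do rewrite EFinM.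
  rewrite ge0_integralZl//=; [|exact/measurable_EFinP/measurable_nrm2|]; last first.
    by move=> w _; rewrite lee_fin sqr_ge0.
  rewrite -nrm_piL2B !fE -EFinM lee_fin.
  have /ltW H : nrm (u (phi k.+1) - u (phi k)) < 4^-1 ^+ k.
    by apply: HN; rewrite ?phiS ?(leq_trans (Nphi k))// leq_addr.
  have {}H : nrm (u (phi k.+1) - u (phi k)) ^+ 2 <= (4^-1 ^+ k) ^+ 2.
    by rewrite ler_sqr ?nnegrE ?nrm_ge0 ?exprn_ge0.
  apply: (@le_trans _ _ (4 ^+ k * (4^-1 ^+ k) ^+ 2)); first by rewrite ler_wpM2l ?exprn_ge0.
  rewrite expr2 mulrA -exprMn divff// expr1n mul1r addn1 expnS natrM invfM mulrA divff// mul1r.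
  rewrite natrX -exprVn; apply: lerXn2r; rewrite ?nnegrE ?invr_ge0//.
  by rewrite lef_pV2 ?posrE// ler_nat.
have aeS : {ae mu, forall w, S w \is a fin_num}.
  have /integrable_ae : mu.-integrable setT S.
    by apply/integrableP; split => //; under eq_integral => w _ do rewrite gee0_abs//.
  by move=> /(_ measurableT); apply: filterS => w /(_ Logic.I).
pose A := [set w | S w \is a fin_num].
have mA : measurable A by rewrite -[A]setTI; exact: emeasurable_fin_num.
(* The indicator of A changes each function on a null set only and makes the subsequence converge at
   every point. *)
pose h k w : R[i]^o := (\1_A w : R)%:C *: f k w.
have smh k : strongly_measurable (h k).
  apply: strongly_measurable_complex.
    rewrite (_ : (fun w => _) = (fun w => \1_A w * complex.Re (f k w))).
      by apply: measurable_funM; [exact: measurable_indic|exact: strongly_measurable_Re].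
    apply/funext => w; rewrite /h -[_ *: _]/(_%:C * (f k w : R[i])).
    by case: (f k w) => a b /=; ring.
  rewrite (_ : (fun w => _) = (fun w => \1_A w * complex.Im (f k w))).
    by apply: measurable_funM; [exact: measurable_indic|exact: strongly_measurable_Im].
  apply/funext => w; rewrite /h -[_ *: _]/(_%:C * (f k w : R[i])).
  by case: (f k w) => a b /=; ring.
have hL k : h k \in @L2pred d T R mu R[i]^o.
  apply/asboolP; split; first exact: smh.
  have [mf] := L2funP (f k); apply: le_lt_trans; apply: ge0_le_integral => //.
  - by move=> w _; rewrite lee_fin sqr_ge0.
  - exact: (iffRL (measurable_EFinP _ _) (measurable_nrm2 (smh k))).
  - exact: (iffRL (measurable_EFinP _ _) (measurable_nrm2 (sf k))).
  - move=> w _; rewrite lee_fin nrm_scaleR indicE.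
    by case: (w \in A); rewrite ?expr1n ?expr0n ?mul1r ?mul0r ?sqr_ge0.
pose h' k := MkL2fun (hL k).
have h'E k : \pi_L2C (h' k) = u (phi k).
  rewrite -fE; apply/piL2P; apply: filterS aeS => w Aw.
  rewrite -[h' k w]/(h k w) /h indicE mem_set//; exact: scale1r.
have dh k w : nrm (h k.+1 w - h k w) <= Num.sqrt (fine (S w)) * 2^-1 ^+ k.
  rewrite /h -scalerBr -ler_sqr ?nnegrE ?nrm_ge0 ?mulr_ge0 ?exprn_ge0 ?sqrtr_ge0//.
  rewrite nrm_scaleR exprMn sqr_sqrtr ?fine_ge0// indicE.
  have [/[!inE] Aw|_] := boolP (w \in A); last first.
    by rewrite expr0n mul0r mulr_ge0 ?fine_ge0 ?sqr_ge0.
  rewrite expr1n mul1r -exprM mulnC exprM -[2^-1 ^+ 2]/(2^-1 * 2^-1) -invfM -natrM.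
  rewrite exprVn ler_pdivlMr ?exprn_gt0// mulrC -lee_fin fineK//.
  rewrite /S (nneseriesD1 (n := k))// leeDl// nneseries_ge0// => j _ _; exact: dl0.
have [l Hl] : exists l : L2C, forall e : R, 0 < e -> exists k, forall n, (k <= n)%N ->
     nrm (\pi_L2C (h' n) - l) < e.
  apply: L2fun_cvg.
  - move=> w; apply: (cvgn_geometric_increments (sqrtr_ge0 _)) => k.
    apply: le_trans (dh k w); rewrite -raddfB; exact: Re_le_nrm.
  - move=> w; apply: (cvgn_geometric_increments (sqrtr_ge0 _)) => k.
    apply: le_trans (dh k w); rewrite -raddfB; exact: Im_le_nrm.
  - move=> e /cu[k Hk]; exists k => m n km kn; rewrite !h'E.
    by apply: Hk; [exact: leq_trans (phi_ge m)|exact: leq_trans (phi_ge n)].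
exists l => e e0; have e2 : 0 < e / 2 by rewrite divr_gt0.
have [k Hk] := cu _ e2; have [k' Hk'] := Hl _ e2.
exists k => n kn; have := Hk' (maxn k k') (leq_maxr _ _); rewrite h'E.
move=> ul; have un := Hk n (phi (maxn k k')) kn (leq_trans (leq_maxl _ _) (phi_ge _)).
apply: le_lt_trans (nrmB_triangle (u (phi (maxn k k'))) _ _) _.
by rewrite (splitr e) ltrD.
Qed.

End Riesz_Fischer.

(** * Trigonometric polynomials *)

Section threshold.
Variable R : realType.
Implicit Types (s r : R) (n : nat).

Let bernoulli s n : 0 <= s -> 1 + n%:R * s <= (1 + s) ^+ n.
Proof.
move=> s0; elim: n => [|n IH]; first by rewrite mul0r addr0 expr0.
rewrite exprS; have : 0 <= n%:R * s ^+ 2 by rewrite mulr_ge0// sqr_ge0.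
by move: IH; rewrite -natr1; move: (_ ^+ n) (n%:R) => a b; nra.
Qed.

Let bernoulliN s n : 0 <= s <= 1 -> 1 - n%:R * s <= (1 - s) ^+ n.
Proof.
move=> /andP[s0 s1]; elim: n => [|n IH]; first by rewrite mul0r subr0 expr0.
rewrite exprS; have : 0 <= n%:R * s ^+ 2 by rewrite mulr_ge0// sqr_ge0.
have : (1 - s) * (1 - n%:R * s) <= (1 - s) * (1 - s) ^+ n by rewrite ler_wpM2l// subr_ge0.
by rewrite -natr1; move: (_ ^+ n) (n%:R) => a b; nra.
Qed.

(** With q = sqrt r, Bernoulli's inequality for 1/q bounds n q^n, and n r^n = (n q^n) q^n. *)
Let cvg_natr_expr r : 0 <= r < 1 -> (fun n => n%:R * r ^+ n) @ \oo --> (0 : R).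
Proof.
move=> /andP[r0 r1]; have [->|rn0] := eqVneq r 0.
  apply: (@cvg_trans _ (cst 0 @ \oo)); last exact: cvg_cst.
  by apply: near_eq_cvg; near=> n; rewrite expr0n gtn_eqF ?mulr0//; near: n; exists 1%N.
have rp : 0 < r by rewrite lt_neqAle eq_sym rn0.
pose q := Num.sqrt r; have q0 : 0 < q by rewrite sqrtr_gt0.
have q1 : q < 1 by rewrite -sqrtr1 ltr_sqrt.
have qq : r = q ^+ 2 by rewrite sqr_sqrtr.
have K n : 0 <= n%:R * r ^+ n <= (q^-1 - 1)^-1 * q ^+ n.
  rewrite mulr_ge0 ?exprn_ge0//= qq -exprM mulnC mulnC exprM expr2.
  rewrite exprMn mulrA ler_wpM2r ?exprn_ge0 ?(ltW q0)//.
  have iq : 0 < q^-1 - 1 by rewrite subr_gt0 invf_gt1.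
  rewrite -ler_pdivlMr ?exprn_gt0// ler_pdivlMl//.
  have := @bernoulli (q^-1 - 1) n (ltW iq); rewrite addrCA subrr addr0 exprVn.
  by apply: le_trans; rewrite mulrC lerDr.
apply: (@squeeze_cvgr _ _ _ _ (cst 0) (geometric (q^-1 - 1)^-1 q)).
- by apply: nearW => n; exact: K.
- exact: cvg_cst.
- by apply: cvg_geometric; rewrite ger0_norm// ltW.
Unshelve. all: by end_near. Qed.

(* The factor [n] in the exponent is there for the limit at [s = 1/2] to be [0]. *)
Definition threshold n s : R := (1 - s ^+ n) ^+ (n * 2 ^ n).

Lemma threshold_itv n s : 0 <= s <= 1 -> 0 <= threshold n s <= 1.
Proof.
move=> /andP[s0 s1]; rewrite /threshold.
have : 0 <= 1 - s ^+ n <= 1 by rewrite subr_ge0 exprn_ile1//= gerBl exprn_ge0.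
by move=> /andP[a b]; rewrite exprn_ge0// exprn_ile1.
Qed.

(** For s < 1/2, Bernoulli's inequality gives the lower bound 1 - n (2s)^n. For s >= 1/2, the
    product with (1 + s^n)^(n 2^n), which is at least n + 1, equals (1 - s^(2n))^(n 2^n) <= 1; so
    the value is at most 1/(n+1). *)
Lemma cvg_threshold s : 0 <= s <= 1 ->
  (fun n => threshold n s) @ \oo --> ((s < 2^-1)%R%:R : R).
Proof.
move=> s01; have /andP[s0 s1] := s01.
have sn n : 0 <= s ^+ n <= 1 by rewrite exprn_ge0// exprn_ile1.
have E n : (n * 2 ^ n)%N%:R * s ^+ n = n%:R * (2 * s) ^+ n.
  by rewrite natrM natrX exprMn mulrA.
have [s2|s2] := ltP s 2^-1.
  apply: (@squeeze_cvgr _ _ _ _ (fun n => 1 - n%:R * (2 * s) ^+ n) (cst 1)).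
  - apply: nearW => n; have /andP[_ ->] := threshold_itv n s01; rewrite andbT.
    by rewrite -E; exact: bernoulliN.
  - rewrite -[X in _ --> X](subr0 1); apply: cvgB; first exact: cvg_cst.
    by apply: cvg_natr_expr; lra.
  - exact: cvg_cst.
apply: (@squeeze_cvgr _ _ _ _ (cst 0) (fun n => n.+1%:R^-1)).
- apply: nearW => n; have /andP[-> _]/= := threshold_itv n s01.
  rewrite -[leRHS]mul1r ler_pdivlMr//.
  have H : n.+1%:R <= (1 + s ^+ n) ^+ (n * 2 ^ n).
    apply: le_trans (bernoulli _ _); last by case/andP: (sn n).
    rewrite E -natr1 addrC lerD2l ler_peMr// exprn_ege1//; lra.
  have t0 : 0 <= threshold n s by case/andP: (threshold_itv n s01).
  apply: le_trans (ler_wpM2l t0 H) _; rewrite /threshold -exprMn.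
  apply: exprn_ile1; have := sn n; move: (s ^+ n) => x; nra.
- exact: cvg_cst.
- exact: cvg_harmonic.
Qed.

End threshold.

Section trigonometric_polynomials.
Variable R : realType.
Implicit Types (p : int * int) (w : R * R).

Definition phase p w : R := 2 * pi * (p.1%:~R * w.1 + p.2%:~R * w.2).

(** The free phase c covers sines and cosines at once and lets a single product formula close the
    class under multiplication. Values are real so that thresholds make sense. *)
Inductive trig_poly : (R * R -> R) -> Prop :=
| trig_poly0 : trig_poly (fun=> 0)
| trig_polyL a p c g : trig_poly g ->
    trig_poly (fun w => a * cos (phase p w + c) + g w).

Lemma trig_poly_cos p c : trig_poly (fun w => cos (phase p w + c)).
Proof.
rewrite (_ : (fun w => _) = (fun w => 1 * cos (phase p w + c) + 0)).
  exact/trig_polyL/trig_poly0.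
by apply/funext => w; rewrite mul1r addr0.
Qed.

Lemma trig_polyD f g : trig_poly f -> trig_poly g -> trig_poly (fun w => f w + g w).
Proof.
move=> + tg; elim=> [|a p c h th IH].
  by under eq_fun => w do rewrite /= add0r.
by under eq_fun => w do rewrite -addrA; exact: trig_polyL.
Qed.

Lemma trig_polyZ a f : trig_poly f -> trig_poly (fun w => a * f w).
Proof.
elim=> [|b p c h th IH]; first by under eq_fun do rewrite /= mulr0; exact: trig_poly0.
by under eq_fun => w do rewrite mulrDr mulrA; exact: trig_polyL.
Qed.

Lemma trig_poly_cst a : trig_poly (fun=> a).
Proof.
rewrite (_ : (fun w => _) = (fun w => a * cos (phase (0, 0) w + 0))).
  exact/trig_polyZ/trig_poly_cos.
by apply/funext => w; rewrite /phase/= mulr0z !mul0r !addr0 mulr0 cos0 mulr1.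
Qed.

Lemma trig_polyM f g : trig_poly f -> trig_poly g -> trig_poly (fun w => f w * g w).
Proof.
move=> + tg; elim=> [|a p c h th IH].
  by under eq_fun do rewrite /= mul0r; exact: trig_poly0.
under eq_fun => w do rewrite mulrDl -mulrA; apply: trig_polyD IH; apply: trig_polyZ.
elim: tg => [|b q e k tk IHk]; first by under eq_fun do rewrite /= mulr0; exact: trig_poly0.
under eq_fun => w do rewrite mulrDr mulrCA; apply: trig_polyD IHk; apply: trig_polyZ.
rewrite (_ : (fun w => _) = (fun w => 2^-1 *
    (cos (phase (p + q) w + (c + e)) + cos (phase (p - q) w + (c - e))))).
  by apply/trig_polyZ/trig_polyD; exact: trig_poly_cos.
apply/funext => w; rewrite (_ : phase (p + q) w + _ = (phase p w + c) + (phase q w + e)).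
  rewrite (_ : phase (p - q) w + _ = (phase p w + c) - (phase q w + e)).
    by move: (phase p w + c) (phase q w + e) => A B; rewrite cosB cosD; field.
  by rewrite /phase/= !intrD !intrN; ring.
by rewrite /phase/= !intrD; ring.
Qed.

Lemma trig_polyX f n : trig_poly f -> trig_poly (fun w => f w ^+ n).
Proof.
move=> tf; elim: n => [|n IH]; first exact: trig_poly_cst.
by under eq_fun do rewrite exprS; exact: trig_polyM.
Qed.

Lemma trig_poly_threshold f n : trig_poly f -> trig_poly (fun w => threshold n (f w)).
Proof.
move=> tf; apply/trig_polyX; under eq_fun do rewrite -mulN1r.
by apply: trig_polyD; [exact: trig_poly_cst|exact/trig_polyZ/trig_polyX].
Qed.

Lemma trig_poly_bounded f : trig_poly f -> exists2 C : R, 0 <= C & forall w, `|f w| <= C.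
Proof.
elim=> [|a p c g tg [C C0 gC]]; first by exists 0 => // w; rewrite normr0.
exists (`|a| + C) => [|w]; first by rewrite addr_ge0.
rewrite (le_trans (ler_normD _ _))// lerD// normrM ler_piMr//.
by rewrite ler_norml cos_geN1 cos_le1.
Qed.

Lemma measurable_phase p : measurable_fun [set: R * R] (phase p).
Proof.
apply: measurable_funM => //; apply: measurable_funD; apply: measurable_funM => //.
Qed.

Lemma measurable_cosf : measurable_fun [set: R] cos.
Proof. by apply: continuous_measurable_fun; exact: continuous_cos. Qed.

Lemma measurable_trig_poly f : trig_poly f -> measurable_fun [set: R * R] f.
Proof.
elim=> [|a p c g tg IH]; first exact: measurable_cst.
apply: measurable_funD => //; apply: measurable_funM => //.
apply: measurableT_comp; first exact: measurable_cosf.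
by apply: measurable_funD => //; exact: measurable_phase.
Qed.

End trigonometric_polynomials.

(** * Uniqueness of Fourier coefficients on the torus *)

(* Up to null sets, arcs of the circle are superlevel sets of trigonometric polynomials. *)
Lemma cos_arc (R : realType) (a t : R) : 0 < a < 1 -> 0 <= t <= 1 ->
  (cos (pi * t) < cos (2 * pi * a - pi * t)) = (a < t).
Proof.
move=> /andP[a0 a1] /andP[t0 t1].
have pi0 : 0 < pi :> R := pi_gt0 R.
have -> : cos (2 * pi * a - pi * t) =
    cos (pi * t) + 2 * (sin (pi * a) * sin (pi * (t - a))).
  have -> : 2 * pi * a - pi * t = pi * a - pi * (t - a) by ring.
  have -> : pi * t = pi * a + pi * (t - a) by ring.
  by rewrite cosB cosD; ring.
have sa : 0 < sin (pi * a) by apply: sin_gt0_pi; nra.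
rewrite ltrDl pmulr_rgt0// pmulr_rgt0//.
have [ta|ta|->] := ltgtP a t; last by rewrite subrr mulr0 sin0 ltxx.
  by apply: sin_gt0_pi; nra.
apply/negbTE; rewrite -leNgt -oppr_ge0 -sinN -mulrN opprB.
by apply/ltW/sin_gt0_pi; nra.
Qed.

(** [torus_measure] is a measure on the whole plane, while [cos_arc] describes arcs only for angles
    in ]0, 1[; this square carries the full measure. *)
Definition open_square (R : realType) : set (measurableTypeR R * measurableTypeR R) :=
  [set w | 0 < w.1 < 1 /\ 0 < w.2 < 1].

Lemma uniform_prob_setC_unit (R : realType) :
  uniform_prob (@ltr01 R) (~` [set a | 0 < a < 1]) = 0%E.
Proof.
rewrite /uniform_prob integral_uniform_pdf.
rewrite (_ : _ `&` _ = [set 0] `|` [set 1 : R]); last first.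
  apply/seteqP; split=> a /=; rewrite in_itv/=.
    move=> [/negP a01 /andP[a0 a1]]; move: a01; rewrite negb_and -!leNgt => /orP[a0'|a1'].
      by left; apply/eqP; rewrite eq_le a0 a0'.
    by right; apply/eqP; rewrite eq_le a1 a1'.
  by case=> ->; rewrite ltxx lexx ler01 ?andbF; split.
have /null_content_dominatesP := dominates_uniform_prob (@ltr01 R); apply.
  exact: measurableU.
apply/eqP; rewrite -measure_le0 (le_trans (measureU2 _ _ _))//.
by rewrite [X in (X + _)%E]lebesgue_measure_set1 [X in (_ + X)%E]lebesgue_measure_set1 adde0.
Qed.

Lemma torus_ae_open_square (R : realType) :
  {ae (@torus_measure R), forall w, open_square w}.
Proof.
have mI : measurable (~` [set a : R | 0 < a < 1]).
  apply: measurableC; rewrite (_ : [set a | _] = `]0, 1[%classic); first exact: measurable_itv.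
  by apply/seteqP; split=> a /=; rewrite in_itv.
have e1 : (uniform_prob (@ltr01 R) \x uniform_prob (@ltr01 R))%E
    (~` [set a : R | 0 < a < 1] `*` setT) = 0%E.
  by rewrite product_measure1E// [X in (X * _)%E]uniform_prob_setC_unit mul0e.
have e2 : (uniform_prob (@ltr01 R) \x uniform_prob (@ltr01 R))%E
    (setT `*` ~` [set a : R | 0 < a < 1]) = 0%E.
  by rewrite product_measure1E// [X in (_ * X)%E]uniform_prob_setC_unit mule0.
exists ((~` [set a : R | 0 < a < 1] `*` setT) `|` (setT `*` ~` [set a : R | 0 < a < 1])).
split; first by apply: measurableU; exact: measurableX.
  apply/eqP; rewrite -measure_le0 (le_trans (measureU2 _ _ _))//; try exact: measurableX.
  by rewrite [X in (X + _)%E]e1 [X in (_ + X)%E]e2 adde0.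
move=> w /= nQ; have [w1|w1] := pselect (0 < w.1 < 1); last by left.
by right; split => // w2; exact: nQ.
Qed.

Section trig_uniqueness.
Variables (R : realType) (phi : R * R -> R).
Local Notation T2 := (measurableTypeR R * measurableTypeR R)%type.
Variable mu : {measure set T2 -> \bar R}.
Hypothesis iphi : mu.-integrable setT (EFin \o phi).

Let mphi : measurable_fun setT phi.
Proof. by have /integrableP[/measurable_EFinP] := iphi. Qed.

Let ibdd (u : R * R -> R) (C : R) : measurable_fun setT u ->
  (forall w, `|u w| <= C) -> mu.-integrable setT (fun w => (phi w * u w)%:E).
Proof.
move=> mu_ uC; have C0 : 0 <= C by apply: le_trans (uC (0, 0)).
apply: (@le_integrable _ _ _ mu setT measurableT _ (fun w => (C * phi w)%:E)).
- by apply/measurable_EFinP; exact: measurable_funM.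
- move=> w _; rewrite lee_fin !normrM mulrC (ger0_norm C0).
  by rewrite ler_wpM2r.
- by under eq_fun do rewrite EFinM; exact: integrableZl.
Qed.

(** Testing against every [g], and not only against 1, makes the class stable under multiplication
    by trigonometric polynomials with values in [0,1]; the bound 1 provides the domination for
    limits. *)
Definition annihilated (u : R * R -> R) := [/\ measurable_fun setT u,
  forall w, `|u w| <= 1 & forall g, trig_poly g ->
  Rintegral mu setT (fun w => phi w * (g w * u w)) = 0].

Let igu (g u : R * R -> R) : trig_poly g -> measurable_fun setT u -> (forall w, `|u w| <= 1) ->
  mu.-integrable setT (fun w => (phi w * (g w * u w))%:E).
Proof.
move=> tg mu_ u1; have [C C0 gC] := trig_poly_bounded tg; apply: (ibdd (C := C)).
  by apply: measurable_funM => //; exact: measurable_trig_poly.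
by move=> w; rewrite normrM -[leRHS]mulr1 ler_pM.
Qed.

Lemma annihilated_lim (h : nat -> R * R -> R) (u : R * R -> R) : (forall n, annihilated (h n)) ->
  (forall w, (fun n => h n w) @ \oo --> u w) -> annihilated u.
Proof.
move=> hn hu.
have mu_ : measurable_fun setT u.
  by apply: (measurable_fun_cvg (h := h)) => [n|w _]; [case: (hn n)|exact: hu].
have u1 w : `|u w| <= 1.
  have uE : limn (fun n => h n w) = u w by apply/cvg_lim => //; exact: hu.
  have cu : cvgn (fun n => h n w) by apply/cvg_ex; exists (u w); exact: hu.
  rewrite ler_norml -uE; apply/andP; split; [apply: limr_ge|apply: limr_le] => //.
    by apply: nearW => n; have [_ /(_ w) + _] := hn n; rewrite ler_norml => /andP[].
  by apply: nearW => n; have [_ /(_ w) + _] := hn n; rewrite ler_norml => /andP[].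
split => // g tg; have mg := measurable_trig_poly tg.
have [C C0 gC] := trig_poly_bounded tg.
have [] := @dominated_convergence _ _ _ mu setT measurableT
  (fun n w => (phi w * (g w * h n w))%:E) (fun w => (phi w * (g w * u w))%:E)
  (fun w => (C * `|phi w|)%:E).
- move=> n; have [mh _ _] := hn n; apply/measurable_EFinP.
  by apply: measurable_funM => //; exact: measurable_funM.
- apply/measurable_EFinP.
  by apply: measurable_funM => //; exact: measurable_funM.
- apply: aeW => w _; apply: cvg_EFin; first exact: nearW.
  by apply: cvgM; [exact: cvg_cst|apply: cvgM; [exact: cvg_cst|exact: hu]].
- under eq_fun do rewrite EFinM; apply: integrableZl => //.
  exact: (integrable_abse iphi).
- apply: aeW => w n _; have [_ h1 _] := hn n.
  rewrite /= lee_fin !normrM mulrC ler_wpM2r//.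
  by rewrite -[leRHS]mulr1 ler_pM.
move=> _ _; rewrite [X in X @ _ --> _](_ : _ = cst 0%E); last first.
  apply/funext => n /=; have [mh h1 /(_ _ tg) hn0] := hn n.
  rewrite -[LHS]fineK ?hn0//; first by rewrite -[fine _]/(Rintegral _ _ _) hn0.
  by apply: integrable_fin_num => //; exact: igu.
by move=> H; rewrite /Rintegral -(cvg_lim _ H)// lim_cst.
Qed.

Lemma annihilatedM u T : annihilated u -> trig_poly T -> (forall w, 0 <= T w <= 1) ->
  annihilated (fun w => T w * u w).
Proof.
move=> [mu_ u1 H] tT T01; split.
- by apply: measurable_funM => //; exact: measurable_trig_poly.
- move=> w; rewrite normrM -[leRHS]mulr1 ler_pM//.
  by have /andP[T0 T1] := T01 w; rewrite ger0_norm.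
move=> g tg; apply: etrans (H _ (trig_polyM tg tT)).
by apply: eq_Rintegral => w _; rewrite !mulrA.
Qed.

Lemma annihilated_threshold u T : annihilated u -> trig_poly T ->
  (forall w, 0 <= T w <= 1) -> annihilated (fun w => (T w < 2^-1)%R%:R * u w).
Proof.
move=> hu tT T01; apply: (annihilated_lim (h := fun n w => threshold n (T w) * u w)).
  move=> n; apply: annihilatedM => //; first exact: trig_poly_threshold.
  by move=> w; exact: threshold_itv.
by move=> w; apply: cvgM; [exact: cvg_threshold|exact: cvg_cst].
Qed.

Hypothesis hphi : forall p c, Rintegral mu setT (fun w => phi w * cos (phase p w + c)) = 0.

Lemma annihilated1 : annihilated (fun=> 1).
Proof.
split=> [//|w|g tg]; first by rewrite normr1.
under eq_Rintegral => w _ do rewrite mulr1.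
elim: tg => [|a p c h th IH].
  rewrite (@eq_Rintegral _ _ _ _ _ (cst 0)) ?Rintegral_cst ?mul0r// => w _.
  by rewrite /= mulr0.
under eq_Rintegral => w _ do rewrite mulrDr mulrCA.
have ic : mu.-integrable setT (fun w => (phi w * cos (phase p w + c))%:E).
  apply: (ibdd (u := fun w => cos (phase p w + c)) (C := 1)).
    by apply: measurable_trig_poly; exact: trig_poly_cos.
  by move=> w; rewrite ler_norml cos_geN1 cos_le1.
have ih : mu.-integrable setT (fun w => (phi w * h w)%:E).
  have [C _ hC] := trig_poly_bounded th.
  by apply: (ibdd (C := C)) => //; exact: measurable_trig_poly.
have ia : mu.-integrable setT (fun w => (a * (phi w * cos (phase p w + c)))%:E).
  by under eq_fun do rewrite EFinM; exact: integrableZl.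
rewrite RintegralD//.
by rewrite RintegralZl// hphi mulr0 IH addr0.
Qed.

Local Notation Q := (@open_square R).
Hypothesis aeQ : {ae mu, forall w : T2, Q w}.

Let annihilated_ae (u v : R * R -> R) : annihilated u -> measurable_fun setT v ->
  (forall w, `|v w| <= 1) -> (forall w, Q w -> u w = v w) -> annihilated v.
Proof.
move=> [mu_ u1 hu] mv v1 uv; split => // g tg; apply: etrans (hu g tg).
congr fine; have mg := measurable_trig_poly tg; apply: ae_eq_integral => //.
- by apply/measurable_EFinP/measurable_funM => //; exact: measurable_funM.
- by apply/measurable_EFinP/measurable_funM => //; exact: measurable_funM.
- by apply: filterS aeQ => w Qw _; rewrite uv.
Qed.

Definition annihilated_set (A : set (R * R)) := measurable A /\ annihilated (\1_A).

Let indic_le1 (A : set (R * R)) w : `|\1_A w| <= 1 :> R.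
Proof. by rewrite indicE; case: (w \in A); rewrite ?normr1 ?normr0. Qed.

Let annihilated_setT : annihilated_set setT.
Proof. by split=> //; rewrite indicT; exact: annihilated1. Qed.

Let annihilated_setD A B : B `<=` A -> annihilated_set A -> annihilated_set B ->
  annihilated_set (A `\` B).
Proof.
move=> BA [mA [_ _ hA]] [mB [_ _ hB]].
have mAB : measurable (A `\` B) by exact: measurableD.
split => //; split => // g tg; apply: (@etrans _ _ (Rintegral mu setT (fun w => phi w * (g w * \1_A w)) -
    Rintegral mu setT (fun w => phi w * (g w * \1_B w)))); last by rewrite hA// hB// subr0.
rewrite -RintegralB//; last 2 first.
- by apply: igu => //; exact: measurable_indic.
- by apply: igu => //; exact: measurable_indic.
apply: eq_Rintegral => w _; rewrite -!mulrBr; congr (_ * (_ * _)).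
rewrite !indicE in_setD.
have [wB|] := boolP (w \in B); last by rewrite andbT subr0.
by rewrite andbF mem_set ?subrr//; apply: BA; exact/set_mem.
Qed.

Let annihilated_setU A B : A `&` B = set0 -> annihilated_set A -> annihilated_set B ->
  annihilated_set (A `|` B).
Proof.
move=> AB [mA [_ _ hA]] [mB [_ _ hB]].
have mAB : measurable (A `|` B) by exact: measurableU.
split => //; split => // g tg; apply: (@etrans _ _ (Rintegral mu setT (fun w => phi w * (g w * \1_A w)) +
    Rintegral mu setT (fun w => phi w * (g w * \1_B w)))); last by rewrite hA// hB// addr0.
rewrite -RintegralD//; last 2 first.
- by apply: igu => //; exact: measurable_indic.
- by apply: igu => //; exact: measurable_indic.
apply: eq_Rintegral => w _; rewrite -!mulrDr; congr (_ * (_ * _)).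
rewrite !indicE in_setU.
have [/set_mem wB|] := boolP (w \in B); last by rewrite orbF addr0.
rewrite orbT (_ : w \in A = false) ?add0r//; apply/negP => /set_mem wA.
by have : (A `&` B) w by []; rewrite AB.
Qed.

Let annihilated_bigcup (F : nat -> set (R * R)) : trivIset setT F ->
  (forall n, annihilated_set (F n)) -> annihilated_set (\bigcup_n F n).
Proof.
move=> tF hF; split; first by apply: bigcup_measurable => n _; case: (hF n).
pose A n := \bigcup_(i in `I_n) F i.
have hA n : annihilated_set (A n).
  elim: n => [|n IH].
    rewrite /A II0 bigcup_set0 -(setDv setT); apply: annihilated_setD => //.
  rewrite /A IIS bigcup_setU bigcup_set1; apply: annihilated_setU => //.
  apply/seteqP; split => // w [[i /= ni Fi] Fn].
  have /(_ i n Logic.I Logic.I) H := tF.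
  by have := H (ex_intro _ w (conj Fi Fn)) => E; rewrite E ltnn in ni.
apply: (annihilated_lim (h := fun n => \1_(A n))) => [n|w]; first by case: (hA n).
have [[i _ Fi]|nF] := pselect ((\bigcup_n F n) w).
  apply: (@cvg_trans _ (cst 1 @ \oo)); last first.
    by rewrite indicE mem_set//; [exact: cvg_cst|exists i].
  apply: near_eq_cvg; near=> n; rewrite indicE mem_set//; exists i => //=.
  by near: n; exact: nbhs_infty_gt.
apply: (@cvg_trans _ (cst 0 @ \oo)); last first.
  by rewrite indicE memNset//; exact: cvg_cst.
apply: near_eq_cvg; apply: nearW => n; rewrite indicE memNset//.
by move=> [i _ Fi]; apply: nF; exists i.
Unshelve. all: by end_near. Qed.

Let annihilated_set_ae A B : annihilated_set A -> measurable B ->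
  (forall w, Q w -> A w <-> B w) -> annihilated_set B.
Proof.
move=> [_ hA] mB AB; split => //.
apply: (annihilated_ae hA) => [|w|w Qw]; [exact: measurable_indic|exact: indic_le1|].
by rewrite !indicE; congr ((_ : bool)%:R); apply/idP/idP; rewrite !inE => /(AB _ Qw).
Qed.

Let measurable_ray (t : R) : measurable [set a : R | a < t].
Proof.
rewrite (_ : [set a | _] = `]-oo, t[%classic); first exact: measurable_itv.
by apply/seteqP; split=> a /=; rewrite in_itv.
Qed.

Let annihilated_rays (t s : R) :
  annihilated_set ([set a | a < t] `*` [set b | b < s]).
Proof.
(* [cos_arc] wants the endpoint in [0,1]; clipping does not change the ray inside ]0, 1[. *)
pose clip (x : R) := Num.max 0 (Num.min x 1).
have clip01 x : 0 <= clip x <= 1.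
  by rewrite /clip le_max lexx/= ge_max ler01 ge_min lexx orbT.
have clipE x a : 0 < a < 1 -> (a < clip x) = (a < x).
  by move=> /andP[a0 a1]; rewrite /clip lt_max lt_min a1 andbT ltNge (ltW a0).
(* An affine rescaling of the inequality in [cos_arc]: the values lie in [0,1] and are below 1/2
   exactly where the inequality holds. *)
pose arc p x w : R := - 4^-1 * cos (phase p w - pi * clip x) +
  (2^-1 + 4^-1 * cos (pi * clip x)).
have t_arc p x : trig_poly (arc p x).
  by apply: trig_polyD; [exact/trig_polyZ/trig_poly_cos|exact: trig_poly_cst].
have arc01 p x w : 0 <= arc p x w <= 1.
  rewrite /arc; move: (pi * clip x) (phase p w - pi * clip x) => z y.
  have := cos_geN1 y; have := cos_le1 y; have := cos_geN1 z; have := cos_le1 z.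
  by move=> *; apply/andP; split; lra.
have arcE p x w : (arc p x w < 2^-1) = (cos (pi * clip x) < cos (phase p w - pi * clip x)).
  by rewrite /arc; apply/idP/idP => ?; lra.
have := annihilated_threshold (annihilated_threshold annihilated1
  (t_arc (1, 0) t) (arc01 (1, 0) t)) (t_arc (0, 1) s) (arc01 (0, 1) s).
have mr : measurable ([set a | a < t] `*` [set b | b < s]) by exact: measurableX.
move=> H; split => //; apply: (annihilated_ae H) => [|w|[a b] [/= a01 b01]].
- exact: measurable_indic.
- exact: indic_le1.
have -> : (arc (0, 1) s (a, b) < 2^-1) = (b < s).
  rewrite arcE -(clipE s b b01) -(cos_arc b01 (clip01 s)) /phase/=.
  by rewrite mulr0z mulr1z mul0r add0r mul1r.
have -> : (arc (1, 0) t (a, b) < 2^-1) = (a < t).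
  rewrite arcE -(clipE t a a01) -(cos_arc a01 (clip01 t)) /phase/=.
  by rewrite mulr0z mulr1z mul0r addr0 mul1r.
rewrite mulr1 -natrM mulnb indicE; congr ((_ : bool)%:R).
by apply/idP/idP => [/andP[bs at_]|]; rewrite ?inE// => -[/= -> ->].
Qed.

(** Dynkin's lemma for one real function [g], later a coordinate, within a fixed set B: the rays
    ]-oo, t[ form a pi-system generating the Borel sets. *)
Let annihilated_preimage (B : set (R * R)) (g : R * R -> R) :
  annihilated_set B -> (forall t, annihilated_set (B `&` g @^-1` [set a | a < t])) ->
  forall A, measurable A -> annihilated_set (B `&` g @^-1` A).
Proof.
move=> hB hr A mA.
have Em : (@measurable _ R : set (set R)) = <<s @RGenInftyO.G R >> := RGenInftyO.measurableE R.
have : <<s @RGenInftyO.G R >> A by rewrite -Em.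
apply: (@dynkin_induction _ R _ (fun A => annihilated_set (B `&` g @^-1` A)) Em).
- move=> _ _ [x ->] [y ->]; exists (Num.min x y).
  by apply/seteqP; split=> a /=; rewrite !in_itv/= lt_min; [case=> -> ->|case/andP].
- by rewrite preimage_setT setIT.
- move=> _ [x ->]; rewrite (_ : `]-oo, x[%classic = [set a | a < x])//.
- move=> S mS hS; rewrite (_ : _ `&` _ = B `\` (B `&` g @^-1` S)).
    by apply: annihilated_setD => // w [].
  apply/seteqP; split=> w /= [Bw gw]; first by split => // -[].
  by split => // gS; apply: gw.
- move=> F mF tF hF; rewrite preimage_bigcup setI_bigcupr.
  apply: annihilated_bigcup => // i j _ _ [w [[_ Fi] [_ Fj]]].
  by apply: (tF i j Logic.I Logic.I); exists (g w).
Qed.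

Lemma annihilated_measurable A : measurable A -> annihilated_set A.
Proof.
(* On the open square the first coordinate is below 1, so the ray with endpoint 1 imposes no
   condition there. *)
have h2 (s : R) : annihilated_set (snd @^-1` [set b : R | b < s]).
  apply: (annihilated_set_ae (annihilated_rays 1 s)).
    rewrite (_ : _ @^-1` _ = setT `*` [set b : R | b < s]).
      by apply: measurableX => //; exact: measurable_ray.
    by apply/seteqP; split=> -[a b] //= [].
  move=> [a b] [/= /andP[a0 a1] _]; split=> [[]//|bs]; by split.
have h12 (s : R) B : measurable B ->
    annihilated_set (snd @^-1` [set b : R | b < s] `&` fst @^-1` B).
  apply: annihilated_preimage => // t; have := annihilated_rays t s.
  by congr annihilated_set; apply/seteqP; split=> -[a b] /= [? ?]; split.
have h1 B : measurable B -> annihilated_set (@fst R R @^-1` B).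
  move=> mB; apply: (annihilated_set_ae (h12 1 B mB)).
    rewrite (_ : _ @^-1` _ = B `*` setT); first exact: measurableX.
    by apply/seteqP; split=> -[a b] //= [].
  move=> [a b] [/= _ /andP[b0 b1]]; split=> [[]//|bs]; by split.
have hX B C : measurable B -> measurable C -> annihilated_set (B `*` C).
  move=> mB mC; rewrite (_ : _ `*` _ = @fst R R @^-1` B `&` snd @^-1` C)//.
  apply: annihilated_preimage => //; first exact: h1.
  by move=> t; rewrite setIC; exact: h12.
move=> mA; have := mA; rewrite measurable_prod_measurableType.
apply: dynkin_induction.
- exact: measurable_prod_measurableType.
- move=> _ _ [A1 mA1 [A2 mA2 <-]] [B1 mB1 [B2 mB2 <-]].
  by exists (A1 `&` B1); [exact: measurableI|exists (A2 `&` B2); [exact: measurableI|rewrite setXI]].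
- exact: annihilated_setT.
- by move=> _ [A1 mA1 [A2 mA2 <-]]; exact: hX.
- by move=> S mS hS; rewrite -setTD; apply: annihilated_setD.
- by move=> F mF tF hF; exact: annihilated_bigcup.
Qed.

Lemma trig_uniqueness : {ae mu, forall w, phi w = 0}.
Proof.
have : ae_eq mu setT (EFin \o phi) (cst 0%E).
  (* The test polynomial 1 shows that phi has integral zero over every measurable set. *)
  apply: integral_ae_eq => // A _ /annihilated_measurable[mA [_ _ /(_ _ (trig_poly_cst 1)) H]].
  rewrite integral0 integral_mkcond -[LHS]fineK; last first.
    apply: integrable_fin_num => //.
    by rewrite -integrable_restrict// setTI; exact: integrableS iphi.
  congr EFin; apply: etrans H; congr fine; apply: eq_integral => w _.
  by rewrite patchE indicE mul1r; case: (w \in A); rewrite ?mulr1 ?mulr0.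
by apply: filterS => w /(_ Logic.I)/= [].
Qed.

End trig_uniqueness.

(** * Characters as an orthonormal basis *)

Section characters.
Variable R : realType.
Implicit Types (p q : int * int) (w : R * R) (a : R).

Lemma expi_neq0 a : expi a != 0.
Proof.
rewrite /expi eq_complex/=; apply/negP => /andP[/eqP c0 /eqP s0].
by have := cos2Dsin2 (2 * pi * a); rewrite c0 s0 expr0n addr0 => /eqP; rewrite eq_sym oner_eq0.
Qed.

Lemma expiV a : (expi a)^-1 = (expi a)^*%C.
Proof.
apply: (mulfI (expi_neq0 a)); rewrite mulfV ?expi_neq0// /expi.
have := cos2Dsin2 (2 * pi * a); move: (cos _) (sin _) => c s cs.
by apply/eqP; rewrite eq_complex/=; apply/andP; split; apply/eqP; lra.
Qed.

Lemma expiXz a (k : int) :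
  expi a ^ k = cos (2 * pi * (k%:~R * a)) +i* sin (2 * pi * (k%:~R * a)).
Proof.
have nat_case (n : nat) :
    expi a ^+ n = cos (2 * pi * (n%:R * a)) +i* sin (2 * pi * (n%:R * a)).
  elim: n => [|n IH]; first by rewrite expr0 mul0r mulr0 cos0 sin0.
  rewrite exprS IH /expi.
  have -> : 2 * pi * (n.+1%:R * a) = 2 * pi * a + 2 * pi * (n%:R * a).
    by rewrite -natr1; ring.
  rewrite cosD sinD; apply/eqP; rewrite eq_complex/=; apply/andP; split; apply/eqP; ring.
case: k => n; first by rewrite -exprnP nat_case.
rewrite NegzE -exprnN -exprVn expiV -rmorphXn/= nat_case/=.
by rewrite rmorphN/= mulNr mulrN cosN sinN.
Qed.

Definition character p w : R[i]^o := expi w.1 ^ p.1 * expi w.2 ^ p.2.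

Lemma characterE p w : character p w = cos (phase p w) +i* sin (phase p w).
Proof.
rewrite /character !expiXz.
rewrite (_ : phase p w = 2 * pi * (p.1%:~R * w.1) + 2 * pi * (p.2%:~R * w.2)).
  rewrite cosD sinD.
  by apply/eqP; rewrite eq_complex/=; apply/andP; split; apply/eqP; ring.
by rewrite /phase mulrDr.
Qed.

Lemma characterD p q w : character (p + q) w = (character p w : R[i]) * character q w.
Proof. by rewrite /character/= !expfzDr ?expi_neq0// mulrACA. Qed.

Lemma characterN p w : character (- p) w = (character p w : R[i])^*%C.
Proof.
rewrite !characterE /phase/= !rmorphN/= !mulNr -opprD mulrN cosN sinN.
by [].
Qed.

Lemma character_square_integrable p : square_integrable (@torus_measure R) (character p).
Proof.
split.
  apply: strongly_measurable_complex.
    under eq_fun do rewrite characterE/= -[phase p _]addr0.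
    by apply: measurable_trig_poly; exact: trig_poly_cos.
  rewrite (_ : (fun w => _) = (fun w => cos (phase p w + - (pi / 2)))).
    by apply: measurable_trig_poly; exact: trig_poly_cos.
  by apply/funext => w; rewrite characterE/= cosBpihalf.
under eq_integral => w _ do rewrite nrm_complex characterE/= cos2Dsin2.
rewrite integral_cst// mul1e.
apply: (@le_lt_trans _ _ 1%E); last by rewrite ltry.
exact: probability_le1.
Qed.

Definition character_fun p : L2fun (@torus_measure R) R[i]^o :=
  MkL2fun (introT (asboolP _) (character_square_integrable p)).

Local Open Scope quotient_scope.
Local Notation L2T := (L2 (@torus_measure R) R[i]^o).

Definition characterL2 p : L2T := \pi_L2T (character_fun p).
Local Notation z := characterL2.

Lemma inner_character (f : L2T) p :
  inner f (z p) = cintegral (@torus_measure R) (fun w => repr f w * character (- p) w).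
Proof.
rewrite -[f in LHS]reprK -[inner _ _]/(innerL2 _ _) innerL2E; congr cintegral.
by apply/funext => w; rewrite characterN.
Qed.

(** Replaces the choice operator in [fourier] by an inner product: the scalar has the defining
    property, and this property has at most one solution. *)
Lemma fourier_character (f : L2T) p : fourier f p = inner f (z p).
Proof.
have cM (a b c : R[i]) : a * b^*%C * c^*%C = a * (b * c)^*%C by rewrite rmorphM mulrA.
have E h : cintegral (@torus_measure R) (fun w =>
      inner (repr f w) h * (expi w.1 ^ (- p.1) * expi w.2 ^ (- p.2))) =
    inner (inner f (z p) : R[i]^o) h.
  rewrite -[RHS]/(inner f (z p) * (h : R[i])^*%C) mulrC -innerZr.
  rewrite (_ : (h : R[i]) *: z p = \pi_L2T ((h : R[i]) *: character_fun p)); last first.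
    by rewrite piL2Z.
  rewrite -[f in RHS]reprK.
  rewrite -[RHS]/(innerL2 _ _) innerL2E; congr cintegral; apply/funext => w.
  rewrite -[expi _ ^ _ * _]/(character (- p) w) characterN.
  rewrite -[inner _ h]/((repr f w : R[i]) * (h : R[i])^*%C).
  rewrite -[RHS]/((repr f w : R[i]) * ((h : R[i]) * character p w)^*%C).
  exact: cM.
apply: xget_unique => [h|c Hc]; first by rewrite E.
apply/eqP; rewrite -subr_eq0; apply/eqP/inner_eq0.
by rewrite innerBl Hc E subrr.
Qed.

Lemma character_complete (f : L2T) : (forall p, inner f (z p) = 0) -> f = 0.
Proof.
move=> f0; set F := repr f.
have FE : f = \pi_L2T F by rewrite reprK.
have int0 p c : cintegral (@torus_measure R)
    (fun w => (F w : R[i]) * (cos (phase p w + c))%:C) = 0.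
  (* a = e^(ic) / 2, so a times the character plus its conjugate is the real function cos (phase +
     c); a real test function separates the real and imaginary parts of F. *)
  pose a : R[i] := (cos c / 2) +i* (sin c / 2).
  pose k : L2fun (@torus_measure R) R[i]^o :=
    a *: character_fun p + a^*%C *: character_fun (- p).
  have := innerL2E F k; rewrite piL2D 2!piL2Z.
  rewrite -FE -[innerL2 _ _]/(inner f (a *: z p + a^*%C *: z (- p))).
  rewrite innerDr !innerZr !f0 !mulr0 addr0 => H; rewrite [RHS]H.
  congr cintegral; apply/funext => w.
  have -> : k w = (cos (phase p w + c))%:C :> R[i].
    rewrite -[LHS]/(a * character p w + a^*%C * character (- p) w).
    rewrite characterN characterE cosD /a.
    by apply/eqP; rewrite eq_complex/=; apply/andP; split; apply/eqP; field.
  by rewrite -[RHS]/((F w : R[i]) * ((cos (phase p w + c))%:C)^*%C) conjc_real.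
have ae0 (phi : R * R -> R) : (torus_measure (R:=R)).-integrable setT (EFin \o phi) ->
    (forall p c, Rintegral (@torus_measure R) setT (fun w => phi w * cos (phase p w + c)) = 0) ->
    {ae (@torus_measure R), forall w, phi w = 0}.
  move=> iphi hphi; exact: (trig_uniqueness iphi hphi (torus_ae_open_square R)).
(* Pairing with the constant character turns square integrability of F into integrability. *)
have i1 : forall w, inner (F w) (character_fun 0 w) = F w.
  move=> w; rewrite -[LHS]/((F w : R[i]) * (character 0 w : R[i])^*%C).
  have -> : character 0 w = 1 :> R[i] by rewrite /character !expr0z mulr1.
  by rewrite conjc1 mulr1.
have aer : {ae (@torus_measure R), forall w, complex.Re (F w) = 0}.
  apply: ae0 => [|p c].
    have := integrable_Re_inner F (character_fun 0); congr (_.-integrable _ _).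
    by apply/funext => w /=; rewrite i1.
  have := congr1 (@complex.Re R) (int0 p c); rewrite /cintegral/= => H; rewrite [RHS]/= -[RHS]H.
  by apply: eq_Rintegral => w _; case: (F w) => a b /=; ring.
have aei : {ae (@torus_measure R), forall w, complex.Im (F w) = 0}.
  apply: ae0 => [|p c].
    have := integrable_Im_inner F (character_fun 0); congr (_.-integrable _ _).
    by apply/funext => w /=; rewrite i1.
  have := congr1 (@complex.Im R) (int0 p c); rewrite /cintegral/= => H; rewrite -[RHS]H.
  by apply: eq_Rintegral => w _; case: (F w) => a b /=; ring.
by rewrite FE; exact: (piL2_eq0 aer aei).
Qed.

Lemma character_square_integrableZ r (f : L2T) :
  square_integrable (@torus_measure R) (fun w => (character r w : R[i]) *: repr f w).
Proof.
have [sf ff] := L2funP (repr f); split.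
  have mr := strongly_measurable_Re sf; have mi := strongly_measurable_Im sf.
  have [sc _] := character_square_integrable r.
  have cr := strongly_measurable_Re sc; have ci := strongly_measurable_Im sc.
  apply: strongly_measurable_complex.
    rewrite (_ : (fun w => _) = (fun w => complex.Re (character r w) * complex.Re (repr f w) -
        complex.Im (character r w) * complex.Im (repr f w))).
      by apply: measurable_funB; apply: measurable_funM.
    apply/funext => w; rewrite -[_ *: _]/((character r w : R[i]) * (repr f w : R[i])).
    by case: (character r w) => a b; case: (repr f w).
  rewrite (_ : (fun w => _) = (fun w => complex.Re (character r w) * complex.Im (repr f w) +
      complex.Im (character r w) * complex.Re (repr f w))).
    by apply: measurable_funD; apply: measurable_funM.
  apply/funext => w; rewrite -[_ *: _]/((character r w : R[i]) * (repr f w : R[i])).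
  by case: (character r w) => a b; case: (repr f w).
under eq_integral => w _ do rewrite nrmZ characterE/= cos2Dsin2 mul1r.
exact: ff.
Qed.

Lemma inner_toL2_character r (f : L2T) q :
  inner (toL2 (@torus_measure R) (fun w => (character r w : R[i]) *: repr f w) : L2T) (z q) =
  inner f (z (q - r)).
Proof.
(* Square integrability keeps [toL2] away from its default value 0. *)
have sr := character_square_integrableZ r f.
pose g : L2fun (@torus_measure R) R[i]^o := MkL2fun (introT (asboolP _) sr).
have -> : toL2 (@torus_measure R) (fun w => (character r w : R[i]) *: repr f w) = \pi_L2T g.
  by congr (\pi_L2T _); apply: val_inj; rewrite insubdK//; exact/asboolP.
rewrite [in RHS]inner_character -[LHS]/(innerL2 _ _) innerL2E.
congr cintegral; apply/funext => w.
rewrite opprB characterD characterN.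
rewrite -[LHS]/((character r w : R[i]) * (repr f w : R[i]) * (character q w : R[i])^*%C).
by rewrite mulrCA mulrA.
Qed.

Lemma Mz1_character (f : L2T) :
  Mz1 f = toL2 (@torus_measure R) (fun w => (character (1, 0) w : R[i]) *: repr f w).
Proof.
rewrite /Mz1; congr (toL2 _ _); apply/funext => w; congr (_ *: _).
by rewrite /character/= expr0z mulr1.
Qed.

Lemma Mz2_character (f : L2T) :
  Mz2 f = toL2 (@torus_measure R) (fun w => (character (0, 1) w : R[i]) *: repr f w).
Proof.
rewrite /Mz2; congr (toL2 _ _); apply/funext => w; congr (_ *: _).
by rewrite /character/= expr0z mul1r.
Qed.

Lemma inner_Mz1 (f : L2T) q : inner (Mz1 f) (z q) = inner f (z (q - (1, 0))).
Proof. by rewrite Mz1_character; exact: inner_toL2_character. Qed.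

Lemma inner_Mz2 (f : L2T) q : inner (Mz2 f) (z q) = inner f (z (q - (0, 1))).
Proof. by rewrite Mz2_character; exact: inner_toL2_character. Qed.

(** The summand 1 makes the integrand nonnegative, as needed for [integral_uniform] and later for
    Tonelli's theorem; [Rintegral_cos_phase] subtracts it again. *)
Let integral_cos1 (k : int) (c : R) : k != 0 ->
  (\int[uniform_prob (@ltr01 R)]_a (1 + cos (2 * pi * (k%:~R * a) + c))%:E = 1)%E.
Proof.
move=> k0; pose t : R := 2 * pi * k%:~R.
have t0 : t != 0 by rewrite /t mulf_neq0 ?intr_eq0// mulf_neq0// gt_eqF// pi_gt0.
have cf : continuous (fun a : R => 1 + cos (t * a + c)).
  move=> a; apply: cvgD; first exact: cvg_cst.
  apply: continuous_comp; last exact: continuous_cos.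
  by apply: cvgD; [apply: cvgM; [exact: cvg_cst|exact: cvg_id]|exact: cvg_cst].
pose F (a : R) := a + t^-1 * sin (t * a + c).
have dF a : is_derive a 1 F (1 + cos (t * a + c)).
  rewrite /F; apply: is_derive_eq.
  by rewrite /GRing.scale/=; field.
transitivity (\int[uniform_prob (@ltr01 R)]_a (1 + cos (t * a + c))%:E)%E.
  by apply: eq_integral => a _; rewrite /t !mulrA.
rewrite integral_uniform; last 2 first.
- by apply/measurable_EFinP; exact: continuous_measurable_fun.
- by move=> a; rewrite lee_fin -lerBlDl sub0r cos_geN1.
rewrite subr0 invr1 mul1e (@continuous_FTC2 _ _ F)//.
- rewrite -EFinB /F mulr1 mulr0 !add0r.
  have -> : sin (t + c) = sin c.
    (* t = 2 pi k is a period: this is read off from the k-th power of [expi 1], which is 1. *)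
    have := expiXz 1 k; rewrite mulr1 -/t /expi mulr1 mulr_natl cos2pi sin2pi.
    rewrite [X in X ^ _](_ : _ = 1) ?exp1rz// => /eqP.
    rewrite eq_complex/= => /andP[/eqP ct /eqP st].
    by rewrite sinD -ct -st mul0r add0r mul1r.
  by congr EFin; rewrite addrK.
- exact: continuous_subspaceT.
- split.
  + by move=> a _; exact: ex_derive.
  + apply: cvg_at_right_filter; apply: differentiable_continuous.
    by apply/derivable1_diffP; exact: ex_derive.
  + apply: cvg_at_left_filter; apply: differentiable_continuous.
    by apply/derivable1_diffP; exact: ex_derive.
- by move=> a _; rewrite derive1E derive_val.
Qed.

Let integral_cos_phase p (c : R) : p <> 0 ->
  (\int[@torus_measure R]_w (1 + cos (phase p w + c))%:E = 1)%E.
Proof.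
move=> p0; have mf : measurable_fun setT
    (fun w : measurableTypeR R * measurableTypeR R => (1 + cos (phase p w + c))%:E).
  apply/measurable_EFinP; apply: (@measurable_trig_poly _ (fun w => 1 + cos (phase p w + c))).
  by apply: trig_polyD; [exact: trig_poly_cst|exact: trig_poly_cos].
have f0 (w : measurableTypeR R * measurableTypeR R) : (0 <= (1 + cos (phase p w + c))%:E)%E.
  by rewrite lee_fin -lerBlDl sub0r cos_geN1.
have int1 : (\int[uniform_prob (@ltr01 R)]_a 1 = 1)%E.
  by rewrite integral_cst// mul1e; exact: probability_setT.
(* The inner integral is taken in a coordinate of nonzero frequency; the other coordinate only
   shifts the phase. *)
have [p2|p2] := eqVneq p.2 0; last first.
  rewrite /torus_measure fubini_tonelli1//; apply: etrans int1; apply: eq_integral => a _.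
  rewrite /fubini_F -[RHS](integral_cos1 (2 * pi * (p.1%:~R * a) + c) p2).
  by apply: eq_integral => b _; congr ((1 + cos _)%:E); rewrite /phase/=; ring.
have p1 : p.1 != 0.
  by apply/eqP => p1; apply: p0; move: p1 p2; case: p {mf f0} => k l /= -> ->.
rewrite /torus_measure fubini_tonelli2//; apply: etrans int1; apply: eq_integral => b _.
rewrite /fubini_G -[RHS](integral_cos1 (2 * pi * (p.2%:~R * b) + c) p1).
by apply: eq_integral => a _; congr ((1 + cos _)%:E); rewrite /phase/=; ring.
Qed.

Let torus1 : (\int[@torus_measure R]_w 1%:E = 1)%E.
Proof.
rewrite integral_cst// mul1e -setXTT /torus_measure.
rewrite [LHS]product_measure1E// [X in (X * _)%E]probability_setT.
by rewrite [X in (_ * X)%E]probability_setT mule1.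
Qed.

Lemma Rintegral_cos_phase p (c : R) : p <> 0 ->
  Rintegral (@torus_measure R) setT (fun w => cos (phase p w + c)) = 0.
Proof.
move=> p0.
have i1 : (@torus_measure R).-integrable setT (fun w => (1 : R)%:E).
  apply/integrableP; split; first exact: measurable_cst.
  by under eq_integral do rewrite gee0_abs//; rewrite torus1 ltry.
have ic : (@torus_measure R).-integrable setT (fun w => (1 + cos (phase p w + c))%:E).
  apply/integrableP; split.
    apply/measurable_EFinP; apply: (@measurable_trig_poly _ (fun w => 1 + cos (phase p w + c))).
    by apply: trig_polyD; [exact: trig_poly_cst|exact: trig_poly_cos].
  under eq_integral => w _ do
    rewrite gee0_abs ?lee_fin -?lerBlDl ?sub0r ?cos_geN1//.
  by rewrite integral_cos_phase// ltry.
transitivity (Rintegral (@torus_measure R) setT (fun w => (1 + cos (phase p w + c)) - 1)).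
  by apply: eq_Rintegral => w _; rewrite addrAC subrr add0r.
by rewrite RintegralB// /Rintegral integral_cos_phase// torus1 subrr.
Qed.

Lemma character_orthonormal p q : inner (z p) (z q) = (p == q)%:R.
Proof.
rewrite -[inner _ _]/(innerL2 _ _) innerL2E.
transitivity (cintegral (@torus_measure R) (character (p - q))).
  congr cintegral; apply/funext => w; rewrite characterD characterN.
  by [].
have [->|/eqP pq] := eqVneq p q.
  rewrite subrr /cintegral (@eq_Rintegral _ _ _ _ _ (cst 1)); last first.
    by move=> w _; rewrite /character !expr0z mulr1.
  rewrite [X in _ +i* X](@eq_Rintegral _ _ _ _ _ (cst 0)); last first.
    by move=> w _; rewrite /character !expr0z mulr1.
  by rewrite [X in _ +i* X]Rintegral_cst// mul0r /Rintegral torus1.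
have pq0 : p - q <> 0 by move=> /eqP; rewrite subr_eq0 => /eqP.
rewrite /cintegral; apply/eqP; rewrite eq_complex/=; apply/andP; split; apply/eqP.
  rewrite -[RHS](@Rintegral_cos_phase _ 0 pq0).
  by apply: eq_Rintegral => w _; rewrite characterE addr0.
rewrite -[RHS](@Rintegral_cos_phase _ (- (pi / 2)) pq0).
by apply: eq_Rintegral => w _; rewrite characterE cosBpihalf.
Qed.

End characters.

(** * Pairs given by a diagram *)

(** Makes the scalars a [hilbertType], as the coefficient space in [given_by_diagram] has to be. *)
Lemma complex_complete (R : realType) (F : set_system R[i]^o) :
  ProperFilter F -> cauchy F -> cvg F.
Proof.
move=> FF /cauchyP cF.
have cauchy_part (f : R[i]^o -> R) : (forall x y, `|f x - f y| <= nrm (x - y)) ->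
    exists a : R, forall e : R, 0 < e -> \forall z \near F, `|a - f z| < e.
  move=> fL; have : cauchy (fmap f F).
    apply/cauchyP => e e0; have [|x Fx] := cF e%:C; first by rewrite ltcR.
    exists (f x); apply: (@filterS _ F _ (ball x e%:C) (f @^-1` ball (f x) e)) Fx.
    move=> y xy; have {xy} : nrm (x - y) < e.
      by move: xy; rewrite -ball_normE/= -nrmE ltcR.
    by rewrite /= -ball_normE/=; exact: le_lt_trans (fL x y).
  move=> /cauchy_cvg /cvg_ex[a fa]; exists a => e e0.
  by have := fa _ (nbhsx_ballx a e e0); rewrite -ball_normE.
have ReL (x y : R[i]^o) : `|complex.Re x - complex.Re y| <= nrm (x - y).
  by rewrite -raddfB; exact: Re_le_nrm.
have ImL (x y : R[i]^o) : `|complex.Im x - complex.Im y| <= nrm (x - y).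
  by rewrite -raddfB; exact: Im_le_nrm.
have [a Fa] := cauchy_part _ ReL; have [b Fb] := cauchy_part _ ImL.
apply/cvg_ex; exists (a +i* b); apply/cvg_ballP => e e0.
have eE : e = (complex.Re e)%:C by rewrite RRe_real// gtr0_real.
have e2 : 0 < complex.Re e / 2 by rewrite divr_gt0// -ltcR -eE.
near=> z; rewrite -ball_normE/= -nrmE eE ltcR.
apply: le_lt_trans (nrm_le_ReIm _) _; rewrite !raddfB/= (splitr (complex.Re e)).
by apply: ltrD; near: z; [exact: Fa|exact: Fb].
Unshelve. all: by end_near. Qed.

HB.instance Definition _ (R : realType) := Uniform_isComplete.Build R[i]^o (@complex_complete R).

(* The coefficient space of the diagram model when the innovation vanishes *)
Definition zero_space (R : realType) : Type := L2 (@mzero _ unit R) R[i]^o.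
HB.instance Definition _ (R : realType) := InnerProduct.on (zero_space R).

Lemma zero_space_eq0 (R : realType) (x : zero_space R) : x = 0.
Proof.
rewrite -[x]reprK; apply: piL2_eq0; exists setT; split => //; exact: measurableT.
Qed.

Lemma zero_space_complete (R : realType) (F : set_system (zero_space R)) :
  ProperFilter F -> cauchy F -> cvg F.
Proof.
move=> FF _; apply/cvg_ex; exists 0 => A /nbhs_singleton A0.
by apply: filterS filterT => x _; rewrite (zero_space_eq0 x).
Qed.

HB.instance Definition _ (R : realType) :=
  Uniform_isComplete.Build (zero_space R) (@zero_space_complete R).


(** * Isometries from equal Gram matrices *)

Section gram_transfer.
Variables (R : realType) (E F : innerProductType R) (I : Type) (u : I -> E) (z : I -> F).
Hypotheses (cF : seq_complete F)
  (gram : forall p q, inner (u p) (u q) = inner (z p) (z q)).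

(** A relation, since a vector may have several expansions in [u]; equality of the Gram matrices
    makes it distance-preserving and thereby single-valued. *)
Let graph (x : E) (y : F) := exists n (c : 'I_n -> R[i]) (a : 'I_n -> I),
  x = \sum_i c i *: u (a i) /\ y = \sum_i c i *: z (a i).

Let graph_inner x y x' y' : graph x y -> graph x' y' -> inner x x' = inner y y'.
Proof.
move=> [n [c [a [-> ->]]]] [m [c' [a' [-> ->]]]]; rewrite !inner_suml.
apply: eq_bigr => i _; rewrite !inner_sumr; apply: eq_bigr => j _.
by rewrite !innerZl !innerZr gram.
Qed.

Let graph_nrm x y x' y' : graph x y -> graph x' y' -> nrm (x - x') = nrm (y - y').
Proof.
move=> xy xy'; apply/eqP; rewrite -(@eqrXn2 _ 2)// ?nrm_ge0// !nrmB_sq.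
by rewrite !nrm2E (graph_inner xy xy) (graph_inner xy xy') (graph_inner xy' xy').
Qed.

Let graph_dense x : lspan (range u) x -> exists y, graph x y /\ lspan (range z) y.
Proof.
move=> [n [c [a [ua ->]]]].
have /choice[b ub] : forall i, exists p, u p = a i by move=> i; have [p _ <-] := ua i; exists p.
exists (\sum_i c i *: z (b i)); split.
  by exists n, c, b; split => //; apply: eq_bigr => i _; rewrite ub.
by exists n, c, (z \o b); split => // i; exists (b i).
Qed.

(** Approximate x by finite combinations: their partners under [graph] form a Cauchy sequence, whose
    limit inherits the norm and the coefficients. *)
Lemma gram_transfer x : clspan (range u) x -> exists y,
  [/\ clspan (range z) y, nrm y = nrm x & forall p, inner y (z p) = inner x (u p)].
Proof.
move=> /closure_nrmP ux.
have /choice[f Hf] n : exists xy : E * F,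
    [/\ graph xy.1 xy.2, lspan (range z) xy.2 & nrm (x - xy.1) < n.+1%:R^-1].
  have [|x' /graph_dense[y [xy zy]] xx'] := ux n.+1%:R^-1; first by rewrite invr_gt0.
  by exists (x', y).
have near_x e : 0 < e -> exists k, forall n, (k <= n)%N -> nrm (x - (f n).1) < e.
  move=> e0; have [k /= _ Hk] := @near_infty_natSinv_lt R (PosNum e0).
  exists k => n kn; have [_ _ xn] := Hf n.
  exact: lt_trans xn (Hk n kn).
have [|y Hy] := cF (u := fun n => (f n).2).
  move=> e e0; have e2 : 0 < e / 2 by rewrite divr_gt0.
  have [k Hk] := near_x _ e2; exists k => m n km kn.
  have [gm _ _] := Hf m; have [gn _ _] := Hf n; rewrite -(graph_nrm gm gn).
  apply: le_lt_trans (nrmB_triangle x _ _) _; rewrite (splitr e).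
  by apply: ltrD; [rewrite nrmBC; exact: Hk|exact: Hk].
have both e : 0 < e -> exists n, nrm (x - (f n).1) < e /\ nrm (y - (f n).2) < e.
  move=> e0; have [k Hk] := near_x _ e0; have [k' Hk'] := Hy _ e0.
  exists (maxn k k'); split; first exact/Hk/leq_maxl.
  by rewrite nrmBC; exact/Hk'/leq_maxr.
have nf n : nrm (f n).1 = nrm (f n).2.
  have [g _ _] := Hf n; apply/eqP; rewrite -(@eqrXn2 _ 2)// ?nrm_ge0//.
  by rewrite !nrm2E (graph_inner g g).
exists y; split.
- apply/closure_nrmP => e /both[n [_ yn]]; exists (f n).2 => //.
  by have [] := Hf n.
- apply/le_anti/andP; split; apply/ler_addgt0Pr => e e0.
    have e2 : 0 < e / 2 by rewrite divr_gt0.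
    have [n [xn yn]] := both _ e2.
    have h1 : nrm y <= nrm (y - (f n).2) + nrm (f n).2.
      by have := nrm_triangle (y - (f n).2) (f n).2; rewrite subrK.
    have h2 : nrm (f n).1 <= nrm (x - (f n).1) + nrm x.
      by have := nrm_triangle ((f n).1 - x) x; rewrite subrK nrmBC.
    by rewrite nf in h2; clear -xn yn h1 h2; lra.
  have e2 : 0 < e / 2 by rewrite divr_gt0.
  have [n [xn yn]] := both _ e2.
  have h1 : nrm x <= nrm (x - (f n).1) + nrm (f n).1.
    by have := nrm_triangle (x - (f n).1) (f n).1; rewrite subrK.
  have h2 : nrm (f n).2 <= nrm (y - (f n).2) + nrm y.
    by have := nrm_triangle ((f n).2 - y) y; rewrite subrK nrmBC.
  by rewrite nf in h1; clear -xn yn h1 h2; lra.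
- move=> p; have gp : graph (u p) (z p).
    exists 1%N, (fun=> 1), (fun=> p); rewrite !big_ord_recl !big_ord0.
    by rewrite !scale1r !addr0.
  have key e : 0 < e -> exists n, nrm (x - (f n).1) * nrm (u p) +
      nrm (y - (f n).2) * nrm (z p) <= e.
    move=> e0; have c0 : 0 < nrm (u p) + nrm (z p) + 1.
      by rewrite ltr_wpDl// addr_ge0 ?nrm_ge0.
    have [n [xn yn]] := both _ (divr_gt0 e0 c0); exists n.
    have := ler_wpM2r (nrm_ge0 (u p)) (ltW xn); have := ler_wpM2r (nrm_ge0 (z p)) (ltW yn).
    move=> h1 h2; apply: le_trans (lerD h2 h1) _; rewrite -mulrDr.
    by rewrite mulrAC ler_pdivrMr// ler_wpM2l ?(ltW e0)// lerDl.
  have dE n : inner y (z p) - inner x (u p) =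
      inner (y - (f n).2) (z p) - inner (x - (f n).1) (u p).
    have [g _ _] := Hf n; rewrite !innerBl (graph_inner g gp).
    by rewrite opprB subrKA.
  apply/eqP; rewrite -subr_eq0 eq_complex; apply/andP; split; rewrite -normr_le0.
    apply/ler_addgt0Pr => e /key[n]; rewrite add0r; apply: le_trans.
    rewrite (dE n) raddfB/= (le_trans (ler_normB _ _))// addrC.
    by apply: lerD; exact: Re_inner_CS.
  apply/ler_addgt0Pr => e /key[n]; rewrite add0r; apply: le_trans.
  rewrite (dE n) raddfB/= (le_trans (ler_normB _ _))// addrC.
  by apply: lerD; exact: Im_inner_CS.
Qed.

End gram_transfer.

Section diagram_model.
Variables (R : realType) (E : innerProductType R).
Hypothesis cE : seq_complete E.
Local Notation L2T := (L2 (@torus_measure R) R[i]^o).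
Local Notation z := (@characterL2 R).

Let cT : seq_complete L2T. Proof. exact: L2_seq_complete. Qed.

Let z_uniq (f g : L2T) : (forall p, inner f (z p) = inner g (z p)) -> f = g.
Proof.
move=> fg; apply/eqP; rewrite -subr_eq0; apply/eqP/character_complete => p.
by rewrite innerBl fg subrr.
Qed.

Let clspan_z (f : L2T) : clspan (range z) f.
Proof.
suff -> : clspan (range z) = setT by [].
apply: (csub_eq cT) => [||| g _ gz].
- exact: clspan_csub.
- by [].
- by split => //; exact: closedT.
- by apply: character_complete => p; apply: gz; apply: clspan_sub; exists p.
Qed.

(** [u] is indexed by the whole lattice although J alone spans the space, because shifting the index
    of a coefficient may leave J. The intertwining relations are checked on Fourier coefficients. *)
Lemma orthonormal_given_by_diagram (J : set (int * int)) (u : int * int -> E)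
    (V1 V2 : E -> E) : is_diagram J ->
  (forall p q, inner (u p) (u q) = (p == q)%:R) ->
  (forall x q, clspan [set u p | p in J] x -> clspan [set u p | p in J] (V1 x) /\
     inner (V1 x) (u q) = inner x (u (q - (1, 0)))) ->
  (forall x q, clspan [set u p | p in J] x -> clspan [set u p | p in J] (V2 x) /\
     inner (V2 x) (u q) = inner x (u (q - (0, 1)))) ->
  given_by_diagram J (clspan [set u p | p in J]) V1 V2.
Proof.
move=> dJ uu; set M := clspan _ => hV1 hV2; split => //; exists R[i]^o.
have cM : closed_subspace M by exact: clspan_csub.
have uz p q : inner (u p) (u q) = inner (z p) (z q).
  by rewrite uu character_orthonormal.
have uMJ q x : ~ J q -> M x -> inner x (u q) = 0.
  move=> Jq Mx; apply: inner_eq0C; apply: (@perp_clspan _ _ [set u p | p in J]) Mx.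
  move=> _ [p Jp <-]; rewrite uu; have [qp|//] := eqVneq q p.
  by rewrite qp in Jq.
(* the function with Fourier coefficients [inner x (u p)] *)
pose W x : L2T := xget 0 [set y | forall p, inner y (z p) = inner x (u p)].
have WP x : M x -> nrm (W x) = nrm x /\ forall p, inner (W x) (z p) = inner x (u p).
  move=> Mx; have [|y [_ ny yz]] := gram_transfer cT uz (x := x).
    by apply: clspan_mono Mx => _ [p _ <-]; exists p.
  rewrite (_ : W x = y)//; apply: xget_unique => // y' Hy'.
  by apply: z_uniq => p; rewrite Hy' yz.
have WM x : M x -> diagram_space J (W x).
  by move=> Mx p Jp; rewrite fourier_character (WP x Mx).2 uMJ.
exists W; split.
- split=> [x|a x y Mx My]; first exact: WM.
  apply: z_uniq => p; rewrite innerDl innerZl (WP x Mx).2 (WP y My).2.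
  by rewrite (WP _ (csubL a cM Mx My)).2 innerDl innerZl.
- apply/seteqP; split=> [_ [x Mx <-]|y Jy]; first exact: WM.
  (* Surjectivity uses the transfer in the opposite direction. *)
  have [|x [ux _ xy]] := gram_transfer cE (fun p q => esym (uz p q)) (x := y).
    exact: clspan_z.
  have Mx : M x.
    (* The vanishing coefficients outside J force x into M: its component orthogonal to M is
       orthogonal to every [u p]. *)
    have [Mp xp] := projP cE x cM.
    suff /eqP : x - proj M x = 0 by rewrite subr_eq0 => /eqP ->.
    apply: (@perp_self _ _ (clspan (range u))).
      apply: (csubB (clspan_csub _)) => //.
      by apply: clspan_mono Mp => _ [p _ <-]; exists p.
    apply: perp_clspan => _ [p _ <-]; have [Jp|Jp] := pselect (J p).
      by apply: xp; apply: clspan_sub; exists p.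
    rewrite innerBl (uMJ p _ Jp Mp) subr0 xy -fourier_character.
    exact: Jy.
  by exists x => //; apply: z_uniq => p; rewrite (WP x Mx).2 xy.
- by move=> x Mx; rewrite -!nrmE (WP x Mx).1.
- move=> x Mx; apply: z_uniq => q; have [MV xV] := hV1 x q Mx.
  by rewrite (WP _ MV).2 inner_Mz1 (WP x Mx).2.
- move=> x Mx; apply: z_uniq => q; have [MV xV] := hV2 x q Mx.
  by rewrite (WP _ MV).2 inner_Mz2 (WP x Mx).2.
Qed.

Lemma L2_zero_space_eq0 (f : L2 (@torus_measure R) (zero_space R)) : f = 0.
Proof.
rewrite -[LHS]reprK -[RHS]reprK; congr (\pi_(L2 (@torus_measure R) (zero_space R)) _)%qT.
apply: val_inj; apply/funext => w.
by rewrite [LHS]zero_space_eq0 [RHS]zero_space_eq0.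
Qed.

Lemma zero_given_by_diagram (J : set (int * int)) (V1 V2 : E -> E) :
  is_diagram J -> V1 0 = 0 -> V2 0 = 0 -> given_by_diagram J [set 0] V1 V2.
Proof.
move=> dJ V10 V20; split => //; exists (zero_space R), (fun=> 0).
have d0 f : @diagram_space R (zero_space R) J f.
  by move=> p _; exact: zero_space_eq0.
split.
- split=> [x _|a x y _ _]; first exact: d0.
  by rewrite scaler0 addr0.
- apply/seteqP; split=> [_ [x _ <-]|f _]; first exact: d0.
  by exists 0 => //; exact/esym/L2_zero_space_eq0.
- by move=> x ->; rewrite !normr0.
- by move=> x _; exact/esym/L2_zero_space_eq0.
- by move=> x _; exact/esym/L2_zero_space_eq0.
Qed.

End diagram_model.

Section diagram_part_model.
Variables (R : realType) (E : innerProductType R).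
Variables (U : int * int -> E -> E) (x0 : E) (V1 V2 : E -> E).
Hypotheses (hU : unitary_group U) (cE : seq_complete E).
Let H : set E := clspan [set U p x0 | p in lexJ].
Hypothesis V1E : forall x, H x -> V1 x = U dir1 x.
Hypothesis V2E : forall x, H x -> V2 x = U dir2 x.

Lemma diagram_part_given_by_diagram :
  given_by_diagram lexJ (diagram_part U x0) V1 V2.
Proof.
have cH : closed_subspace H by exact: clspan_csub.
have [_ HtH Ht1 _] := diagram_part_reduces1 hU cE V1E.
have [_ _ Ht2 _] := diagram_part_reduces2 hU cE V2E.
have HtE := diagram_part_innovation x0 hU cE.
set e0 := innovation U x0 in HtE.
(* If the innovation vanishes, then Ht is zero and the coefficient space must be zero as well, since
   the diagram space over the scalars is not. *)
have [e00|e0n] := eqVneq e0 0.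
  have -> : diagram_part U x0 = [set 0].
    rewrite HtE; apply/seteqP; split=> [|_ ->]; last exact: csub0 (clspan_csub _).
    have c0 : closed_subspace [set (0 : E)].
      split=> // [a x y -> ->|x /closure_nrmP x0']; first by rewrite scaler0 addr0.
      apply: nrm0_eq0; apply/eqP; rewrite -normr_le0 ger0_norm ?nrm_ge0//.
      apply/ler_addgt0Pr => e /x0'[_ ->]; rewrite subr0 add0r; exact: ltW.
    by apply: clspan_min => // _ [p _ <-]; rewrite e00 (U_0 hU).
  have H0 : H 0 by exact: csub0.
  apply: zero_given_by_diagram lexJ_diagram _ _.
    by rewrite V1E// (U_0 hU).
  by rewrite V2E// (U_0 hU).
pose c : R[i] := (nrm e0)^-1%:C.
have n0 : nrm e0 != 0 by apply: contra_neq e0n => /nrm0_eq0.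
have c0 : c != 0 by rewrite eq_complex/= negb_and invr_neq0.
pose u p := U p (c *: e0).
have uE p : u p = c *: U p e0 by rewrite /u (U_Z hU).
have HtE' : diagram_part U x0 = clspan [set u p | p in lexJ].
  rewrite HtE; apply/seteqP; split; apply: clspan_min; try exact: clspan_csub.
    move=> _ [p Jp <-]; rewrite -[U p e0]scale1r -(mulVf c0) -scalerA -uE.
    by apply: (csubZ _ (clspan_csub _)); apply: clspan_sub; exists p.
  move=> _ [p Jp <-]; rewrite uE.
  by apply: (csubZ _ (clspan_csub _)); apply: clspan_sub; exists p.
have uU p q x : inner (U p x) (u q) = inner x (u (q - p)).
  by rewrite (UadjL hU) -(UD hU) addrC.
rewrite HtE'; apply: orthonormal_given_by_diagram => //; first exact: lexJ_diagram.
- move=> p q; have [->|/eqP pq] := eqVneq p q; last first.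
    by rewrite !uE innerZl innerZr (innovation_orth x0 hU cE pq) !mulr0.
  rewrite (UI hU) innerZl innerZr innerxx -nrmE conjc_real -[_ ^+ 2]rmorphXn -!rmorphM/=.
  by rewrite -[RHS]/(1%:C); congr (_%:C); field.
- move=> x q; rewrite -HtE' => Hx; split; first exact: Ht1.
  by rewrite V1E; [exact: uU|exact: HtH].
- move=> x q; rewrite -HtE' => Hx; split; first exact: Ht2.
  by rewrite V2E; [exact: uU|exact: HtH].
Qed.

End diagram_part_model.

(** * Fields as orbits of the lattice *)

Section shifted_orbit.
Variables (R : realType) (E : innerProductType R) (U : int * int -> E -> E).
Variable f : int * int -> E.
Hypotheses (hU : unitary_group U) (f1 : forall q, U dir1 (f q) = f (q - dir1))
  (f2 : forall q, U dir2 (f q) = f (q - dir2)).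

Lemma orbit_shift p q : U p (f q) = f (q - p).
Proof.
have step (e : int * int) : (forall q, U e (f q) = f (q - e)) ->
    forall (k : int) q, U (e *~ k) (f q) = f (q - e *~ k).
  move=> fe; have fn (n : nat) r : U (e *+ n) (f r) = f (r - e *+ n).
    elim: n r => [|n IH] r; first by rewrite mulr0n (U0 hU) subr0.
    by rewrite mulrS (UD hU) IH fe opprD addrCA addrC -addrA addrC.
  case=> n r; first exact: fn.
  rewrite NegzE mulrNz opprK -[f r](_ : U (e *+ n.+1) (f (r + e *+ n.+1)) = f r).
    by rewrite (UK hU).
  by rewrite fn addrK.
have pE r : r = dir1 *~ r.1 + dir2 *~ r.2.
  have mz (v : int * int) k : v *~ k = (v.1 *~ k, v.2 *~ k).
    by rewrite [LHS]surjective_pairing !raddfMz.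
  by case: r => k l; rewrite !mz /= !mul0rz !intz; congr pair; rewrite /=; lia.
by rewrite [in LHS](pE p) (UD hU) (step _ f2) (step _ f1) [in RHS](pE p) opprD addrA [in RHS]addrAC.
Qed.

End shifted_orbit.

(** * Extension of the shifts to unitary operators *)

Section integer_iterates.
Variables (T : Type) (A B : T -> T).
Hypotheses (AK : cancel A B) (BK : cancel B A).

Definition ziter (k : int) : T -> T :=
  match k with Posz n => iter n A | Negz n => iter n.+1 B end.

Lemma ziterS k x : ziter (k + 1) x = A (ziter k x).
Proof.
case: k => [n|[|n]]; first by rewrite -PoszD addn1.
  by rewrite /= BK.
by rewrite NegzE (_ : - n.+2%:Z + 1 = Negz n) ?NegzE /= ?BK//; lia.
Qed.

Lemma ziterP k x : ziter (k - 1) x = B (ziter k x).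
Proof. by rewrite -[in RHS](subrK 1 k) ziterS AK. Qed.

Lemma ziterD k l x : ziter (k + l) x = ziter k (ziter l x).
Proof.
elim/int_rec: k => [|n IH|n IH]; first by rewrite add0r.
  have -> : n.+1%:Z + l = (n%:Z + l) + 1 by lia.
  have -> : n.+1%:Z = n%:Z + 1 by lia.
  by rewrite !ziterS IH.
have -> : - n.+1%:Z + l = (- n%:Z + l) - 1 by lia.
have -> : - n.+1%:Z = - n%:Z - 1 by lia.
by rewrite !ziterP IH.
Qed.

Lemma ziter_comm (C : T -> T) : (forall x, C (A x) = A (C x)) ->
  forall k x, C (ziter k x) = ziter k (C x).
Proof.
move=> CA; have CB x : C (B x) = B (C x) by rewrite -[LHS]AK -CA BK.
by case=> n x; rewrite /ziter; [elim: n|elim: n.+1] => //= m <-; rewrite ?CA ?CB.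
Qed.

Lemma ziter_ind (P : (T -> T) -> Prop) : P id ->
  (forall f, P f -> P (A \o f)) -> (forall f, P f -> P (B \o f)) -> forall k, P (ziter k).
Proof.
move=> P0 PA PB [] n; rewrite /ziter.
  by elim: n => // m IH; exact: (PA _ IH).
by elim: n.+1 => // m IH; exact: (PB _ IH).
Qed.

End integer_iterates.

Section unitary_extension.
Variables (R : realType) (E : innerProductType R).
Implicit Types (x y : E) (G : set E).
Hypothesis cE : seq_complete E.

Definition unitary_operator (A : E -> E) :=
  [/\ forall (a : R[i]) x y, A (a *: x + y) = a *: A x + A y,
      forall x y, inner (A x) (A y) = inner x y &
      forall y, exists x, A x = y].

Let unitary_inv (A : E -> E) : unitary_operator A ->
  exists B : E -> E, [/\ unitary_operator B, cancel A B & cancel B A].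
Proof.
move=> [AL AI AS]; have /choice[B BK] := AS.
have Ainj : injective A.
  move=> x y xy; apply/eqP; rewrite -subr_eq0; apply/eqP/inner_eq0.
  rewrite -AI -[x - y]addrC -scaleN1r AL xy scaleN1r addNr inner0l//.
have AK : cancel A B by move=> x; apply: Ainj; rewrite BK.
exists B; split => //; split=> [a x y|x y|y].
- by apply: Ainj; rewrite AL !BK.
- by rewrite -AI !BK.
- by exists (A y).
Qed.

Lemma unitary_group_of (A1 A2 : E -> E) : unitary_operator A1 -> unitary_operator A2 ->
  (forall x, A1 (A2 x) = A2 (A1 x)) ->
  exists U, [/\ unitary_group U, forall x, U (1, 0) x = A1 x & forall x, U (0, 1) x = A2 x].
Proof.
move=> u1 u2 A12; have [B1 [v1 K1 K1']] := unitary_inv u1.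
have [B2 [v2 K2 K2']] := unitary_inv u2.
pose U (p : int * int) x := ziter A1 B1 p.1 (ziter A2 B2 p.2 x).
have zu (A B : E -> E) k : unitary_operator A -> unitary_operator B ->
    (forall (a : R[i]) x y, ziter A B k (a *: x + y) = a *: ziter A B k x + ziter A B k y) /\
    (forall x y, inner (ziter A B k x) (ziter A B k y) = inner x y).
  move=> [AL AI _] [BL BI _]; apply: (ziter_ind (P := fun f =>
    (forall (a : R[i]) x y, f (a *: x + y) = a *: f x + f y) /\
    (forall x y, inner (f x) (f y) = inner x y))) => // f [fL fI]; split=> *.
  - by rewrite /= fL AL.
  - by rewrite /= AI fI.
  - by rewrite /= fL BL.
  - by rewrite /= BI fI.
exists U; split => //; split => [[k l] a x y|//|[k l] [m n] x|[k l] x y].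
- by rewrite /U/= (zu _ _ _ u2 v2).1 (zu _ _ _ u1 v1).1.
- rewrite /U/= (ziterD K1 K1') (ziterD K2 K2'); congr (ziter _ _ k _).
  apply/esym/(ziter_comm K1 K1') => {}x; apply/esym.
  exact: (ziter_comm K2 K2').
- by rewrite /U/= (zu _ _ _ u1 v1).2 (zu _ _ _ u2 v2).2.
Qed.

(* the identity on the orthogonal complement of [G] *)
Definition extend G (A : E -> E) x : E := A (proj G x) + (x - proj G x).

Lemma proj_id G x : closed_subspace G -> G x -> proj G x = x.
Proof.
by move=> cG Gx; apply: (proj_uniq cE) => // y _; rewrite subrr inner0l.
Qed.

Lemma extendE G A x : closed_subspace G -> G x -> extend G A x = A x.
Proof. by move=> cG Gx; rewrite /extend proj_id// subrr addr0. Qed.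

Let projL G (a : R[i]) x y : closed_subspace G ->
  proj G (a *: x + y) = a *: proj G x + proj G y.
Proof.
move=> cG; apply: (proj_uniq cE) => //; first by apply: csubL => //; exact: (proj_in cE).
rewrite (_ : _ - _ = a *: (x - proj G x) + (y - proj G y)).
  by apply: (csubL a (perp_csub G)); exact: (proj_perp cE _ cG).
by rewrite scalerBr opprD addrACA.
Qed.

(** Polarization: norms determine the real part of the inner product, and its imaginary part is a
    real part after multiplication by i. *)
Lemma isometry_on_inner G A x y : closed_subspace G -> isometry_on G A -> G x -> G y ->
  inner (A x) (A y) = inner x y.
Proof.
move=> cG [[AG AL] An] Gx Gy.
have nA v : G v -> nrm (A v) = nrm v by move=> Gv; rewrite /nrm An.
have A0 : A 0 = 0 by apply: nrm0_eq0; rewrite nA ?nrm0//; exact: csub0.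
have AZ (a : R[i]) v : G v -> A (a *: v) = a *: A v.
  by move=> Gv; rewrite -[a *: v]addr0 AL ?A0 ?addr0//; exact: csub0.
have AD v w : G v -> G w -> A (v + w) = A v + A w.
  by move=> Gv Gw; rewrite -[v]scale1r AL// !scale1r.
have AN v : G v -> A (- v) = - A v by move=> Gv; rewrite -scaleN1r AZ// scaleN1r.
have re v w : G v -> G w -> complex.Re (inner (A v) (A w)) = complex.Re (inner v w).
  move=> Gv Gw; have Gw' := csubN cG Gw.
  rewrite !Re_inner_polar -AD// -AN// -AD//.
  by rewrite !nA//; [exact: csubB|exact: csubD].
apply/eqP; rewrite eq_complex re// !Im_inner -AZ// re ?eqxx//.
exact: csubZ.
Qed.

Lemma extend_unitary G A : closed_subspace G -> unitary_on G A -> unitary_operator (extend G A).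
Proof.
move=> cG [iA AS]; have [[AG AL] An] := iA; split=> [a x y|x y|y].
- rewrite /extend projL// AL; [|exact: (proj_in cE)|exact: (proj_in cE)].
  by rewrite [in RHS]scalerDr [RHS]addrACA; congr (_ + _); rewrite opprD addrACA scalerBr.
- have Px := proj_in cE x cG; have Py := proj_in cE y cG.
  have Qx := proj_perp cE x cG; have Qy := proj_perp cE y cG.
  have pyth (v v' w w' : E) : inner v w' = 0 -> inner w v' = 0 ->
      inner (v + w) (v' + w') = inner v v' + inner w w'.
    by move=> vw wv; rewrite innerDl !innerDr vw wv addr0 add0r.
  rewrite /extend pyth; [|exact: perpC (AG _ Px) Qy|exact: Qx (AG _ Py)].
  rewrite (isometry_on_inner cG iA Px Py) -pyth; [|exact: perpC Px Qy|exact: Qx Py].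
  by rewrite addrC subrK addrC subrK.
- have Py := proj_in cE y cG; move: (Py); rewrite -{1}AS => -[x Gx xy].
  exists (x + (y - proj G y)); rewrite /extend (proj_uniq cE cG (y := x))//.
    by rewrite xy addrAC subrr add0r addrC subrK.
  by rewrite addrAC subrr add0r; exact: (proj_perp cE _ cG).
Qed.

Lemma extend_comm G A B x : closed_subspace G -> unitary_on G A -> unitary_on G B ->
  commute_on G A B -> extend G A (extend G B x) = extend G B (extend G A x).
Proof.
move=> cG [[[AG AL] _] _] [[[BG BL] _] _] AB.
have Px := proj_in cE x cG; have Qx := proj_perp cE x cG.
have pE C : G (C (proj G x)) -> proj G (extend G C x) = C (proj G x).
  by move=> GC; apply: (proj_uniq cE) => //; rewrite addrAC subrr add0r.
rewrite {1}/extend [in RHS]/extend !pE; [|exact: AG|exact: BG].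
by rewrite AB// /extend; congr (_ + _); rewrite !(addrAC _ _ (- _)) !subrr !add0r.
Qed.

End unitary_extension.

Theorem theorem16 (d : measure_display) (Omega : measurableType d)
    (R : realType) (P : probability Omega R)
    (X : int * int -> Omega -> R[i])
    (U1 U2 : L2 P R[i]^o -> L2 P R[i]^o) :
  weak_stationary P X ->
  no_deterministic_part P X half_plane ->
  unitary_on (field_space P X) U1 ->
  unitary_on (field_space P X) U2 ->
  commute_on (field_space P X) U1 U2 ->
  (forall s t : int, U1 (rv_class P X (s, t)) = rv_class P X (s - 1, t)) ->
  (forall s t : int, U2 (rv_class P X (s, t)) = rv_class P X (s, t - 1)) ->
  let H := past_space P X half_plane (0, 0) in
  let V1 := U1 \_ H in
  let V2 := U2 \_ H in
  let kerV1s := kernel_on H (adjoint H V1) in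
  let kerV2s := kernel_on H (adjoint H V2) in
  let K := hdim kerV2s in
  let J := neg_set half_plane `|` [set (0, 0)] in
  exists Ht He : set (L2 P R[i]^o),
    orth_sum2 H Ht He /\
    (* (1) *)
    (reduces H V1 Ht /\ reduces H V2 Ht /\
     reduces H V1 He /\ reduces H V2 He) /\
    (* (2) *)
    totally_non_unitary (neg_set half_plane) Ht V1 V2 /\
    (* (3) *)
    (unitary_on He V1 /\ unilateral_shift He V2) /\
    (* (4) *)
    (exists v : L2 P R[i]^o,
       cyclic_vector (kerV2s `&` He) V1 v /\
       orth_sum [set: nat]
         (fun n => clspan [set iter n V2 (iter m V1 v) |
                             m in [set m : nat | (m%:R%:E < K)%E]]) He) /\
    (* (5) *)
    (given_by_diagram J Ht V1 V2 /\
     orth_sum J (fun p => Vpow H V1 V2 p @` kerV1s) Ht).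
Proof.
move=> _ nodet uU1 uU2 U12 U1X U2X H V1 V2 kerV1s kerV2s K J.
have cE : seq_complete (L2 P R[i]^o) by exact: L2_seq_complete.
pose G := field_space P X; have cG : closed_subspace G by exact: clspan_csub.
have [U [hU Ue1 Ue2]] : exists U, [/\ unitary_group U,
    forall x, U (1, 0) x = extend G U1 x & forall x, U (0, 1) x = extend G U2 x].
  apply: unitary_group_of; [exact: extend_unitary|exact: extend_unitary|].
  by move=> x; exact: extend_comm.
pose f := rv_class P X.
have Gf q : G (f q) by apply: clspan_sub; exists q.
have Uf p q : U p (f q) = f (q - p).
  apply: (orbit_shift hU) => -[s t].
    by rewrite Ue1 extendE// [LHS]U1X /f; congr (rv_class _ _ (_, _)); rewrite subr0.
  by rewrite Ue2 extendE// [LHS]U2X /f; congr (rv_class _ _ (_, _)); rewrite subr0.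
(* (-1, 0) is the largest element of L, so L = (-1, 0) - J, and the past is spanned by the orbit of
   x0 over J. *)
pose x0 := f (-1, 0).
have HE : H = clspan [set U p x0 | p in lexJ].
  rewrite /H /past_space; congr clspan; apply/seteqP; split=> _ [q qJ <-].
    exists ((-1, 0) - q); last by rewrite Uf opprB addrC subrK.
    by move: qJ; rewrite lexJE /half_plane/= !subr0; case: q => k l /=; lia.
  exists ((-1, 0) - q); last by rewrite /x0 Uf.
  by move: qJ; rewrite lexJE /half_plane/= !subr0; case: q => k l /=; lia.
have HG : H `<=` G.
  by apply: clspan_min => // _ [q _ <-]; exact: Gf.
have V1E x : clspan [set U p x0 | p in lexJ] x -> V1 x = U (1, 0) x.
  by rewrite -HE => Hx; rewrite /V1 patchE mem_set// Ue1 extendE//; exact: HG.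
have V2E x : clspan [set U p x0 | p in lexJ] x -> V2 x = U (0, 1) x.
  by rewrite -HE => Hx; rewrite /V2 patchE mem_set// Ue2 extendE//; exact: HG.
have H_inf x : (forall n : nat, clspan [set U p x0 | p in lexJ] (U (0, - n%:Z) x)) -> x = 0.
  rewrite -HE => Hx; suff : [set 0] x by [].
  (* Shifting by n = |1 - j| brings all rows of L strictly below the row j, where the half-plane
     condition at (i, j) holds whatever the first coordinate; so x is in the past of every (i,
     j). *)
  rewrite -nodet => -[i j] _; have := Hx `|1 - j|%N; set n := `|1 - j|%N => Hn.
  have -> : x = U (0, n%:Z) (U (0, - n%:Z) x).
    by rewrite -(UD hU) (_ : _ + _ = 0) ?(U0 hU)//; congr pair; rewrite /=; lia.
  apply: (U_clspan hU) Hn; first exact: clspan_csub.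
  move=> _ [q qL <-]; rewrite -/(f q) Uf; apply: clspan_sub; exists (q - (0, n%:Z)) => //.
  by move: qL; rewrite /half_plane/= !subr0 /n; case: q => k l /=; lia.
exists (diagram_part U x0), (evanescent_part U x0).
rewrite /K /kerV2s /kerV1s HE; split; first exact: diagram_evanescent_sum.
split.
  split; first exact: diagram_part_reduces1.
  split; first exact: diagram_part_reduces2.
  split; first exact: evanescent_part_reduces1.
  exact: evanescent_part_reduces2.
split; first exact: diagram_part_tnu.
split; first by split; [exact: evanescent_part_unitary|exact: evanescent_part_shift].
split.
  exists (wandering2_vector U x0).
  by split; [exact: wandering2_cyclic|exact: evanescent_part_cyclic_sum].
split; first exact: diagram_part_given_by_diagram.
exact: diagram_part_Vpow_sum.
Qed.
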